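(* Let $M$ be a compact, oriented, $2$-dimensional Riemannian manifold and $(N,\omega)$ a symplectic manifold. Then every smooth map $\varphi:M\to N$ which is a critical point of $F$ has $\varphi^*\omega$ coclosed, i.e. $\delta\varphi^*\omega=0$ (and hence $\varphi$ minimizes $F$ in its homotopy class: $F(\varphi)\le F(\psi)$ for every smooth $\psi:M\to N$ homotopic to $\varphi$).
   Context: All maps are smooth; compact manifolds are without boundary. $\delta$ is the coderivative on differential forms of $(M,g)$, the formal $L^2$-adjoint of $d$. For a smooth map $\varphi:(M,g)\to(N,\omega)$, $F(\varphi)=\frac12\int_M\|\varphi^*\omega\|^2\,d\mathrm{vol}_g$, where $\|\cdot\|$ is the pointwise norm on $2$-forms induced by $g$ (for an orthonormal coframe $e^1,\dots,e^m$, the forms $e^i\wedge e^j$, $i<j$, are orthonormal). A map $\varphi$ is a critical point of $F$ if $\frac{d}{dt}F(\varphi_t)\big|_{t=0}=0$ for every smooth variation $\varphi_t$ of $\varphi=\varphi_0$. It is known (first variation formula) that this holds if and only if $d\varphi(\sharp\,\delta\varphi^*\omega)=0$ on $M$, where $\sharp:T^*M\to TM$ is the metric isomorphism. *)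

(* Defs.v *)
From HB Require Import structures.
From mathcomp Require Import all_boot all_order all_algebra.
From mathcomp Require Import all_classical all_reals all_analysis.
Set Implicit Arguments.
Unset Strict Implicit.
Unset Printing Implicit Defensive.
Import Order.TTheory GRing.Theory Num.Theory.
Import numFieldNormedType.Exports.
Local Open Scope classical_set_scope.
Local Open Scope ring_scope.

(* Conventions: tangent vectors are row vectors, and the Jacobian 'J f p of  *)
(* the library acts on them from the right ('d f p v = v *m 'J f p).  A      *)
(* tensor field on a manifold is a family of coefficient functions, one for  *)
(* each chart of the atlas, defined on the image of the chart and subject to *)
(* the usual transformation law.                                             *)

Section Smooth.
Context {R : realType} {V W : normedModType R}.

Fixpoint Ck_on (k : nat) (U : set V) (f : V -> W) : Prop :=
  match k with
  | 0 => forall x, U x -> {for x, continuous f}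
  | k'.+1 => (forall x, U x -> differentiable f x) /\
             (forall v : V, Ck_on k' U ('D_v f))
  end.

(* Only used for open sets U. *)
Definition smooth_on (U : set V) (f : V -> W) := forall k, Ck_on k U f.
End Smooth.

(* cinv is only relevant on the image of cdom. *)
Record chart (R : realType) (n : nat) (M : topologicalType) := Chart {
  cdom : set M;
  cmap : M -> 'rV[R]_n;
  cinv : 'rV[R]_n -> M;
  cdom_open : open cdom;
  cimg_open : open (cmap @` cdom);
  cmapK : forall x, cdom x -> cinv (cmap x) = x;
  cmap_continuous : forall x, cdom x -> {for x, continuous cmap};
  cinv_continuous : forall u, (cmap @` cdom) u -> {for u, continuous cinv} }.

Definition cimg (R : realType) (n : nat) (M : topologicalType)
  (c : chart R n M) : set 'rV[R]_n := cmap c @` cdom c.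

(* A smooth n-manifold (without boundary) structure on the space M. *)
Record manifold (R : realType) (n : nat) (M : topologicalType) := Manifold {
  atlas : set (chart R n M);
  manifold_hausdorff : hausdorff_space M;
  manifold_second_countable : @second_countable M;
  atlas_cover : forall x : M, exists c, atlas c /\ cdom c x;
  atlas_smooth : forall c d, atlas c -> atlas d ->
    smooth_on [set u | cimg c u /\ cdom d (cinv c u)] (cmap d \o cinv c) }.

(* Coefficients of a (not necessarily smooth or consistent) field of          *)
(* covectors, resp. of covariant 2-tensors.                                   *)
Notation coefs1 R n M := (chart R n M -> 'rV[R]_n -> 'rV[R]_n).
Notation coefs2 R n M := (chart R n M -> 'rV[R]_n -> 'M[R]_n).

Section Manifold.
Context {R : realType} {n : nat} {M : topologicalType}.
Implicit Types (A : manifold R n M) (c d : chart R n M).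

Definition chart_at A (x : M) : chart R n M := projT1 (cid (atlas_cover A x)).

Definition transition_jacobian c d (x : M) : 'M[R]_n :=
  'J (cmap d \o cinv c) (cmap c x).

(* The orientation is the one for which the charts of the atlas are positive. *)
Definition oriented A := forall c d x, atlas A c -> atlas A d ->
  cdom c x -> cdom d x -> 0 < \det (transition_jacobian c d x).

Record oneform A := OneForm {
  oneform_coef :> coefs1 R n M;
  oneform_smooth : forall c, atlas A c -> smooth_on (cimg c) (oneform_coef c);
  oneform_transform : forall c d x, atlas A c -> atlas A d ->
    cdom c x -> cdom d x ->
    oneform_coef c (cmap c x) =
      oneform_coef d (cmap d x) *m (transition_jacobian c d x)^T }.

Record tensor2 A := Tensor2 {
  tensor2_coef :> coefs2 R n M;
  tensor2_smooth : forall c, atlas A c -> smooth_on (cimg c) (tensor2_coef c);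
  tensor2_transform : forall c d x, atlas A c -> atlas A d ->
    cdom c x -> cdom d x ->
    tensor2_coef c (cmap c x) =
      transition_jacobian c d x *m tensor2_coef d (cmap d x)
        *m (transition_jacobian c d x)^T }.

Definition riemannian A (g : tensor2 A) := forall c u, atlas A c -> cimg c u ->
  (g c u)^T = g c u /\ forall v : 'rV[R]_n, v != 0 -> 0 < (v *m g c u *m v^T) 0 0.

Definition e_ (i : 'I_n) : 'rV[R]_n := delta_mx 0 i.

(* Exterior derivatives in coordinates:                                       *)
(* (d a)_ij = d_i a_j - d_j a_i,  (d w)_ijk = d_i w_jk + d_j w_ki + d_k w_ij. *)
Definition ext_d1 (a : coefs1 R n M) : coefs2 R n M := fun c u =>
  \matrix_(i, j) (('D_(e_ i) (a c) u) 0 j - ('D_(e_ j) (a c) u) 0 i).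

Definition ext_d2 (w : coefs2 R n M) c (u : 'rV[R]_n) (i j k : 'I_n) : R :=
  ('D_(e_ i) (w c) u) j k + ('D_(e_ j) (w c) u) k i + ('D_(e_ k) (w c) u) i j.

Definition symplectic A (w : tensor2 A) := forall c u, atlas A c -> cimg c u ->
  [/\ (w c u)^T = - w c u,
      forall i j k, ext_d2 w c u i j k = 0 &
      forall v : 'rV[R]_n, v *m w c u = 0 -> v = 0].

(* Pointwise inner products induced by g on 1-forms, <a, b> = g^{ij} a_i b_j, *)
(* and on 2-forms, <a, b> = \sum_(i < j) a_ij b^{ij} with                     *)
(* b^{ij} = g^{ik} g^{jl} b_kl; for the latter the products e^i /\ e^j        *)
(* (i < j) of an orthonormal coframe are orthonormal.                         *)
Definition inner1 A (g : tensor2 A) (a b : coefs1 R n M) (x : M) : R :=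
  let c := chart_at A x in let u := cmap c x in
  (a c u *m invmx (g c u) *m (b c u)^T) 0 0.

Definition inner2 A (g : tensor2 A) (a b : coefs2 R n M) (x : M) : R :=
  let c := chart_at A x in let u := cmap c x in
  \sum_(i < n) \sum_(j < n | (i < j)%N)
    a c u i j * (invmx (g c u) *m b c u *m invmx (g c u)) i j.

End Manifold.

Section Maps.
Context {R : realType} {m n : nat} {M N : topologicalType}.
Variables (A : manifold R m M) (B : manifold R n N).

Definition smooth_map (phi : M -> N) := continuous phi /\
  forall c d, atlas A c -> atlas B d ->
    smooth_on [set u | cimg c u /\ cdom d (phi (cinv c u))]
              (cmap d \o phi \o cinv c).

(* (t, x) |-> Phi t x is a smooth map ]-eps, eps[ * M -> N with Phi 0 = phi. *)
Definition smooth_variation (phi : M -> N) (eps : R) (Phi : R -> M -> N) :=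
  [/\ Phi 0 = phi,
      forall t x, `|t| < eps ->
        {for (t, x), continuous (fun p : R * M => Phi p.1 p.2)} &
      forall c d, atlas A c -> atlas B d ->
        smooth_on [set p : R * 'rV[R]_m | [/\ `|p.1| < eps, cimg c p.2 &
                                            cdom d (Phi p.1 (cinv c p.2))]]
                  (fun p : R * 'rV[R]_m => cmap d (Phi p.1 (cinv c p.2)))].

Definition pullback (phi : M -> N) (w : tensor2 B) : coefs2 R m M := fun c u =>
  let y := phi (cinv c u) in
  let d := chart_at B y in
  let J := 'J (cmap d \o phi \o cinv c) u in
  J *m w d (cmap d y) *m J^T.

Definition homotopic (phi psi : M -> N) := exists H : R -> M -> N,
  [/\ {within `[0, 1] `*` [set: M], continuous (fun p : R * M => H p.1 p.2)},
      H 0 = phi & H 1 = psi].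

End Maps.

Section Surface.
Context {R : realType} {M : ptopologicalType}.

Definition borel_space := g_sigma_algebraType (@open M).

Definition rV2 (p : R * R) : 'rV[R]_2 := \row_i (if i == 0 then p.1 else p.2).

(* mu is the Riemannian measure dvol_g: the (unique) Borel measure whose      *)
(* density with respect to Lebesgue measure is sqrt (det g) in every chart.   *)
Definition riemannian_volume (A : manifold R 2 M) (g : tensor2 A)
    (mu : {measure set borel_space -> \bar R}) :=
  forall (c : chart R 2 M) (X : set borel_space), atlas A c ->
    measurable X -> X `<=` cdom c ->
    mu X = (\int[(@lebesgue_measure R \x @lebesgue_measure R)]_(p in
              [set p : R * R | (cmap c @` X) (rV2 p)])
              (Num.sqrt (\det (g c (rV2 p))))%:E)%E.

Variables (A : manifold R 2 M) (g : tensor2 A)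
          (mu : {measure set borel_space -> \bar R}).

(* sigma = delta beta, for delta the formal L^2-adjoint of d; since M is      *)
(* going to be compact, all 1-forms are allowed as test forms.                *)
Definition is_coderivative (beta : coefs2 R 2 M) (sigma : oneform A) :=
  forall alpha : oneform A,
    \int[mu]_x inner2 g (ext_d1 alpha) beta x =
    \int[mu]_x inner1 g alpha sigma x.

Definition coclosed (beta : coefs2 R 2 M) :=
  exists2 sigma : oneform A, is_coderivative beta sigma &
    forall c u, atlas A c -> cimg c u -> sigma c u = 0.

Context {n : nat} {N : topologicalType} (B : manifold R n N) (w : tensor2 B).

Definition energy (phi : M -> N) : R :=
  2^-1 * \int[mu]_x inner2 g (pullback phi w) (pullback phi w) x.

Definition critical_point (phi : M -> N) :=
  forall (eps : R) (Phi : R -> M -> N), 0 < eps ->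
    smooth_variation A B phi eps Phi ->
    is_derive (0 : R) (1 : R) (fun t => energy (Phi t)) 0.

End Surface.
Arguments borel_space : clear implicits.

(* Main.v *)
(* Write phi^*w = f dvol_g.  Precomposing phi with diffeomorphisms of M gives  *)
(* variations for which F changes like \int f^2 / J, and criticality for these *)
(* already forces d(f^2) = 0, hence f is locally constant.  By Stokes,         *)
(* <d alpha, phi^*w> = f d alpha then integrates to 0 for every 1-form alpha,  *)
(* which is coclosedness.  For the same reason                                 *)
(* I(psi) = \int <psi^*w, phi^*w> = \int f psi^*w only depends on the homotopy *)
(* class of psi: w being closed, psi^*w changes by an exact form when psi is   *)
(* moved along coordinate segments inside a chart of N, and smooth maps close  *)
(* to the successive stages of a continuous homotopy are joined by finitely    *)
(* many such moves, each supported in a small box of M.  Finally               *)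
(* |psi^*w|^2 >= 2 <psi^*w, phi^*w> - |phi^*w|^2 yields                        *)
(* F(psi) - F(phi) >= I(psi) - I(phi) = 0.                                     *)
Require Import Defs.
From HB Require Import structures.
From mathcomp Require Import all_boot all_order all_algebra.
From mathcomp Require Import all_classical all_reals all_analysis.
From mathcomp Require Import measurable_realfun ring lra.
Set Implicit Arguments.
Unset Strict Implicit.
Unset Printing Implicit Defensive.
Import Order.TTheory GRing.Theory Num.Theory.
Import numFieldNormedType.Exports.
Local Open Scope classical_set_scope.
Local Open Scope ring_scope.


(** * Smooth functions on normed spaces *)

(** On a surface [phi^*w] has a single coefficient F in a chart. Writing s for [sqrtg], the square
    root of det g, one has F = f s with f the [density], and the energy is one half of the integral
    of f^2 s. Coclosedness means that f is locally constant, and minimality follows from that as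
    well.

    Criticality is tested on variations coming from the source. Inside a coordinate box with bump b,
    phi is precomposed with u -> u + t b(u) e_i. The Jacobian determinant of this map is 1 + t D_i
    b, so the coefficient becomes F(u + t b e_i) (1 + t D_i b). Differentiating the energy at t = 0
    and removing the total derivative D_i (2 f^2 s b), whose integral is 0, leaves the integral of
    -2 b s f D_i f ([first_variation]). Bumps exist around every point at every small scale, so f
    D_i f = 0 ([density_mul_derive0]). Then D_i f = 0, because f would vanish on the open set where
    D_i f does not ([density_derive0]).

    Against a 1-form alpha, the integrand <d alpha, phi^*w> dvol is locally a constant times d
    alpha. Cutoffs reduce its integral to one box, where it is a divergence of functions vanishing
    on the boundary ([stokes_form]). Hence the zero form is the coderivative ([pullback_coclosed]).

    Minimality is a calibration argument for the linear functional [pairing]. Along y_s = y_0 + s W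
    in a chart of N, closedness of w gives d/ds y_s^*w = d (y_s^* i_W w) ([segment_form_derive]),
    and integrating against the locally constant f gives 0 ([segment_integral], [pairing_step]). The
    stages of a merely continuous homotopy are approximated by smooth maps ([smooth_map_dense]). Two
    smooth maps close to the same stage are joined by finitely many chart moves
    ([pairing_locally_constant]), so the pairing is constant along the homotopy
    ([pairing_homotopic]). Expanding the integral of |psi^*w - phi^*w|^2 >= 0 then gives
    [energy_homotopic]. *)

Section Differentiability.
Context {R : realType}.
Implicit Types U V W : normedModType R.

Lemma near0_differentiable V W (h : V -> W) x :
  (\forall y \near x, h y = 0) -> differentiable h x.
Proof.
move=> h0.
have hx0 : h x = 0 by apply: nbhs_singleton h0.
have hs : h \o shift x = cst (h x) + (\0 : {linear V -> W}) +o_ (0 : V) id.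
  apply/eqaddoP => _/posnumP[e]; near=> y.
  have -> : (h \o shift x - (cst (h x) + (\0 : {linear V -> W}))) y = h (y + x) - (h x + 0) by [].
  rewrite hx0 addr0 subr0.
  suff -> : h (y + x) = 0 by rewrite normr0 mulr_ge0.
  by near: y; move: h0; rewrite (near_shift 0) /=; apply: filterS => y; rewrite subr0.
have c0 : continuous (\0 : {linear V -> W}) by move=> ?; apply: cst_continuous.
have dh : 'd h x = (\0 : {linear V -> W}) :> (V -> W) by apply: diff_unique.
by apply/diff_locallyP; rewrite dh.
Unshelve. all: by end_near. Qed.

(** Differentiability only depends on the germ: [g - f] vanishes near [x], hence is differentiable
    there with zero differential, and [g] is its sum with [f]. *)
Lemma near_eq_differentiable V W (f g : V -> W) x :
  (\forall y \near x, f y = g y) -> differentiable f x -> differentiable g x.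
Proof.
move=> fg df.
have -> : g = f + (g - f) by apply/funext => y; rewrite !fctE addrC subrK.
apply: differentiableD => //; apply: near0_differentiable.
by apply: filterS fg => y /= fgy; rewrite !fctE fgy subrr.
Qed.

Lemma scale_bilinear W :
  bilinear_for
    (GRing.Scale.Law.clone _ _ *:%R _) (GRing.Scale.Law.clone _ _ *:%R _)
    (@GRing.scale R W).
Proof.
split=> [u'|u] a x y /=; first by rewrite scalerDl scalerA.
by rewrite scalerDr !scalerA mulrC.
Qed.

Lemma is_diff_scale V W (k : V -> R) (f : V -> W) x :
  differentiable k x -> differentiable f x ->
  is_diff x (fun y => k y *: f y) (fun v => k x *: 'd f x v + 'd k x v *: f x).
Proof.
move=> dk df.
pose sB := bilinear_isBilinear.Build R R W W _ _ (@GRing.scale R W) (scale_bilinear W).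
pose sc : {bilinear R -> W -> W} := HB.pack (@GRing.scale R W) sB.
have cs : continuous (fun p : R * W => sc p.1 p.2) by exact: scale_continuous.
have ds p := differentiable_bilin p cs.
have dp := differentiable_pair dk df.
have E : (fun y => k y *: f y) = (fun p => sc p.1 p.2) \o (fun y => (k y, f y)) by [].
split; rewrite E; first exact: differentiable_comp.
by rewrite diff_comp// diff_pair// diff_bilin.
Qed.

Lemma differentiable_scale V W (k : V -> R) (f : V -> W) x :
  differentiable k x -> differentiable f x -> differentiable (fun y => k y *: f y) x.
Proof. by move=> dk df; have [] := is_diff_scale dk df. Qed.

Lemma derive_scale V W (k : V -> R) (f : V -> W) x v :
  differentiable k x -> differentiable f x ->
  'D_v (fun y => k y *: f y) x = 'D_v k x *: f x + k x *: 'D_v f x.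
Proof.
move=> dk df; have [h1 h2] := is_diff_scale dk df.
by rewrite !deriveE// h2 addrC.
Qed.

Lemma derive_comp U V W (f : U -> V) (g : V -> W) x v :
  differentiable f x -> differentiable g (f x) ->
  'D_v (g \o f) x = 'D_('D_v f x) g (f x).
Proof.
move=> df dg; rewrite !deriveE//; last exact: differentiable_comp.
by rewrite diff_comp.
Qed.

Lemma derive_linear V W (L : {linear V -> W}) x v :
  continuous L -> 'D_v L x = L v.
Proof. by move=> cL; rewrite deriveE ?diff_lin//; exact: linear_differentiable. Qed.

Lemma deriveDir_sum V W (f : V -> W) x n (a : 'I_n -> R) (v : 'I_n -> V) :
  differentiable f x ->
  'D_(\sum_i a i *: v i) f x = \sum_i a i *: 'D_(v i) f x.
Proof.
move=> df; rewrite deriveE// linear_sum; apply: eq_bigr => i _.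
by rewrite linearZ deriveE.
Qed.

End Differentiability.

(** * Calculus of smooth functions on open sets and at points *)

Section SmoothCalculus.
Context {R : realType}.
Implicit Types U V W : normedModType R.

Lemma near_open_nbhs V (P : V -> Prop) x : (\forall y \near x, P y) ->
  exists2 A, open_nbhs x A & forall y, A y -> P y.
Proof. by rewrite -nbhs_nearE nbhsE => -[A nA AP]; exists A. Qed.

Lemma Ck_on_succ V W k (A : set V) (f : V -> W) : Ck_on k.+1 A f ->
  (forall x, A x -> differentiable f x) /\ (forall v, Ck_on k A ('D_v f)).
Proof. by []. Qed.

Lemma Ck_onS V W k (A : set V) (f : V -> W) : Ck_on k.+1 A f -> Ck_on k A f.
Proof.
elim: k f => [|k IH] f /Ck_on_succ[d D]; first by move=> x Ax; exact/differentiable_continuous/d.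
by split=> // v; apply: IH; exact: D.
Qed.

Lemma Ck_on_sub V W k (A B : set V) (f : V -> W) :
  A `<=` B -> Ck_on k B f -> Ck_on k A f.
Proof.
move=> AB; elim: k f => [|k IH] f /=; first by move=> cf x /AB; exact: cf.
by move=> [d D]; split=> [x /AB/d//|v]; exact/IH/D.
Qed.

Lemma Ck_on_setU V W k I (A : I -> set V) (f : V -> W) :
  (forall i, Ck_on k (A i) f) -> Ck_on k (\bigcup_i A i) f.
Proof.
elim: k f => [|k IH] f H /=; first by move=> x [i _ Ax]; exact: H Ax.
split=> [x [i _ Ax]|v]; first by have [d _] := H i; exact: d.
by apply: IH => i; have [_ D] := H i; exact: D.
Qed.

(** Openness of [A] is essential: the derivatives of [f] and [g] agree at a point only because the
    functions agree on a neighbourhood of it. *)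
Lemma Ck_on_eq V W k (A : set V) (f g : V -> W) : open A ->
  (forall x, A x -> f x = g x) -> Ck_on k A f -> Ck_on k A g.
Proof.
move=> oA; elim: k f g => [|k IH] f g fg.
  move=> cf x Ax.
  have nA : \forall y \near x, f y = g y.
    by apply: filterS (open_nbhs_nbhs (conj oA Ax)) => y /fg.
  have := cf x Ax; rewrite /prop_for /continuous_at -(fg _ Ax).
  by apply: cvg_trans; apply: near_eq_cvg; apply: filterS nA.
have nA x : A x -> \forall y \near x, f y = g y.
  by move=> Ax; apply: filterS (open_nbhs_nbhs (conj oA Ax)) => y /fg.
move=> [d D]; split=> [x Ax|v].
  exact: near_eq_differentiable (nA x Ax) (d x Ax).
by apply: IH (D v) => x Ax; apply: near_eq_derive; exact: nA.
Qed.

Lemma Ck_on_cst V W k (A : set V) (w : W) : Ck_on k A (cst w).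
Proof.
elim: k w => [|k IH] w /=; first by move=> x _; apply: cst_continuous.
split=> [x _|v]; first exact: differentiable_cst.
have -> : 'D_v (cst w) = cst 0 :> (V -> W) by apply/funext => x; exact: derive_cst.
exact: IH.
Qed.

Lemma Ck_on_linear V W k (A : set V) (L : {linear V -> W}) :
  continuous L -> Ck_on k A L.
Proof.
move=> cL; case: k => [|k] /=; first by move=> x _; exact: cL.
split=> [x _|v]; first exact: linear_differentiable.
have -> : 'D_v L = cst (L v) by apply/funext => x; exact: derive_linear.
exact: Ck_on_cst.
Qed.

Lemma Ck_on_linear_comp U V W k (A : set U) (L : {linear V -> W}) (f : U -> V) :
  open A -> continuous L -> Ck_on k A f -> Ck_on k A (L \o f).
Proof.
move=> oA cL; elim: k f => [|k IH] f.
  by move=> cf x Ax; apply: continuous_comp; [exact: cf|exact: cL].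
move=> /Ck_on_succ[d D]; have dL y : differentiable L y by exact: linear_differentiable.
split=> [x Ax|v]; first by apply: differentiable_comp => //; exact: d.
apply: (@Ck_on_eq _ _ _ _ (L \o 'D_v f)) => // [x Ax|]; last exact: IH (D v).
by rewrite derive_comp ?derive_linear//; exact: d.
Qed.

(** For an affine inner map the chain rule is D_v (f(a + L u)) = (D_(L v) f)(a + L u), which again
    has the same shape, so no coordinates in [V] are called for. It serves to restrict functions on
    a product to the slices of one factor. *)
Lemma Ck_on_comp_affine U V W k (B : set V) (L : {linear U -> V}) a (f : V -> W) :
  continuous L -> open B -> Ck_on k B f ->
  Ck_on k [set u | B (a + L u)] (fun u => f (a + L u)).
Proof.
move=> cL oB.
have da x : is_diff x (fun u => a + L u) L.
  split.
    apply: (@differentiableD _ _ _ (cst a) L); first exact: differentiable_cst.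
    exact: linear_differentiable.
  rewrite (_ : (fun u => a + L u) = cst a + L) // diffD//; last exact: linear_differentiable.
  by apply/funext => y; rewrite diff_cst diff_lin //= add0r.
have dd x : differentiable (fun u => a + L u) x by have [] := da x.
have oA : open [set u | B (a + L u)].
  by apply: open_comp oB => x _; exact: differentiable_continuous.
elim: k f => [|k IH] f.
  move=> cf x Bx; apply: (@continuous_comp _ _ _ (fun u => a + L u) f); last exact: cf.
  exact: differentiable_continuous.
move=> /Ck_on_succ[d D]; split=> [x Bx|v].
  by apply: (@differentiable_comp _ _ _ _ (fun u => a + L u) f) => //; exact: d.
apply: Ck_on_eq oA _ (IH _ (D (L v))) => x Bx.
rewrite [RHS](@derive_comp _ _ _ _ (fun u => a + L u) f) //; last exact: d.
by congr ('D__ f _); rewrite deriveE//; have [_ ->] := da x.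
Qed.

Lemma Ck_onD V W k (A : set V) (f g : V -> W) : open A ->
  Ck_on k A f -> Ck_on k A g -> Ck_on k A (f + g).
Proof.
move=> oA; elim: k f g => [|k IH] f g.
  by move=> cf cg x Ax; apply: continuousD; [exact: cf|exact: cg].
move=> /Ck_on_succ[df Df] /Ck_on_succ[dg Dg]; split=> [x Ax|v]; first by apply: differentiableD;
  auto.
apply: Ck_on_eq oA _ (IH _ _ (Df v) (Dg v)) => x Ax.
by rewrite deriveD//; apply: diff_derivable; auto.
Qed.

Lemma Ck_on_scale V W k (A : set V) (h : V -> R) (f : V -> W) : open A ->
  Ck_on k A h -> Ck_on k A f -> Ck_on k A (fun x => h x *: f x).
Proof.
move=> oA; elim: k h f => [|k IH] h f.
  by move=> ch cf x Ax; apply: continuousZ; [exact: ch|exact: cf].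
move=> Ch Cf; have [dh Dh] := Ck_on_succ Ch; have [df Df] := Ck_on_succ Cf.
split=> [x Ax|v]; first by apply: differentiable_scale; auto.
apply: (@Ck_on_eq _ _ _ _ ((fun x => 'D_v h x *: f x) + (fun x => h x *: 'D_v f x))) => //.
  by move=> x Ax; rewrite derive_scale; auto.
apply: Ck_onD => //; apply: IH => //; [exact: Ck_onS Cf|exact: Ck_onS Ch].
Qed.

Lemma Ck_on_sum V W k (A : set V) n (f : 'I_n -> V -> W) : open A ->
  (forall i, Ck_on k A (f i)) -> Ck_on k A (fun x => \sum_i f i x).
Proof.
move=> oA; elim: n f => [|n IH] f H.
  apply: Ck_on_eq oA _ (Ck_on_cst k A 0) => x _; by rewrite big_ord0.
apply: (Ck_on_eq oA _ (Ck_onD oA (IH _ (fun i => H _)) (H ord_max))) => x _.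
by rewrite big_ord_recr.
Qed.

(* A chain rule for the iterated directional derivatives needs coordinates in *)
(* the intermediate space.                                                     *)
Definition has_basis V :=
  exists n, exists e : 'I_n -> V, exists l : 'I_n -> {linear V -> R},
    (forall i, continuous (l i)) /\ forall v, v = \sum_i l i v *: e i.

Lemma has_basis_R : has_basis R.
Proof.
exists 1%N, (fun=> 1), (fun=> idfun); split=> [i x|v]; first exact: cvg_id.
by rewrite big_ord1 /= /GRing.scale /= mulr1.
Qed.

Lemma coordL_linear n (i : 'I_n) : linear (fun v : 'rV[R]_n => v 0 i).
Proof. by move=> a u v; rewrite !mxE. Qed.

Lemma has_basis_rV n : has_basis 'rV[R]_n.
Proof.
pose l (i : 'I_n) : {linear 'rV[R]_n -> R} :=
  HB.pack (fun v : 'rV[R]_n => v 0 i) (GRing.isLinear.Build _ _ _ _ _ (coordL_linear i)).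
exists n, (fun i => delta_mx 0 i), l; split=> [i|v]; first exact: coord_continuous.
by rewrite [LHS]row_sum_delta.
Qed.

(** In coordinates D_v (g o f) is the sum of the l_i(D_v f) (D_(e_i) g o f), a combination of
    products of functions with one derivative less, to which the induction applies. *)
Lemma Ck_on_comp U V W k (A : set U) (B : set V) (f : U -> V) (g : V -> W) :
  has_basis V -> open A -> open B -> (forall x, A x -> B (f x)) ->
  Ck_on k A f -> Ck_on k B g -> Ck_on k A (g \o f).
Proof.
move=> [n [e [l [cl el]]]] oA oB AB; elim: k f g AB => [|k IH] f g AB.
  by move=> cf cg x Ax; apply: continuous_comp; [exact: cf|exact/cg/AB].
move=> Cf Cg; have [df Df] := Ck_on_succ Cf; have [dg Dg] := Ck_on_succ Cg.
split=> [x Ax|v]; first by apply: differentiable_comp; [exact: df|exact/dg/AB].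
apply: (@Ck_on_eq _ _ _ _ (fun x => \sum_i l i ('D_v f x) *: ('D_(e i) g \o f) x)) => //.
  move=> x Ax; rewrite derive_comp; [|exact: df|exact/dg/AB].
  by rewrite [in RHS](el ('D_v f x)) deriveDir_sum//; exact/dg/AB.
apply: Ck_on_sum => // i; apply: Ck_on_scale => //.
  exact: (Ck_on_linear_comp (L := l i) oA (cl i) (Df v)).
by apply: IH => //; exact: Ck_onS Cf.
Qed.

(** The derivative of 1/f is a product of -D_v f with two copies of 1/f, so the regularity of 1/f
    bootstraps. The square root below is handled alike, its derivative being D_v f over twice the
    root itself. *)
Lemma Ck_on_inv V k (A : set V) (f : V -> R) : open A ->
  (forall x, A x -> f x != 0) -> Ck_on k A f -> Ck_on k A (fun x => (f x)^-1).
Proof.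
move=> oA f0; elim: k => [|k IH].
  by move=> cf x Ax; apply: continuousV; [exact: f0|exact: cf].
move=> Cf; have [df Df] := Ck_on_succ Cf.
split=> [x Ax|v].
  by apply: differentiableV; [exact: df|exact: f0].
have Ci := IH (Ck_onS Cf).
apply: (@Ck_on_eq _ _ _ _ (fun x => (f x)^-1 *: ((f x)^-1 *: (- 'D_v f x)))) => //.
  move=> x Ax; rewrite deriveV; [|exact: f0|exact/diff_derivable/df].
  by rewrite !scalerN scaleNr scalerA expr2 invfM.
apply: Ck_on_scale => //; apply: Ck_on_scale => //.
apply: (@Ck_on_eq _ _ _ _ (fun x => (- 1 : R) *: 'D_v f x)) => //.
  by move=> x Ax; rewrite scaleN1r.
by apply: Ck_on_scale => //; exact: Ck_on_cst.
Qed.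

Lemma Ck_on_sqrt V k (A : set V) (f : V -> R) : open A ->
  (forall x, A x -> 0 < f x) -> Ck_on k A f -> Ck_on k A (fun x => Num.sqrt (f x)).
Proof.
move=> oA f0; elim: k => [|k IH].
  move=> cf x Ax; apply: (@continuous_comp _ _ _ f Num.sqrt); first exact: cf.
  exact: sqrt_continuous.
move=> Cf; have [df Df] := Ck_on_succ Cf.
have ds (y : R) : 0 < y -> differentiable (Num.sqrt : R -> R) y.
  by move=> y0; apply/derivable1_diffP; have [] := is_derive1_sqrt y0.
split=> [x Ax|v].
  by apply: (@differentiable_comp _ _ _ _ f Num.sqrt); [exact: df|exact/ds/f0].
have Ci := IH (Ck_onS Cf).
apply: (@Ck_on_eq _ _ _ _ (fun x => (2 *: Num.sqrt (f x))^-1 *: ('D_v f x))) => //.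
  move=> x Ax; rewrite (@derive_comp _ _ _ _ f Num.sqrt); [|exact: df|exact/ds/f0].
  rewrite -[in RHS](mulr1 ('D_v f x)) -[_ * 1]/(_ *: (1 : R^o)) !deriveE; [|exact/ds/f0|exact: df].
  rewrite linearZ /= -(deriveE (1 : R) (ds _ (f0 _ Ax))).
  have [_ ->] := is_derive1_sqrt (f0 _ Ax).
  by rewrite /GRing.scale /= mulrC.
apply: Ck_on_scale => //; apply: Ck_on_inv => //.
  by move=> x Ax; rewrite /GRing.scale /= mulf_neq0// gt_eqF// sqrtr_gt0 f0.
by apply: Ck_on_scale => //; exact: Ck_on_cst.
Qed.

(** Pointwise version of [smooth_on]. Smoothness of a function defined chart by chart is then proved
    separately at each point, with no common domain to carry along. *)
Variant smooth_at V W (f : V -> W) (x : V) : Prop :=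
  SmoothAt A of open_nbhs x A & smooth_on A f.

Lemma smooth_onP V W (A : set V) (f : V -> W) : open A ->
  smooth_on A f <-> forall x, A x -> smooth_at f x.
Proof.
move=> oA; split=> [sf x Ax|H k]; first by exists A.
have H' x : A x -> exists2 B, open_nbhs x B & smooth_on B f by move=> /H[B]; exists B.
pose B (i : {x | A x}) := projT1 (cid2 (H' _ (projT2 i))).
have C : Ck_on k (\bigcup_i B i) f.
  by apply: Ck_on_setU => i; rewrite /B; case: cid2 => ? ? /=; apply.
apply: Ck_on_sub C => x Ax; exists (exist _ x Ax) => //; rewrite /B.
by case: cid2 => ? [].
Qed.

Lemma smooth_at_near V W (f : V -> W) x : smooth_at f x -> \forall y \near x, smooth_at f y.
Proof.
by move=> [A Ax sf]; apply: filterS (open_nbhs_nbhs Ax) => y Ay; exists A => //; split => //;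
  case: Ax.
Qed.

Lemma smooth_at_eq V W (f g : V -> W) x :
  (\forall y \near x, f y = g y) -> smooth_at f x -> smooth_at g x.
Proof.
move=> /near_open_nbhs[B [oB Bx] fg] [A [oA Ax] sf].
have oAB := openI oA oB.
exists (A `&` B) => // k; apply: (@Ck_on_eq _ _ _ _ f) => // [y [_ /fg]//|].
by apply: Ck_on_sub (sf k) => y [].
Qed.

Lemma smooth_at_diff V W (f : V -> W) x : smooth_at f x -> differentiable f x.
Proof. by move=> [A [oA Ax] sf]; have [d _] := sf 1%N; exact: d. Qed.

Lemma smooth_at_derivable V W (f : V -> W) x v : smooth_at f x -> derivable f x v.
Proof. by move=> /smooth_at_diff; exact: diff_derivable. Qed.

Lemma smooth_at_cont V W (f : V -> W) x : smooth_at f x -> {for x, continuous f}.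
Proof. by move=> /smooth_at_diff; exact: differentiable_continuous. Qed.

Lemma smooth_at_derive V W (f : V -> W) x v : smooth_at f x -> smooth_at ('D_v f) x.
Proof. by move=> [A nA sf]; exists A => // k; have [_ D] := sf k.+1; exact: D. Qed.

Lemma smooth_at_cst V W (w : W) (x : V) : smooth_at (fun _ => w) x.
Proof. by exists setT; [split=> //; exact: openT|move=> k; exact: Ck_on_cst]. Qed.

Lemma smooth_at_linear V W (L : {linear V -> W}) x : continuous L -> smooth_at L x.
Proof. by exists setT; [split=> //; exact: openT|move=> k; exact: Ck_on_linear]. Qed.

Lemma smooth_at_id V (x : V) : smooth_at (fun y => y) x.
Proof. by apply: (smooth_at_linear (L := idfun)) => y; exact: cvg_id. Qed.

Lemma smooth_at_linear_comp U V W (L : {linear V -> W}) (f : U -> V) x :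
  continuous L -> smooth_at f x -> smooth_at (fun y => L (f y)) x.
Proof.
move=> cL [A [oA Ax] sf]; exists A => // k.
by apply: Ck_on_linear_comp => //; exact: sf.
Qed.

Lemma smooth_at_comp_affine U V W (L : {linear U -> V}) a (f : V -> W) x :
  continuous L -> smooth_at f (a + L x) -> smooth_at (fun u => f (a + L u)) x.
Proof.
move=> cL [A [oA Ax] sf]; exists [set u | A (a + L u)].
  split=> //; apply: open_comp oA => y _; apply: cvgD; first exact: cvg_cst.
  exact: cL.
by move=> k; exact: Ck_on_comp_affine.
Qed.

Lemma smooth_at_fst V W (p : V * W) : smooth_at (fun q : V * W => q.1) p.
Proof. by apply: (smooth_at_linear (L := fst)) => q; exact: cvg_fst. Qed.

Lemma smooth_at_snd V W (p : V * W) : smooth_at (fun q : V * W => q.2) p.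
Proof. by apply: (smooth_at_linear (L := snd)) => q; exact: cvg_snd. Qed.

Lemma smooth_at_pairr U V W (f : V * U -> W) (v : V) (u : U) :
  smooth_at f (v, u) -> smooth_at (fun u => f (v, u)) u.
Proof.
have lin : linear (fun u : U => (0, u) : V * U).
  by move=> k w w'; congr pair => /=; rewrite scaler0 addr0.
pose L : {linear U -> (V * U)%type} :=
  HB.pack (fun u : U => (0, u) : V * U) (GRing.isLinear.Build _ _ _ _ _ lin).
have cL : continuous L.
  move=> w; apply/differentiable_continuous/differentiable_pair; first exact: differentiable_cst.
  by have [] := is_diff_id w.
have Lt w : (v, 0) + L w = (v, w) by congr pair => /=; rewrite ?addr0 ?add0r.
move=> sf; have sL : smooth_at (fun w => f ((v, 0) + L w)) u.
  by apply: smooth_at_comp_affine => //; rewrite Lt.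
have -> : (fun w => f (v, w)) = (fun w => f ((v, 0) + L w)) by apply/funext => w; rewrite Lt.
exact: sL.
Qed.

Lemma smooth_at2 V W W1 W2 (op : (V -> W1) -> (V -> W2) -> V -> W) (x : V) f g :
  (forall k A f g, open A -> Ck_on k A f -> Ck_on k A g -> Ck_on k A (op f g)) ->
  smooth_at f x -> smooth_at g x -> smooth_at (op f g) x.
Proof.
move=> H [A [oA Ax] sf] [B [oB Bx] sg].
have oAB := openI oA oB.
exists (A `&` B) => // k; apply: H => //; [apply: Ck_on_sub (sf k)|apply: Ck_on_sub (sg k)];
by move=> y [].
Qed.

Lemma smooth_atD V W (f g : V -> W) x :
  smooth_at f x -> smooth_at g x -> smooth_at (fun y => f y + g y) x.
Proof. by apply: (@smooth_at2 _ _ _ _ (fun f g y => f y + g y)) => k A {}f {}g oA;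
  exact: Ck_onD. Qed.

Lemma smooth_atZ V W (f : V -> R) (g : V -> W) x :
  smooth_at f x -> smooth_at g x -> smooth_at (fun y => f y *: g y) x.
Proof.
apply: (@smooth_at2 V W R W (fun f g y => f y *: g y)) => k A f1 g1 oA.
exact: Ck_on_scale.
Qed.

Lemma smooth_atM V (f g : V -> R) x :
  smooth_at f x -> smooth_at g x -> smooth_at (fun y => f y * g y) x.
Proof. exact: smooth_atZ. Qed.

Lemma smooth_atN V W (f : V -> W) x : smooth_at f x -> smooth_at (fun y => - f y) x.
Proof.
move=> sf; have -> : (fun y => - f y) = (fun y => (- 1 : R) *: f y).
  by apply/funext => y; rewrite scaleN1r.
by apply: smooth_atZ => //; exact: smooth_at_cst.
Qed.

Lemma smooth_atB V W (f g : V -> W) x :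
  smooth_at f x -> smooth_at g x -> smooth_at (fun y => f y - g y) x.
Proof. by move=> sf sg; apply: smooth_atD => //; exact: smooth_atN. Qed.

Lemma smooth_at_sum V W n (f : 'I_n -> V -> W) x :
  (forall i, smooth_at (f i) x) -> smooth_at (fun y => \sum_i f i y) x.
Proof.
elim: n f => [|n IH] f H.
  have -> : (fun y => \sum_i f i y) = (fun _ => 0) by apply/funext => y; rewrite big_ord0.
  exact: smooth_at_cst.
have -> : (fun y => \sum_i f i y) =
    (fun y => (\sum_(i < n) f (widen_ord (leqnSn n) i) y) + f ord_max y).
  by apply/funext => y; rewrite big_ord_recr.
by apply: smooth_atD => //; apply: IH => i.
Qed.

Lemma smooth_atV V (f : V -> R) x : f x != 0 -> smooth_at f x ->
  smooth_at (fun y => (f y)^-1) x.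
Proof.
move=> fx0 [A [oA Ax] sf].
have : \forall y \near x, f y != 0.
  have : f @ x --> f x by apply: smooth_at_cont; exists A.
  by move/cvgr_neq0; apply.
move=> /near_open_nbhs[B [oB Bx] Bf].
have oAB := openI oA oB.
exists (A `&` B) => // k; apply: Ck_on_inv => // [y [_ /Bf]//|].
by apply: Ck_on_sub (sf k) => y [].
Qed.

Lemma smooth_at_sqrt V (f : V -> R) x : 0 < f x -> smooth_at f x ->
  smooth_at (fun y => Num.sqrt (f y)) x.
Proof.
move=> fx0 [A [oA Ax] sf].
have : \forall y \near x, 0 < f y.
  have : f @ x --> f x by apply: smooth_at_cont; exists A.
  by move/cvgr_gt; apply.
move=> /near_open_nbhs[B [oB Bx] Bf].
have oAB := openI oA oB.
exists (A `&` B) => // k; apply: Ck_on_sqrt => // [y [_ /Bf]//|].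
by apply: Ck_on_sub (sf k) => y [].
Qed.

Lemma smooth_at_comp U V W (f : U -> V) (g : V -> W) x : has_basis V ->
  smooth_at f x -> smooth_at g (f x) -> smooth_at (fun y => g (f y)) x.
Proof.
move=> bV sf [B [oB Bx] sg].
have cf := smooth_at_cont sf; case: sf => A [oA Ax] sf.
have : \forall y \near x, B (f y) by apply: cf; exact: open_nbhs_nbhs.
move=> /near_open_nbhs[C [oC Cx] CB].
have oAC := openI oA oC.
exists (A `&` C) => // k; apply: (@Ck_on_comp _ _ _ _ _ B) => // [y [_ /CB]//|].
by apply: Ck_on_sub (sf k) => y [].
Qed.

Lemma smooth_at_comp_rV U W n (f : U -> 'rV[R]_n) (g : 'rV[R]_n -> W) x :
  smooth_at f x -> smooth_at g (f x) -> smooth_at (fun y => g (f y)) x.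
Proof. exact/smooth_at_comp/has_basis_rV. Qed.

Lemma smooth_at_comp_snd V W n (f : 'rV[R]_n -> W) (t : V) u :
  smooth_at f u -> smooth_at (fun q : V * 'rV[R]_n => f q.2) (t, u).
Proof. by move=> sf; exact: (smooth_at_comp_rV (smooth_at_snd (t, u)) sf). Qed.

Lemma smooth_at_mx V m n (f : V -> 'M[R]_(m, n)) x :
  smooth_at f x <-> forall i j, smooth_at (fun y => f y i j) x.
Proof.
split=> [sf i j|H].
  have lin : linear (fun M : 'M[R]_(m, n) => M i j) by move=> a A B; rewrite !mxE.
  pose L : {linear 'M[R]_(m, n) -> R} :=
    HB.pack (fun M : 'M[R]_(m, n) => M i j) (GRing.isLinear.Build _ _ _ _ _ lin).
  by apply: (smooth_at_linear_comp (L := L)) => //; exact: coord_continuous.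
have -> : f = fun y => \sum_i \sum_j f y i j *: delta_mx i j.
  by apply/funext => y; exact: matrix_sum_delta.
apply: smooth_at_sum => i; apply: smooth_at_sum => j.
by apply: smooth_atZ => //; exact: smooth_at_cst.
Qed.

Lemma smooth_at_mulmx V m n p (f : V -> 'M[R]_(m, n)) (g : V -> 'M[R]_(n, p)) x :
  smooth_at f x -> smooth_at g x -> smooth_at (fun y => f y *m g y) x.
Proof.
move=> /smooth_at_mx sf /smooth_at_mx sg; apply/smooth_at_mx => i j.
have -> : (fun y => (f y *m g y) i j) = fun y => \sum_k f y i k * g y k j.
  by apply/funext => y; rewrite mxE.
by apply: smooth_at_sum => k; exact: smooth_atM.
Qed.

Lemma smooth_at_trmx V m n (f : V -> 'M[R]_(m, n)) x :
  smooth_at f x -> smooth_at (fun y => (f y)^T) x.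
Proof.
move=> /smooth_at_mx sf; apply/smooth_at_mx => i j.
by have -> : (fun y => (f y)^T i j) = fun y => f y j i by apply/funext => y; rewrite mxE.
Qed.

Lemma derive_mxE V m n (f : V -> 'M[R]_(m, n)) x v i j : derivable f x v ->
  ('D_v f x) i j = 'D_v (fun y => f y i j) x.
Proof. by move=> df; rewrite derive_mx// mxE. Qed.

Lemma jacobianE m n (f : 'rV[R]_m -> 'rV[R]_n) u i j : differentiable f u ->
  ('J f u) i j = ('D_(delta_mx 0 i) f u) 0 j.
Proof. by move=> df; rewrite /jacobian mxE deriveE. Qed.

Lemma smooth_at_jacobian m n (f : 'rV[R]_m -> 'rV[R]_n) u :
  smooth_at f u -> smooth_at (fun v => 'J f v) u.
Proof.
move=> sf; apply/smooth_at_mx => i j.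
apply: (@smooth_at_eq _ _ (fun v => ('D_(delta_mx 0 i) f v) 0 j)).
  apply: filterS (smooth_at_near sf) => v sv.
  by rewrite jacobianE//; exact: smooth_at_diff.
by have /smooth_at_mx := smooth_at_derive (delta_mx 0 i) sf; apply.
Qed.

Lemma jacobian_comp m n p (f : 'rV[R]_m -> 'rV[R]_n) (g : 'rV[R]_n -> 'rV[R]_p) u :
  differentiable f u -> differentiable g (f u) ->
  'J (g \o f) u = 'J f u *m 'J g (f u).
Proof.
move=> df dg; apply/row_matrixP => i; rewrite row_mul !rowE.
rewrite -!deriveEjacobian//; last exact: differentiable_comp.
exact: derive_comp.
Qed.

End SmoothCalculus.

(** * Restriction to lines and symmetry of second derivatives *)

Section Lines.
Context {R : realType}.
Implicit Types V W : normedModType R.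

Lemma line_diff V (y v : V) (s : R) : is_diff s (fun t : R => y + t *: v) (fun t => t *: v).
Proof.
have h : is_diff s (cst y + ( *:%R^~ v)) (0 + ( *:%R^~ v)) by exact: is_diffD.
by rewrite add0r in h.
Qed.

Lemma line_derive V W (f : V -> W) (y v : V) (s : R) :
  differentiable f (y + s *: v) ->
  is_derive s (1 : R) (fun t : R => f (y + t *: v)) ('D_v f (y + s *: v)).
Proof.
move=> df; have [dl El] := line_diff y v s.
have dc : differentiable (f \o (fun t : R => y + t *: v)) s by exact: differentiable_comp.
split; first exact: diff_derivable dc.
have := @derive_comp _ _ _ _ (fun t : R => y + t *: v) f s 1 dl df.
by rewrite [in X in _ = X -> _](deriveE (1 : R) dl) El scale1r.
Qed.

Lemma exists_small_steps V (x v w : V) (P : V -> Prop) : (\forall y \near x, P y) ->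
  exists2 h : R, 0 < h &
    forall s t, 0 <= s <= h -> 0 <= t <= h -> P (x + s *: v + t *: w).
Proof.
move=> /nbhs_ballP[e /= e0 xeP].
have d0 : 0 < `|v| + `|w| + 1 by rewrite ltr_wpDl// addr_ge0.
(* The summand 1 keeps the denominator positive when [v] and [w] vanish; the factor 1/2 makes the
   final inequality strict. *)
exists (e / (`|v| + `|w| + 1) / 2) => [|s t /andP[s0 sh] /andP[t0 th]].
  by rewrite !divr_gt0.
apply: xeP; rewrite -ball_normE /= opprD addrA opprD addrA subrr sub0r -opprD normrN.
rewrite (le_lt_trans (ler_normD _ _))// !normrZ !ger0_norm//.
apply: (@le_lt_trans _ _ (e / (`|v| + `|w| + 1) / 2 * (`|v| + `|w| + 1))).
  rewrite !mulrDr mulr1 -[leLHS]addr0 lerD ?(le_trans s0 sh)//.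
  by rewrite lerD// ler_wpM2r.
by rewrite mulrAC mulfVK ?gt_eqF// ltr_pdivrMr// ltr_pMr// ltr1n.
Qed.

(** Two applications of the mean value theorem: along [v] to the increment of [f] under translation
    by [h *: w], then along [w] to the derivative D_v f. *)
Lemma second_difference V (f : V -> R) (x v w : V) (h : R) : 0 < h ->
  (forall s t, 0 <= s <= h -> 0 <= t <= h -> smooth_at f (x + s *: v + t *: w)) ->
  exists s t, [/\ 0 <= s <= h, 0 <= t <= h &
   f (x + h *: v + h *: w) - f (x + h *: w) - (f (x + h *: v) - f x) =
     'D_w ('D_v f) (x + s *: v + t *: w) * h * h].
Proof.
move=> h0 sf.
have hh : 0 <= h <= h by rewrite lexx ltW.
have zh : 0 <= (0 : R) <= h by rewrite lexx ltW.
have oo (s : R) : s \in `]0, h[ -> 0 <= s <= h.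
  by rewrite in_itv/= => /andP[? ?]; apply/andP; split; exact: ltW.
have cc (s : R) : s \in `[0, h] -> 0 <= s <= h by rewrite in_itv.
pose A s := f (x + h *: w + s *: v) - f (x + s *: v).
have dA s : 0 <= s <= h -> is_derive s (1 : R) A
    ('D_v f (x + h *: w + s *: v) - 'D_v f (x + s *: v)).
  move=> sh; apply: is_deriveB; apply: line_derive; apply: smooth_at_diff.
    by rewrite addrAC; exact: sf.
  by have := sf s 0 sh zh; rewrite scale0r addr0.
have cA : {within `[0, h], continuous A}.
  apply: derivable_within_continuous => s /cc sh.
  by have [] := dA s sh.
have [s /oo sh Es] := MVT h0 (fun s si => dA s (oo s si)) cA.
pose B t := 'D_v f (x + s *: v + t *: w).
have dB t : 0 <= t <= h -> is_derive t (1 : R) B ('D_w ('D_v f) (x + s *: v + t *: w)).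
  by move=> th; apply: line_derive; apply/smooth_at_diff/smooth_at_derive/sf.
have cB : {within `[0, h], continuous B}.
  apply: derivable_within_continuous => t /cc th.
  by have [] := dB t th.
have [t /oo th Et] := MVT h0 (fun t ti => dB t (oo t ti)) cB.
exists s, t; split=> //.
move: Es; rewrite /A !scale0r !addr0 subr0 => Es.
have -> : f (x + h *: v + h *: w) - f (x + h *: w) - (f (x + h *: v) - f x) =
    f (x + h *: w + h *: v) - f (x + h *: v) - (f (x + h *: w) - f x).
  by rewrite (addrAC x (h *: v)); ring.
rewrite Es; congr (_ * _).
by move: Et; rewrite /B scale0r addr0 subr0 (addrAC x (s *: v)) => <-.
Qed.

(* Both mixed derivatives are limits of the same second difference quotient. *)
Lemma derive_derive_comm V (f : V -> R) (x v w : V) : smooth_at f x ->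
  'D_w ('D_v f) x = 'D_v ('D_w f) x.
Proof.
move=> sf; apply/eqP; rewrite -subr_eq0 -normr_le0.
apply/ler_addgt0Pl => e e0; rewrite addr0.
have e2 : 0 < e / 2 by rewrite divr_gt0.
have c1 := smooth_at_cont (smooth_at_derive w (smooth_at_derive v sf)).
have c2 := smooth_at_cont (smooth_at_derive v (smooth_at_derive w sf)).
have n1 : \forall y \near x, `|'D_w ('D_v f) x - 'D_w ('D_v f) y| < e / 2.
  by move/cvgrPdist_lt : c1; apply.
have n2 : \forall y \near x, `|'D_v ('D_w f) x - 'D_v ('D_w f) y| < e / 2.
  by move/cvgrPdist_lt : c2; apply.
have [h h0 H] := exists_small_steps v w (filterI (smooth_at_near sf) (filterI n1 n2)).
have s1 s t : 0 <= s <= h -> 0 <= t <= h -> smooth_at f (x + s *: v + t *: w).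
  by move=> sh th; have [] := H s t sh th.
have s2 s t : 0 <= s <= h -> 0 <= t <= h -> smooth_at f (x + s *: w + t *: v).
  by move=> sh th; rewrite addrAC; have [] := H t s th sh.
have [a [b [ah bh E1]]] := second_difference h0 s1.
have [c [d [ch dh E2]]] := second_difference h0 s2.
have D : f (x + h *: v + h *: w) - f (x + h *: w) - (f (x + h *: v) - f x) =
    f (x + h *: w + h *: v) - f (x + h *: v) - (f (x + h *: w) - f x).
  rewrite (addrAC x (h *: v)); move: (f _) (f _) (f _) (f _) => p q s t; ring.
have E : 'D_w ('D_v f) (x + a *: v + b *: w) = 'D_v ('D_w f) (x + c *: w + d *: v).
  have EE := etrans (esym E1) (etrans D E2).
  exact: (mulIf (lt0r_neq0 h0) (mulIf (lt0r_neq0 h0) EE)).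
have b1 : `|'D_w ('D_v f) x - 'D_w ('D_v f) (x + a *: v + b *: w)| < e / 2.
  by have [_ []] := H a b ah bh.
have b2 : `|'D_v ('D_w f) x - 'D_v ('D_w f) (x + c *: w + d *: v)| < e / 2.
  by have [_ [_]] := H d c dh ch; rewrite addrAC.
rewrite E in b1; clear -b1 b2.
move: b1 b2.
move: ('D_w ('D_v f) x) ('D_v ('D_w f) x) ('D_v ('D_w f) _) => p q r b1 b2.
by rewrite (splitr e) (le_trans (ler_distD r _ _))// lerD// ltW// distrC.
Qed.

Lemma derive_derive_comm_mx V m n (f : V -> 'M[R]_(m, n)) (x v w : V) : smooth_at f x ->
  'D_w ('D_v f) x = 'D_v ('D_w f) x.
Proof.
move=> sf; apply/matrixP => i j.
have E (a b : V) : ('D_a ('D_b f) x) i j = 'D_a ('D_b (fun y => f y i j)) x.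
  rewrite derive_mxE; last exact/smooth_at_derivable/smooth_at_derive.
  apply: near_eq_derive; apply: filterS (smooth_at_near sf) => y sy.
  by rewrite derive_mxE//; exact: smooth_at_derivable.
apply: (etrans (E w v)); apply: (etrans _ (esym (E v w))).
apply: derive_derive_comm.
by have /smooth_at_mx := sf; apply.
Qed.

End Lines.

Section DerivativeRules.
Context {R : realType}.

Lemma is_derive_fst (V : normedModType R) (G : R * V -> R) (s : R) (u : V) :
  differentiable G (s, u) ->
  is_derive s (1 : R) (fun s => G (s, u)) ('D_((1, 0) : R * V) G (s, u)).
Proof.
move=> dG.
have line t : (t, u) = (0, u) + t *: ((1, 0) : R * V).
  by congr pair; rewrite /= ?scaler0 ?addr0// add0r /GRing.scale /= mulr1.
rewrite [in X in differentiable _ X]line in dG.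
have := line_derive dG; rewrite -line.
by rewrite (_ : (fun t => G ((0, u) + t *: (1, 0))) = (fun t => G (t, u))) //; apply/funext => t;
  rewrite -line.
Qed.

Lemma is_derive_smooth (V : normedModType R) (f : V -> R) u v : smooth_at f u ->
  is_derive u v f ('D_v f u).
Proof. by move=> sf; apply/derivableP/smooth_at_derivable. Qed.

Lemma is_derive_quot (V : normedModType R) (f s : V -> R) (u v : V) (df ds : R) : s u != 0 ->
  is_derive u v f df -> is_derive u v s ds ->
  is_derive u v (fun y => f y / s y) (df / s u - f u * ds / (s u * s u)).
Proof.
move=> s0 [df1 df2] [ds1 ds2].
have dV : is_derive u v (fun y => (s y)^-1) (- ((s u * s u)^-1 * ds)).
  split; first exact: derivableV.
  by rewrite deriveV// ds2 /GRing.scale /= mulNr expr2.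
have [D E] := is_deriveM (DeriveDef df1 df2) dV.
split; first exact: D.
by apply: (etrans E); rewrite /GRing.scale /=; field; rewrite s0.
Qed.

Lemma is_derive_mulr (V : normedModType R) (f h : V -> R) (u v : V) (df dh : R) :
  is_derive u v f df -> is_derive u v h dh ->
  is_derive u v (fun y => f y * h y) (df * h u + f u * dh).
Proof.
move=> d1 d2; have [D E] := is_deriveM d1 d2.
split; first exact: D.
by apply: (etrans E); rewrite /GRing.scale /=; ring.
Qed.

Lemma line_derive0 (V : normedModType R) (f : V -> R) (y v : V) : differentiable f y ->
  is_derive (0 : R) (1 : R) (fun t : R => f (y + t *: v)) ('D_v f y).
Proof.
move=> df; have E : y + (0 : R) *: v = y by rewrite scale0r addr0.
by have := @line_derive R V R f y v 0; rewrite E => /(_ df).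
Qed.

Lemma deriveZdir (V : normedModType R) (f : V -> R) (y v : V) (k : R) : differentiable f y ->
  'D_(k *: v) f y = k * 'D_v f y.
Proof. by move=> df; rewrite !deriveE// linearZ. Qed.

End DerivativeRules.

(** * Smooth bump functions *)

Section Bumps.
Context {R : realType}.

(* x^-n exp(-1/x), whose derivative is a combination of functions of the same family. *)
Let G n (x : R) : R := if 0 < x then x^-1 ^+ n * expR (- x^-1) else 0.

Let G_ge0 n x : 0 <= G n x.
Proof.
rewrite /G; case: ifPn => // x0.
by rewrite mulr_ge0 ?expR_ge0// exprn_ge0// invr_ge0 ltW.
Qed.

(** With y = 1/x, the exponential series gives e^y >= y^(n+2) / (n+2)!. The resulting quadratic
    bound makes the difference quotient of [G n] at 0 tend to 0. *)
Let G_le n x : `|G n x| <= (n.+2)`!%:R * x ^+ 2.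
Proof.
rewrite ger0_norm// /G; case: ifPn => [x0|_]; last by rewrite mulr_ge0// sqr_ge0.
have y0 : 0 < x^-1 by rewrite invr_gt0.
rewrite expRN ler_pdivrMr ?expR_gt0//.
have F0 : 0 < (n.+2)`!%:R :> R by rewrite ltr0n fact_gt0.
apply: (@le_trans _ _ ((n.+2)`!%:R * x ^+ 2 * (x^-1 ^+ n.+2 / (n.+2)`!%:R))); last first.
  rewrite ler_pM2l; last by rewrite mulr_gt0// exprn_gt0.
  apply: le_trans (expR_ge1Dxn n.+1 (ltW y0)).
  by rewrite lerDr.
have x1 : x != 0 by rewrite gt_eqF.
have F1 : (n.+2)`!%:R != 0 :> R by rewrite gt_eqF.
rewrite le_eqVlt; apply/orP; left; apply/eqP.
move: F1; move: (_`!%:R : R) => F F1; rewrite !exprS; move: (x^-1 ^+ n) => y.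
by field; rewrite F1 x1.
Qed.

Let G_derive n x : is_derive x (1 : R) (G n) (- n%:R * G n.+1 x + G n.+2 x).
Proof.
have [x0|x0|->] := ltgtP x 0.
- have z m : G m x = 0 by rewrite /G ltNge (ltW x0).
  rewrite !z mulr0 addr0.
  have dc : is_derive x (1 : R) (cst (0 : R)) 0 by exact: is_derive_cst.
  apply: near_eq_is_derive dc.
  near=> y; rewrite /G ltNge ltW//; near: y; exact: (cvgr_lt x).
- apply: (@near_eq_is_derive _ _ _ (fun y : R => y^-1 ^+ n * expR (- y^-1))).
    near=> y; rewrite /G ifT//; near: y; exact: (cvgr_gt x).
  have x1 : x != 0 by rewrite gt_eqF.
  have dv : is_derive x (1 : R) (fun y : R => y^-1) (- x ^- 2).
    split; first exact: derivableV.
    by rewrite deriveV// derive_id /GRing.scale /= mulr1.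
  have dn : is_derive x (1 : R) (fun y : R => - y^-1) (x ^- 2).
    by have := is_deriveN dv; rewrite opprK.
  have de : is_derive x (1 : R) (fun y : R => expR (- y^-1)) (x ^- 2 * expR (- x^-1)).
    have dE := is_derive_expR (- x^-1).
    by have := @is_derive1_comp _ expR (fun y : R => - y^-1) x _ _ dE dn; rewrite mulrC.
  have dX := is_deriveX n dv.
  have EM : (fun y : R => y^-1) ^+ n * (fun y => expR (- y^-1)) =
      (fun y => y^-1 ^+ n * expR (- y^-1)).
    by apply/funext => y; rewrite /= [in LHS]/GRing.mul /= exprfctE.
  have := is_deriveM dX de; rewrite EM => dM.
  apply: (is_derive_eq dM).
  rewrite /G x0 /GRing.scale /=.
  rewrite exprfctE -exprVn; clear.
  move: (expR (- x^-1)) (x^-1 : R) => e y.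
  case: n => [|n]; first by rewrite !exprS !expr0; ring.
  by rewrite /= !exprS expr0; move: (y ^+ n) => z; ring.
- have z m : G m 0 = 0 by rewrite /G ltxx.
  rewrite !z mulr0 addr0.
  have C : h^-1 *: ((G n \o shift 0) (h *: (1 : R)) - G n 0) @[h --> 0^'] --> (0 : R).
    apply/cvgr0Pnorm_le => e e0.
    near=> h.
    rewrite z subr0 /GRing.scale /= mulr1 addr0 normrM normfV.
    have h0 : h != 0 by near: h; exact: nbhs_dnbhs_neq.
    rewrite ler_pdivrMl ?normr_gt0//; apply: le_trans (G_le _ _) _.
    rewrite -(ger0_norm (sqr_ge0 h)) normrX expr2 mulrA mulrC ler_pM2l ?normr_gt0//.
    rewrite -ler_pdivlMl ?ltr0n ?fact_gt0//.
    near: h; apply: dnbhs0_le.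
    by rewrite mulr_gt0// invr_gt0 ltr0n fact_gt0.
  by split; [apply/cvg_ex; exists 0; exact: C|exact: cvg_lim C].
Unshelve. all: by end_near. Qed.

(** [G_derive] stays inside the family, so the induction on the order of differentiability runs
    uniformly in [n]. *)
Let G_smooth n (x : R) : smooth_at (G n) x.
Proof.
exists setT; first by split=> //; exact: openT.
move=> k; elim: k n => [|k IH] n.
  move=> y _; apply/differentiable_continuous/derivable1_diffP.
  by have [] := G_derive n y.
have d y : differentiable (G n) y by apply/derivable1_diffP; have [] := G_derive n y.
split=> [y _|v]; first exact: d.
apply: (@Ck_on_eq _ _ _ _ _ (fun y => v *: ((fun y => (- n%:R) *: G n.+1 y) + G n.+2) y)).
- exact: openT.
- move=> y _; have [_ E] := G_derive n y.
  rewrite -[v in RHS](mulr1 v) -[v * 1]/(v *: (1 : R^o)) deriveE//.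
  by rewrite [RHS]linearZ -(deriveE (1 : R) (d y)) E.
- apply: Ck_on_scale => //; [exact: openT|exact: Ck_on_cst|].
  apply: Ck_onD => //; first exact: openT.
  by apply: Ck_on_scale => //; [exact: openT|exact: Ck_on_cst].
Qed.

(** The step is G(x) / (G(x) + G(1 - x)) for G = [G 0]. The denominator is positive because x and 1
    - x are never both nonpositive. *)
Lemma exists_smooth_step : exists s : R -> R, [/\ forall x, smooth_at s x,
  forall x, 0 <= s x <= 1, forall x, x <= 0 -> s x = 0 & forall x, 1 <= x -> s x = 1].
Proof.
have Gp x : 0 < x -> 0 < G 0 x by move=> x0; rewrite /G x0 expr0 mul1r expR_gt0.
have Gz x : x <= 0 -> G 0 x = 0 by move=> x0; rewrite /G ltNge x0.
have Dp x : 0 < G 0 x + G 0 (1 - x).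
  have [x0|x0] := ltP 0 x; first by rewrite ltr_pwDl// Gp.
  by rewrite ltr_wpDl// Gp//; lra.
exists (fun x => G 0 x * (G 0 x + G 0 (1 - x))^-1); split => x.
- apply: smooth_atM => //; apply: smooth_atV; first by rewrite gt_eqF.
  apply: smooth_atD => //.
  apply: (@smooth_at_comp _ _ _ _ (fun x : R => 1 - x)) => //; first exact: has_basis_R.
  by apply: smooth_atB; [exact: smooth_at_cst|exact: smooth_at_id].
- rewrite ler_pdivrMr// mul1r lerDl G_ge0 andbT.
  by rewrite divr_ge0// ltW.
- by move=> x0; rewrite Gz// mul0r.
- move=> x1; rewrite [G 0 (1 - x)]Gz; last by lra.
  by rewrite addr0 divff// gt_eqF// Gp//; lra.
Qed.

Definition plateau : R -> R := let s := projT1 (cid exists_smooth_step) in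
  fun t => s (2 - t) * s (2 + t).

Lemma plateauP : [/\ forall x, smooth_at plateau x, forall x, 0 <= plateau x <= 1,
  forall x, 2 <= `|x| -> plateau x = 0 & forall x, `|x| <= 1 -> plateau x = 1].
Proof.
rewrite /plateau; case: cid => s [ss s01 s0 s1] /=; split=> x.
- apply: smooth_atM.
    apply: (@smooth_at_comp _ _ _ _ (fun x : R => 2 - x)) => //; first exact: has_basis_R.
    by apply: smooth_atB; [exact: smooth_at_cst|exact: smooth_at_id].
  apply: (@smooth_at_comp _ _ _ _ (fun x : R => 2 + x)) => //; first exact: has_basis_R.
  by apply: smooth_atD; [exact: smooth_at_cst|exact: smooth_at_id].
- have /andP[a0 a1] := s01 (2 - x); have /andP[b0 b1] := s01 (2 + x).
  by rewrite mulr_ge0//= mulr_ile1.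
- rewrite ler_normr => /orP[x2|x2].
    by rewrite (s0 (2 - x)) ?mul0r//; lra.
  by rewrite (s0 (2 + x)) ?mulr0//; lra.
- by rewrite ler_norml => /andP[x1 x2]; rewrite !s1 ?mulr1//; lra.
Qed.

(** The norm of row vectors is the sup norm, so its balls are coordinate squares. This is what lets
    [box] serve both as a ball and as a product of intervals. *)
Lemma rV2_norm_le (u : 'rV[R]_2) (r : R) :
  (`|u| <= r) = (`|u 0 0| <= r) && (`|u 0 1| <= r).
Proof.
apply/idP/andP => [ur|[u0 u1]].
  by split; apply: le_trans ur; rewrite [leRHS]/Num.Def.normr/= mx_normrE;
    apply: (le_bigmax _ (fun i : 'I_1 * 'I_2 => `|u i.1 i.2|) (0, _)).
rewrite [leLHS]/Num.Def.normr/= mx_normrE bigmax_le ?(le_trans _ u0)//= => -[i j] _ /=.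
by rewrite (ord1 i); case: j => -[|[|//]] jlt; [move: u0|move: u1]; congr (`|_| <= _);
  congr (u _ _); exact/val_inj.
Qed.

Lemma rV2_norm_lt (u : 'rV[R]_2) (r : R) :
  (`|u| < r) = (`|u 0 0| < r) && (`|u 0 1| < r).
Proof.
apply/idP/andP => [ur|[u0 u1]].
  have /andP[? ?] : (`|u 0 0| <= `|u|) && (`|u 0 1| <= `|u|) by rewrite -rV2_norm_le.
  by split; apply: le_lt_trans ur.
apply: (@le_lt_trans _ _ (Num.max `|u 0 0| `|u 0 1|)); last by rewrite gt_max u0.
by rewrite rV2_norm_le !le_max !lexx orbT.
Qed.

(** Fixes the scheme of radii used below: the bump is 1 at distance at most [r] from [a] and 0 from
    distance [2 * r] on, while charts are asked to cover distance [3 * r], which leaves room to move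
    points by [r]. *)
Definition bump2 (a : 'rV[R]_2) (r : R) (u : 'rV[R]_2) : R :=
  plateau ((u 0 0 - a 0 0) / r) * plateau ((u 0 1 - a 0 1) / r).

Lemma bump2_smooth a r u : smooth_at (bump2 a r) u.
Proof.
have [sp _ _ _] := plateauP.
have H (i : 'I_2) : smooth_at (fun u : 'rV[R]_2 => plateau ((u 0 i - a 0 i) / r)) u.
  apply: (@smooth_at_comp _ _ _ _ (fun u : 'rV[R]_2 => (u 0 i - a 0 i) / r)) => //.
    exact: has_basis_R.
  apply: smooth_atM; last exact: smooth_at_cst.
  apply: smooth_atB; last exact: smooth_at_cst.
  by have /smooth_at_mx := smooth_at_id u; apply.
exact: smooth_atM.
Qed.

Lemma bump2_01 a r u : 0 <= bump2 a r u <= 1.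
Proof.
have [_ p01 _ _] := plateauP; rewrite /bump2.
have /andP[a0 a1] := p01 ((u 0 0 - a 0 0) / r); have /andP[b0 b1] := p01 ((u 0 1 - a 0 1) / r).
by rewrite mulr_ge0//= mulr_ile1.
Qed.

Lemma bump2_1 a r u : 0 < r -> `|u - a| <= r -> bump2 a r u = 1.
Proof.
move=> r0; rewrite rV2_norm_le !mxE => /andP[h0 h1].
have [_ _ _ p1] := plateauP.
by rewrite /bump2 !p1 ?mulr1// normrM (gtr0_norm (_ : 0 < r^-1)) ?invr_gt0// ler_pdivrMr ?mul1r.
Qed.

Lemma bump2_0 a r u : 0 < r -> 2 * r <= `|u - a| -> bump2 a r u = 0.
Proof.
move=> r0; rewrite leNgt rV2_norm_lt !mxE negb_and -!leNgt.
have [_ _ p0 _] := plateauP.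
case/orP=> h; rewrite /bump2.
  by rewrite (p0 ((u 0 0 - a 0 0) / r)) ?mul0r// normrM (gtr0_norm (_ : 0 < r^-1)) ?invr_gt0// ler_pdivlMr.
by rewrite (p0 ((u 0 1 - a 0 1) / r)) ?mulr0// normrM (gtr0_norm (_ : 0 < r^-1)) ?invr_gt0// ler_pdivlMr.
Qed.

End Bumps.

(** * Integration over boxes *)

Section Measurability.
Context {R : realType}.

(** The product sigma-algebra contains the open sets because an open set is the countable union of
    the open squares with rational centre and radius that it contains. The radius is taken below
    [e / 2] so that a square containing [x] stays within [e] of it. *)
Lemma open_prodR_measurable (A : set (R * R)) : open A -> measurable A.
Proof.
move=> oA.
pose D (q : rat * rat * rat) : set (R * R) :=
  `](ratr q.1.1 - ratr q.2), (ratr q.1.1 + ratr q.2)[ `*`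
  `](ratr q.1.2 - ratr q.2), (ratr q.1.2 + ratr q.2)[.
pose F q := if `[< D q `<=` A >] then D q else set0.
have -> : A = \bigcup_q F q.
  apply/seteqP; split => [x Ax|x [q _]]; last first.
    by rewrite /F; case: asboolP => // qA /qA.
  have /nbhs_ballP[e /= e0 eA] := open_nbhs_nbhs (conj oA Ax).
  have e2 : 0 < e / 2 by rewrite divr_gt0.
  have [r] := rat_in_itvoo e2; rewrite in_itv/= => /andP[r0 re].
  have h1 : x.1 - ratr r < x.1 + ratr r by lra.
  have h2 : x.2 - ratr r < x.2 + ratr r by lra.
  have [q1] := rat_in_itvoo h1.
  rewrite in_itv/= => /andP[q1l q1r].
  have [q2] := rat_in_itvoo h2.
  rewrite in_itv/= => /andP[q2l q2r].
  exists (q1, q2, r) => //; rewrite /F asboolT.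
    by split; rewrite /= in_itv/=; apply/andP; split; lra.
  move=> y [/=]; rewrite !in_itv/= => /andP[y1l y1r] /andP[y2l y2r].
  by apply: eA; split; rewrite /ball/= ltr_norml; apply/andP; split; lra.
apply: countable_bigcupT_measurable => // q.
rewrite /F; case: asboolP => // _.
by apply: measurableX => //; exact: measurable_itv.
Qed.

(** The map [j] separates the measurable type from the topological one; it is used for [rV2], for
    charts and for the identity of M. As [f] is continuous only at the points reached from [D], the
    preimage of [V] is replaced by its interior, which has the same trace on [D]. *)
Lemma continuous_on_preimage_measurable d (T : measurableType d) (X U : topologicalType)
    (j : T -> X) (D : set T) (f : X -> U) (V : set U) :
  measurable D -> (forall A, open A -> measurable (j @^-1` A)) ->
  (forall x, D x -> {for j x, continuous f}) -> open V ->
  measurable (D `&` (f \o j) @^-1` V).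
Proof.
move=> mD oT cf oV.
have -> : D `&` (f \o j) @^-1` V = D `&` j @^-1` (f @^-1` V)^°.
  apply/seteqP; split=> x [Dx] /= Vx; split=> //; last exact: interior_subset Vx.
  by apply: (cf x Dx); exact: open_nbhs_nbhs.
by apply: measurableI => //; apply: oT; exact: open_interior.
Qed.

Lemma continuous_on_measurable_fun d (T : measurableType d) (X : topologicalType)
    (j : T -> X) (D : set T) (f : X -> R) :
  measurable D -> (forall A, open A -> measurable (j @^-1` A)) ->
  (forall x, D x -> {for j x, continuous f}) -> measurable_fun D (f \o j).
Proof.
move=> mD oT cf.
apply: (measurability _ (RGenOpens.measurableE R)) => _ [_ [a [b ->] <-]].
by apply: continuous_on_preimage_measurable => //; exact: interval_open.
Qed.

Lemma continuous_on_compact_bounded (T : topologicalType) (K : set T) (f : T -> R) :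
  compact K -> (forall x, K x -> {for x, continuous f}) ->
  exists2 C, 0 <= C & forall x, K x -> `|f x| <= C.
Proof.
move=> cK cf.
have cfK : {within K, continuous f}.
  by apply: continuous_in_subspaceT => x; rewrite inE; exact: cf.
have [C [_ HC]] := compact_bounded (continuous_compact cfK cK).
exists (Num.max 0 (C + 1)); first by rewrite le_max lexx.
move=> x Kx; rewrite le_max; apply/orP; right.
by apply: (HC (C + 1)); [rewrite ltrDl|exists x].
Qed.

Lemma compact_cover_seq (T : ptopologicalType) (K : set T) (P : T -> set T) : compact K ->
  (forall x, K x -> nbhs x (P x)) ->
  exists s : seq T, (forall y, y \in s -> K y) /\ forall x, K x -> exists2 y, y \in s & P y x.
Proof.
move=> cK nP; move: cK; rewrite compact_cover.
move=> /(_ T K (fun x => (P x)^°)) [||s sK sP].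
- by move=> x _; exact: open_interior.
- by move=> x Kx; exists x => //; exact: nP.
exists (finmap.enum_fset s); split=> [y ys|x Kx].
  by have := sK y ys; rewrite inE.
by have [y /= ys Py] := sP x Kx; exists y => //; exact: interior_subset.
Qed.

End Measurability.

(** * Change of variables for a measure given by a density *)

Section ChangeOfVariables.
Local Open Scope ereal_scope.
Context d1 d2 (X : measurableType d1) (Y : measurableType d2) (R : realType).
Variables (la : {measure set X -> \bar R}) (mu : {measure set Y -> \bar R}).
Variables (phi : X -> Y) (w : X -> R) (Q : set X) (D : set Y).
Hypotheses (mQ : measurable Q) (mD : measurable D) (mw : measurable_fun Q w).
Hypotheses (w0 : forall x, Q x -> (0 <= w x)%R) (mphi : measurable_fun Q phi).
Hypothesis QD : forall x, Q x -> D (phi x).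
Hypothesis muE : forall E, measurable E -> E `<=` D ->
  mu E = \int[la]_(x in Q `&` phi @^-1` E) (w x)%:E.

Import HBNNSimple.

Let mfphi (f : {nnsfun Y >-> R}) : measurable_fun Q (f \o phi).
Proof. by apply: (@measurable_comp _ _ _ _ _ _ setT). Qed.

Let mindic (A : set Y) : measurable A -> measurable_fun Q (\1_A \o phi : X -> R).
Proof. by move=> mA; apply: (@measurable_comp _ _ _ _ _ _ setT). Qed.

Let integral_indic_density (A : set Y) (r : R) : measurable A -> (0 <= r)%R ->
  \int[mu]_(y in D) (r * \1_A y)%:E = \int[la]_(x in Q) (r * \1_A (phi x) * w x)%:E.
Proof.
move=> mA r0.
under eq_integral => y _ do rewrite EFinM.
rewrite ge0_integralZl//; last by apply/measurable_EFinP.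
rewrite integral_indic// muE; [|exact: measurableI|by move=> ? []].
under [RHS]eq_integral => x _ do rewrite -mulrA EFinM.
rewrite ge0_integralZl//; last 2 first.
- by apply/measurable_EFinP; apply: measurable_funM => //; exact: mindic.
- by move=> x Qx; rewrite lee_fin mulr_ge0 ?w0.
congr (_ * _); rewrite integral_mkcondr; apply: eq_integral => x /[!inE] Qx.
rewrite /patch; case: ifPn => /=; rewrite ?inE ?notin_setE /= => Ax.
  by rewrite indicE mem_set ?mul1r//; case: Ax.
rewrite indicE memNset ?mul0r// => ?; apply: Ax; split => //; exact: QD.
Qed.

Let integral_nnsfun_density (f : {nnsfun Y >-> R}) :
  \int[mu]_(y in D) (f y)%:E = \int[la]_(x in Q) (f (phi x) * w x)%:E.
Proof.
pose A k := f @^-1` [set k].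
have mA k : measurable (A k) by rewrite -[A k]setTI; exact: measurable_funP.
under eq_integral do rewrite fimfunE -fsumEFin//.
rewrite ge0_integral_fsum//; last 2 first.
- by move=> r; exact/measurable_EFinP/measurable_funM.
- by move=> r y _; rewrite nnfun_muleindic_ge0.
have E x : (f (phi x) * w x)%:E =
    \sum_(r \in range f) (r * \1_(A r) (phi x) * w x)%:E.
  by rewrite fimfunE mulrC mulr_fsumr// -fsumEFin//; apply: eq_fsbigr => r _; rewrite mulrC.
under [RHS]eq_integral do rewrite E.
rewrite [RHS]ge0_integral_fsum//; last 2 first.
- move=> r; apply/measurable_EFinP; apply: measurable_funM => //.
  by apply: measurable_funM => //; exact: mindic.
- move=> r x Qx; rewrite EFinM mule_ge0 ?lee_fin ?w0//.
  by have := nnfun_muleindic_ge0 f r (phi x); rewrite lee_fin.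
apply: eq_fsbigr => r; rewrite inE => -[y _ <-].
by apply: integral_indic_density.
Qed.

(** The hypothesis [muE] is the case of indicator functions. Linearity extends it to nonnegative
    simple functions and monotone convergence to all nonnegative measurable ones. *)
Lemma ge0_integral_density (f : Y -> \bar R) :
  measurable_fun D f -> (forall y, D y -> 0 <= f y) ->
  \int[mu]_(y in D) f y = \int[la]_(x in Q) (f (phi x) * (w x)%:E).
Proof.
move=> mf f0.
pose f_ := nnsfun_approx mD mf.
transitivity (limn (fun n => \int[mu]_(y in D) (f_ n y)%:E)).
  rewrite -monotone_convergence//.
  - apply: eq_integral => y /[!inE] yD; apply/esym/cvg_lim => //.
    by apply: cvg_nnsfun_approx=> // *; apply: f0; rewrite inE.
  - by move=> n; exact/measurable_EFinP/measurable_funTS.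
  - by move=> n y _; rewrite lee_fin.
  - by move=> y _ m n mn; rewrite lee_fin; exact/lefP/nd_nnsfun_approx.
transitivity (limn (fun n => \int[la]_(x in Q) (f_ n (phi x) * w x)%:E)).
  by congr (limn _); apply/funext => n; exact: integral_nnsfun_density.
rewrite -monotone_convergence//.
- apply: eq_integral => x /[!inE] xQ; apply/cvg_lim => //.
  under eq_fun do rewrite EFinM.
  by apply: cvgeZr => //; apply: cvg_nnsfun_approx=> //; exact: QD.
- by move=> n; apply/measurable_EFinP/measurable_funM => //; exact: mfphi.
- by move=> n x Qx; rewrite lee_fin mulr_ge0// w0.
- move=> x Qx m n mn; rewrite lee_fin ler_wpM2r ?w0//.
  exact/lefP/nd_nnsfun_approx.
Qed.

(** Adding the bound [C] makes [f] nonnegative, which reduces to the previous lemma. Both sides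
    change by the same finite quantity [C * fine (mu D)], since [mu D] is the integral of the
    density. *)
Lemma Rintegral_density (f : Y -> R) (C : R) :
  measurable_fun D f -> (forall y, D y -> `|f y| <= C)%R ->
  mu D < +oo ->
  (\int[mu]_(y in D) f y = \int[la]_(x in Q) (f (phi x) * w x))%R.
Proof.
move=> mf fC muoo.
have muD : mu D = \int[la]_(x in Q) (w x)%:E.
  rewrite muE//; congr (integral _ _ _); apply/seteqP; split=> x; first by case.
  by move=> Qx; split=> //; exact: QD.
have intw : la.-integrable Q (EFin \o w).
  apply/integrableP; split; first exact/measurable_EFinP.
  rewrite (eq_integral (fun x => (w x)%:E)) -?muD//.
  by move=> x /[!inE] Qx; rewrite /= ger0_norm ?w0.
have intf : mu.-integrable D (EFin \o f).
  apply: measurable_bounded_integrable => //.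
  exists C; split; first exact: num_real.
  by move=> M CM y /fC; move/le_trans; apply; exact: ltW.
have intc : mu.-integrable D (EFin \o cst C).
  apply: measurable_bounded_integrable => //.
  exists `|C|%R; split; first exact: num_real.
  by move=> M CM y _; exact: ltW.
have intfw : la.-integrable Q (EFin \o (fun x => f (phi x) * w x)%R).
  have mfp : measurable_fun Q (f \o phi).
    apply: (@measurable_comp _ _ _ _ _ _ D) => //.
    by move=> _ [x Qx <-]; exact: QD.
  apply: (@le_integrable _ _ _ la Q mQ _ (fun x => C%:E * (w x)%:E)).
  - by apply/measurable_EFinP/measurable_funM.
  - move=> x Qx; rewrite /= lee_fin !normrM ler_wpM2r//.
    by rewrite (le_trans (fC _ (QD Qx)))// ler_norm.
  - exact: integrableZl.
have fC0 y : D y -> (0 <= f y + C)%R.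
  by move=> /fC; rewrite ler_norml => /andP[? _]; lra.
have mfc : measurable_fun D (fun y => (f y + C)%:E).
  by apply/measurable_EFinP; exact: measurable_funD.
have E1 : (\int[mu]_(y in D) (f y + C) = \int[mu]_(y in D) f y + C * fine (mu D))%R.
  by rewrite RintegralD// Rintegral_cst.
have E2 : (\int[la]_(x in Q) ((f (phi x) + C) * w x) =
    \int[la]_(x in Q) (f (phi x) * w x) + C * fine (mu D))%R.
  under eq_Rintegral do rewrite mulrDl.
  rewrite RintegralD//; last first.
    rewrite (_ : EFin \o _ = fun x => C%:E * (EFin \o w) x); first exact: integrableZl.
    by apply/funext => x; rewrite /= EFinM.
  by rewrite RintegralZl// muD.
suff E3 : (\int[mu]_(y in D) (f y + C) = \int[la]_(x in Q) ((f (phi x) + C) * w x))%R.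
  by apply: (@addIr _ (C * fine (mu D))%R); rewrite -E1 -E2.
by rewrite /Rintegral ge0_integral_density.
Qed.

End ChangeOfVariables.

(** * Squares in the plane and integrals over them *)

Section Boxes.
Context {R : realType}.
Implicit Types (a u : 'rV[R]_2) (r : R).

Local Notation la := (@lebesgue_measure R).
Local Notation la2 := (la \x la)%E.

(** Squares live in two types: [box] in the normed space of row vectors, where differentiation takes
    place, and [qbox] in the product of two lines, where Lebesgue measure lives. [rV2] passes from
    the second to the first. *)
Definition box a r : set 'rV[R]_2 := [set u | `|u - a| <= r].
Definition qbox a r : set (R * R) := [set p | box a r (rV2 p)].

Lemma rV2E0 (p : R * R) : rV2 p = rV2 (0, p.2) + p.1 *: e_ 0.
Proof.
apply/rowP => i; rewrite !mxE /=; case: i => -[|[|//]] ilt /=.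
  by rewrite mulr1 add0r.
by rewrite mulr0 addr0.
Qed.

Lemma rV2E1 (p : R * R) : rV2 p = rV2 (p.1, 0) + p.2 *: e_ 1.
Proof.
apply/rowP => i; rewrite !mxE /=; case: i => -[|[|//]] ilt /=.
  by rewrite mulr0 addr0.
by rewrite mulr1 add0r.
Qed.

Lemma rV2_continuous : continuous (@rV2 R).
Proof.
have -> : @rV2 R = fun p => p.1 *: e_ 0 + p.2 *: e_ 1.
  apply/funext => p; rewrite rV2E1 (rV2E0 (p.1, 0)) /=.
  suff -> : rV2 (0, 0) = 0 :> 'rV[R]_2 by rewrite add0r.
  by apply/rowP => i; rewrite !mxE; case: ifP.
move=> p; apply: cvgD; apply: cvgZr_tmp.
  exact: cvg_fst.
exact: cvg_snd.
Qed.

Lemma open_rV2_measurable (A : set 'rV[R]_2) : open A -> measurable (@rV2 R @^-1` A).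
Proof.
move=> oA; apply: open_prodR_measurable; apply: open_comp oA => p _.
exact: rV2_continuous.
Qed.

Lemma qboxE a r : qbox a r =
  `[a 0 0 - r, a 0 0 + r] `*` `[a 0 1 - r, a 0 1 + r].
Proof.
have H (x y : R) : (`|x - y| <= r) = (x \in `[y - r, y + r]).
  by rewrite in_itv /= ler_norml; apply/andP/andP => -[? ?]; split; lra.
apply/seteqP; split => -[x y] /=; rewrite /qbox /box /= rV2_norm_le !mxE /= !H.
  by move/andP.
by move=> [-> ->].
Qed.

Lemma measurable_qbox a r : measurable (qbox a r).
Proof. by rewrite qboxE; apply: measurableX; exact: measurable_itv. Qed.

Lemma qbox_measure a r : 0 < r -> la2 (qbox a r) = ((r + r) * (r + r))%:E.
Proof.
move=> r0; rewrite qboxE [LHS]product_measure1E; [|exact: measurable_itv|exact: measurable_itv].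
have E (x : R) : la `[x - r, x + r]%classic = (r + r)%:E.
  rewrite lebesgue_measure_itv /= lte_fin ifT; last by lra.
  by rewrite -EFinB; congr EFin; ring.
by rewrite EFinM; exact: (congr2 mule (E (a 0 0)) (E (a 0 1))).
Qed.

Lemma qbox_measure_lty a r : 0 < r -> (la2 (qbox a r) < +oo)%E.
Proof. by move=> r0; rewrite qbox_measure// ltry. Qed.

Lemma box_compact a r : compact (box a r).
Proof.
apply: bounded_closed_compact.
  exists (r + `|a|); split; first exact: num_real.
  move=> M rM u; rewrite /box /= => ur; apply: (le_trans _ (ltW rM)).
  by rewrite -[u](subrK a) (le_trans (ler_normD _ _))// lerD2r.
have -> : box a r = (fun u => `|u - a|) @^-1` [set x | x <= r] by [].
apply: closed_comp; last exact: closed_le.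
move=> u _; apply: (@continuous_comp _ _ _ (fun u => u - a) (fun u => `|u|)).
  exact: (smooth_at_cont (smooth_atB (smooth_at_id u) (smooth_at_cst a u))).
exact: norm_continuous.
Qed.

Lemma measurable_qbox_fun a r (G : 'rV[R]_2 -> R) :
  (forall u, box a r u -> {for u, continuous G}) -> measurable_fun (qbox a r) (G \o @rV2 R).
Proof.
move=> cG; apply: continuous_on_measurable_fun; first exact: measurable_qbox.
  exact: open_rV2_measurable.
by move=> p; exact: cG.
Qed.

Lemma integrable_qbox a r (G : 'rV[R]_2 -> R) : 0 < r ->
  (forall u, box a r u -> {for u, continuous G}) ->
  la2.-integrable (qbox a r) (EFin \o (fun p => G (rV2 p))).
Proof.
move=> r0 cG; apply: measurable_bounded_integrable.
- exact: measurable_qbox.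
- exact: qbox_measure_lty.
- exact: measurable_qbox_fun.
- have [C C0 GC] := continuous_on_compact_bounded (box_compact (a := a) (r := r)) cG.
  exists C; split; first exact: num_real.
  by move=> M CM p /GC; move/le_trans; apply; exact: ltW.
Qed.

Lemma integral_line_derive (G : 'rV[R]_2 -> R) y v (c d : R) : c < d ->
  (forall t, c <= t <= d -> smooth_at G (y + t *: v)) ->
  G (y + c *: v) = 0 -> G (y + d *: v) = 0 ->
  (\int[la]_(t in `[c, d]) ('D_v G (y + t *: v))%:E)%E = 0%E.
Proof.
move=> cd sG Gc Gd.
have dl t : c <= t <= d -> is_derive t (1 : R) (fun t => G (y + t *: v)) ('D_v G (y + t *: v)).
  by move=> /sG/smooth_at_diff; exact: line_derive.
have cl (f : 'rV[R]_2 -> R) t : {for y + t *: v, continuous f} ->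
    {for t, continuous (fun t : R => f (y + t *: v))}.
  move=> cf; apply: (@continuous_comp _ _ _ (fun t : R => y + t *: v) f) => //.
  by have [/differentiable_continuous] := line_diff y v t.
have oc (t : R) : t \in `]c, d[ -> c <= t <= d.
  by rewrite in_itv/= => /andP[? ?]; apply/andP; split; exact: ltW.
have cc : c <= c <= d by rewrite lexx ltW.
have dd : c <= d <= d by rewrite lexx ltW.
rewrite (@continuous_FTC2 _ _ (fun t => G (y + t *: v)) _ _ cd).
- by rewrite Gc Gd sube0.
- apply: continuous_in_subspaceT => t; rewrite inE /= in_itv /= => /sG st.
  exact: (cl ('D_v G) t (smooth_at_cont (smooth_at_derive v st))).
- split.
  + by move=> t /oc/dl[].
  + by apply: cvg_at_right_filter; exact/cl/smooth_at_cont/sG.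
  + by apply: cvg_at_left_filter; exact/cl/smooth_at_cont/sG.
- by move=> t /oc/dl[_ E]; rewrite derive1E.
Qed.

(** Divergence theorem on a square, for one component. By Fubini the [i]-th variable is integrated
    first, and the fundamental theorem of calculus turns that inner integral into a difference of
    two boundary values, both 0. *)
Lemma integral_qbox_derive (i : 'I_2) a r (G : 'rV[R]_2 -> R) : 0 < r ->
  (forall u, box a r u -> smooth_at G u) ->
  (forall u, `|u - a| = r -> G u = 0) ->
  \int[la2]_(p in qbox a r) 'D_(e_ i) G (rV2 p) = 0.
Proof.
move=> r0 sG G0.
pose f p := 'D_(e_ i) G (@rV2 R p).
have intf : la2.-integrable (qbox a r) (EFin \o f).
  apply: (integrable_qbox (G := 'D_(e_ i) G)) => // u /sG su.
  exact/smooth_at_cont/smooth_at_derive.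
have intF : la2.-integrable setT ((EFin \o f) \_ (qbox a r)).
  by rewrite -integrable_mkcond//; exact: measurable_qbox.
rewrite /Rintegral integral_mkcond.
suff -> : (\int[la2]_x ((EFin \o f) \_ (qbox a r)) x = 0)%E by [].
have inb x y : (x, y) \in qbox a r =
    (x \in `[a 0 0 - r, a 0 0 + r]) && (y \in `[a 0 1 - r, a 0 1 + r]).
  by rewrite qboxE in_setX /= !mem_setE.
have edge (j : 'I_2) u : `|u - a| <= r -> `|u 0 j - a 0 j| = r -> `|u - a| = r.
  move=> ur uj; apply/eqP; rewrite eq_le ur -uj /=.
  rewrite [leRHS]/Num.Def.normr/= mx_normrE.
  apply: le_trans (le_bigmax _ (fun k : 'I_1 * 'I_2 => `|(u - a) k.1 k.2|) (0, j)).
  by rewrite !mxE.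
have bnd (x : R) : (`|(x - r) - x| = r) * (`|(x + r) - x| = r).
  by rewrite addrAC subrr sub0r normrN addrAC subrr add0r gtr0_norm.
case: i @f intf intF => -[|[|//]] ilt f intf intF.
- rewrite -integral21_prod_meas1//; apply: integral0_eq => y _.
  rewrite /fubini_G.
  have [yI|yI] := boolP (y \in `[a 0 1 - r, a 0 1 + r]); last first.
    by apply: integral0_eq => x _; rewrite patchE inb (negbTE yI) andbF.
  have E x : ((EFin \o f) \_ (qbox a r)) (x, y) =
      ((fun x => ('D_(e_ 0) G (rV2 (0, y) + x *: e_ 0))%:E)
         \_ `[a 0 0 - r, a 0 0 + r]) x.
    rewrite !patchE inb yI andbT mem_setE; case: ifP => // _.
    rewrite /f /= (rV2E0 (x, y)) /=; congr (EFin ('D_(e_ _) _ _)); exact: val_inj.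
  under eq_integral do rewrite E.
  rewrite -integral_mkcond; apply: integral_line_derive => [|t tI||].
  + by lra.
  + rewrite -(rV2E0 (t, y)); apply: sG.
    suff : qbox a r (t, y) by [].
    by apply/set_mem; rewrite inb yI in_itv /= tI.
  + rewrite -(rV2E0 (a 0 0 - r, y)); apply/G0/(edge 0); last by rewrite mxE /= bnd.
    suff : qbox a r (a 0 0 - r, y) by [].
    by apply/set_mem; rewrite inb yI in_itv /=; apply/andP; split=> //; lra.
  + rewrite -(rV2E0 (a 0 0 + r, y)); apply/G0/(edge 0); last by rewrite mxE /= bnd.
    suff : qbox a r (a 0 0 + r, y) by [].
    by apply/set_mem; rewrite inb yI in_itv /=; apply/andP; split=> //; lra.
- rewrite -integral12_prod_meas1//; apply: integral0_eq => x _.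
  rewrite /fubini_F.
  have [xI|xI] := boolP (x \in `[a 0 0 - r, a 0 0 + r]); last first.
    by apply: integral0_eq => y _; rewrite patchE inb (negbTE xI).
  have E y : ((EFin \o f) \_ (qbox a r)) (x, y) =
      ((fun y => ('D_(e_ 1) G (rV2 (x, 0) + y *: e_ 1))%:E)
         \_ `[a 0 1 - r, a 0 1 + r]) y.
    rewrite !patchE inb xI /= mem_setE; case: ifP => // _.
    rewrite /f /= (rV2E1 (x, y)) /=; congr (EFin ('D_(e_ _) _ _)); exact: val_inj.
  under eq_integral do rewrite E.
  rewrite -integral_mkcond; apply: integral_line_derive => [|t tI||].
  + by lra.
  + rewrite -(rV2E1 (x, t)); apply: sG.
    suff : qbox a r (x, t) by [].
    by apply/set_mem; rewrite inb xI in_itv /= tI.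
  + rewrite -(rV2E1 (x, a 0 1 - r)); apply/G0/(edge 1); last by rewrite mxE /= bnd.
    suff : qbox a r (x, a 0 1 - r) by [].
    by apply/set_mem; rewrite inb xI in_itv /=; apply/andP; split=> //; lra.
  + rewrite -(rV2E1 (x, a 0 1 + r)); apply/G0/(edge 1); last by rewrite mxE /= bnd.
    suff : qbox a r (x, a 0 1 + r) by [].
    by apply/set_mem; rewrite inb xI in_itv /=; apply/andP; split=> //; lra.
Qed.

Lemma is_derive_integral_qbox (G : R * 'rV[R]_2 -> R) (s0 e : R) a r : 0 < e -> 0 < r ->
  (forall s u, `|s - s0| < e -> box a r u -> smooth_at G (s, u)) ->
  is_derive s0 (1 : R) (fun s => \int[la2]_(p in qbox a r) G (s, rV2 p))
    (\int[la2]_(p in qbox a r) 'D_((1, 0) : R * 'rV[R]_2) G (s0, rV2 p)).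
Proof.
move=> e0 r0 sG.
have e2 : 0 < e / 2 by rewrite divr_gt0.
have Ie (s : R) : s \in `[s0 - e / 2, s0 + e / 2] -> `|s - s0| < e.
  rewrite in_itv /= => /andP[? ?]; rewrite ltr_norml; apply/andP; split; lra.
have Io (s : R) : `]s0 - e / 2, s0 + e / 2[%classic s -> `|s - s0| < e.
  by move=> sI; apply: Ie; apply: subset_itv_oo_cc.
have Is0 : `]s0 - e / 2, s0 + e / 2[%classic s0 by rewrite /= in_itv /=; apply/andP; split; lra.
have dl s u : `|s - s0| < e -> box a r u ->
    is_derive s (1 : R) (fun s => G (s, u)) ('D_((1, 0) : R * 'rV[R]_2) G (s, u)).
  by move=> se bu; apply: is_derive_fst; exact: smooth_at_diff (sG s u se bu).
have cs u s : {for (s, u), continuous G} -> {for u, continuous (fun u => G (s, u))}.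
  move=> cG; apply: (@continuous_comp _ _ _ (fun u => (s, u)) G) => //.
  apply/differentiable_continuous/differentiable_pair; first exact: differentiable_cst.
  by have [] := is_diff_id u.
(* The domination needed to differentiate under the integral: the parameter derivative is continuous
   on the compact product of a closed subinterval and the box, hence bounded there by a constant. *)
have cK : compact (`[s0 - e / 2, s0 + e / 2] `*` box a r).
  by apply: compact_setX; [exact: segment_compact|exact: box_compact].
have [C C0 HC] : exists2 C : R, 0 <= C & forall q, (`[s0 - e / 2, s0 + e / 2] `*` box a r) q ->
    `|'D_((1, 0) : R * 'rV[R]_2) G q| <= C.
  apply: continuous_on_compact_bounded cK _ => -[s u] [/= sI bu].
  by apply/smooth_at_cont/smooth_at_derive/sG => //; exact: Ie.
have mB := measurable_qbox a r.
have p1E s p : `|s - s0| < e -> qbox a r p ->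
    partial1of2 (fun s p => G (s, rV2 p)) s p = 'D_((1, 0) : R * 'rV[R]_2) G (s, rV2 p).
  by move=> se bp; rewrite partial1of2E; have [_ ->] := dl s _ se bp.
have intf s : `]s0 - e / 2, s0 + e / 2[%classic s ->
    la2.-integrable (qbox a r) (EFin \o (fun p => G (s, rV2 p))).
  move=> /Io se; apply: (integrable_qbox (G := fun u => G (s, u))) => // u bu.
  by apply/cs/smooth_at_cont/sG.
have derf s p : `]s0 - e / 2, s0 + e / 2[%classic s -> qbox a r p ->
    derivable (fun s => G (s, rV2 p)) s 1.
  by move=> /Io se bp; have [] := dl s _ se bp.
have intC : la2.-integrable (qbox a r) (EFin \o cst C).
  by apply: (integrable_qbox (G := cst C)) => // u _; exact: cst_continuous.
have ub s p : `]s0 - e / 2, s0 + e / 2[%classic s -> qbox a r p ->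
    `|partial1of2 (fun s p => G (s, rV2 p)) s p| <= C.
  move=> sI bp; rewrite p1E//; last exact: Io.
  by apply: HC; split => //=; apply: subset_itv_oo_cc.
have C0' : forall p : R * R, 0 <= cst C p by [].
have dF := @derivable_under_integral R _ _ la2 (fun s p => G (s, rV2 p)) _ mB _ _ _ Is0 intf derf _ C0' intC ub.
split; first exact: dF.
rewrite -derive1E (@differentiation_under_integral R _ _ la2 (fun s p => G (s, rV2 p)) _ mB _ _ _ Is0 intf derf _ C0' intC ub).
apply: eq_Rintegral => p; rewrite inE => bp; apply: p1E => //.
by rewrite subrr normr0.
Qed.

(** By continuity [G] exceeds [G a / 2] on a smaller square around [a], which has positive area, and
    [G] is nonnegative on the rest. *)
Lemma integral_qbox_gt0 a r (G : 'rV[R]_2 -> R) : 0 < r ->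
  (forall u, box a r u -> {for u, continuous G}) ->
  (forall u, box a r u -> 0 <= G u) -> 0 < G a ->
  0 < \int[la2]_(p in qbox a r) G (rV2 p).
Proof.
move=> r0 cG G0 Ga.
have baa : box a r a by rewrite /box /= subrr normr0 ltW.
have : \forall u \near a, G a / 2 < G u.
  by apply: (cvgr_gt _ (cG a baa)); rewrite ltr_pdivrMr// ltr_pMr// ltr1n.
move=> /nbhs_ballP[d /= d0 dG].
pose s := Num.min r (d / 2).
have s0 : 0 < s by rewrite lt_min r0 divr_gt0.
have sr u : box a s u -> box a r u.
  by rewrite /box /= => us; apply: le_trans us _; rewrite ge_min lexx.
have sG u : box a s u -> G a / 2 < G u.
  rewrite /box /= => us; apply: dG; rewrite -ball_normE /= distrC.
  apply: le_lt_trans us _; rewrite gt_min; apply/orP; right.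
  by rewrite ltr_pdivrMr// ltr_pMr// ltr1n.
have ints : la2.-integrable (qbox a r) (EFin \o (fun p => G (rV2 p))) by exact: integrable_qbox.
have intI : la2.-integrable (qbox a s) (EFin \o (fun p => G a / 2)).
  by apply: (integrable_qbox (G := cst (G a / 2))) => // u _; exact: cst_continuous.
apply: (@lt_le_trans _ _ (\int[la2]_(p in qbox a s) (G a / 2))).
  rewrite Rintegral_cst; last exact: measurable_qbox.
  by rewrite [X in fine X](qbox_measure a s0) /= !mulr_gt0// ?divr_gt0// addr_gt0.
have sub : qbox a s `<=` qbox a r by move=> p; exact: sr.
have intGs : la2.-integrable (qbox a s) (EFin \o (fun p => G (rV2 p))).
  apply: integrableS ints => //; exact: measurable_qbox.
apply: (@le_trans _ _ (\int[la2]_(p in qbox a s) G (rV2 p))).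
  apply: le_Rintegral => //; first exact: measurable_qbox.
  by move=> p; rewrite /= => /sG/ltW.
rewrite /Rintegral fine_le//.
- by apply: integrable_fin_num => //; exact: measurable_qbox.
- by apply: integrable_fin_num => //; exact: measurable_qbox.
apply: ge0_subset_integral => //; try exact: measurable_qbox.
  exact: measurable_int ints.
by move=> p bp; rewrite lee_fin G0.
Qed.

End Boxes.

Section BoxLinearity.
Context {R : realType}.
Local Notation la2 := (@lebesgue_measure R \x @lebesgue_measure R)%E.
Variables (a : 'rV[R]_2) (r : R).
Hypothesis r0 : 0 < r.

Lemma Rintegral_qboxB (G H : 'rV[R]_2 -> R) :
  (forall u, box a r u -> {for u, continuous G}) ->
  (forall u, box a r u -> {for u, continuous H}) ->
  \int[la2]_(p in qbox a r) (G (rV2 p) - H (rV2 p)) =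
  \int[la2]_(p in qbox a r) G (rV2 p) - \int[la2]_(p in qbox a r) H (rV2 p).
Proof.
move=> cG cH.
exact: (@RintegralB _ _ _ la2 _ (G \o @rV2 R) (H \o @rV2 R) (measurable_qbox a r)
  (integrable_qbox r0 cG) (integrable_qbox r0 cH)).
Qed.

Lemma Rintegral_qboxZ (k : R) (G : 'rV[R]_2 -> R) :
  (forall u, box a r u -> {for u, continuous G}) ->
  \int[la2]_(p in qbox a r) (k * G (rV2 p)) = k * \int[la2]_(p in qbox a r) G (rV2 p).
Proof.
move=> cG.
exact: (@RintegralZl _ _ _ la2 _ (G \o @rV2 R) k (measurable_qbox a r) (integrable_qbox r0 cG)).
Qed.

End BoxLinearity.

(** * Charts, forms and volume *)

Section Matrices2.
Context {R : realType}.

Lemma sum_ord2 (V : nmodType) (F : 'I_2 -> V) : \sum_i F i = F 0 + F 1.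
Proof. by rewrite !big_ord_recl big_ord0 addr0; congr (F _ + F _); exact: val_inj. Qed.

Lemma det_mx2 (P : 'M[R]_2) : \det P = P 0 0 * P 1 1 - P 0 1 * P 1 0.
Proof.
rewrite (expand_det_row _ 0) sum_ord2 /cofactor !det_mx11 !mxE /= expr0 expr1.
rewrite mul1r mulN1r mulrN; congr (_ * P _ _ - _ * P _ _); exact: val_inj.
Qed.

Lemma antisym_mx2 (b : 'M[R]_2) : b^T = - b ->
  [/\ b 0 0 = 0, b 1 1 = 0 & b 1 0 = - b 0 1].
Proof.
move=> /matrixP h.
have := h 0 0; have := h 1 1; have := h 0 1; rewrite !mxE => h01 h11 h00.
by split=> //; lra.
Qed.

(** Antisymmetric 2 x 2 matrices form a line, on which congruence by [P] acts as multiplication by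
    det P. This turns every change of variables for 2-forms on a surface into a Jacobian
    determinant. *)
Lemma congr_antisym_mx2 (P b : 'M[R]_2) : b^T = - b ->
  (P *m b *m P^T) 0 1 = \det P * b 0 1.
Proof.
move=> /antisym_mx2[h0 h1 h2].
by rewrite det_mx2 !mxE !sum_ord2 !mxE !sum_ord2 h0 h1 h2; ring.
Qed.

Lemma antisym_congr m n (P : 'M[R]_(m, n)) (b : 'M[R]_n) : b^T = - b ->
  (P *m b *m P^T)^T = - (P *m b *m P^T).
Proof. by move=> h; rewrite !trmx_mul trmxK h mulNmx mulmxN mulmxA. Qed.

Lemma posdef_det2_gt0 (G : 'M[R]_2) : G^T = G ->
  (forall v : 'rV[R]_2, v != 0 -> 0 < (v *m G *m v^T) 0 0) -> 0 < \det G.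
Proof.
move=> Gs Gp.
have G10 : G 1 0 = G 0 1 by have /matrixP/(_ 0 1) := Gs; rewrite mxE.
have q (v : 'rV[R]_2) : (v *m G *m v^T) 0 0 =
    v 0 0 * v 0 0 * G 0 0 + 2 * v 0 0 * v 0 1 * G 0 1 + v 0 1 * v 0 1 * G 1 1.
  by rewrite !mxE !sum_ord2 !mxE !sum_ord2 G10; ring.
have G00 : 0 < G 0 0.
  have e0 : e_ 0 != 0 :> 'rV[R]_2.
    by apply/eqP => /matrixP/(_ 0 0); rewrite !mxE /= => /eqP; rewrite oner_eq0.
  by have := Gp _ e0; rewrite q !mxE /=; lra.
(* This vector is chosen so that the quadratic form takes the value [G 0 0 * \det G] on it. *)
pose v : 'rV[R]_2 := rV2 (- G 0 1, G 0 0).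
have v0 : v != 0.
  by apply/eqP => /matrixP/(_ 0 1); rewrite !mxE /= => h; rewrite h ltxx in G00.
have := Gp _ v0; rewrite q !mxE /= det_mx2 G10 => h.
rewrite -(pmulr_rgt0 _ G00); move: h; congr (is_true (0 < _)); ring.
Qed.

End Matrices2.

Section Charts.
Context {R : realType} {n : nat} {M : topologicalType}.
Implicit Types (c d : chart R n M) (A : manifold R n M).

Lemma cimgP c u : cimg c u -> cdom c (cinv c u) /\ cmap c (cinv c u) = u.
Proof. by move=> [x cx <-]; rewrite cmapK. Qed.

Lemma cimg_cmap c x : cdom c x -> cimg c (cmap c x).
Proof. by exists x. Qed.

Lemma nbhs_cdom c x : cdom c x -> nbhs x (cdom c).
Proof. by move=> cx; apply: open_nbhs_nbhs; split=> //; exact: cdom_open. Qed.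

Lemma nbhs_cimg c u : cimg c u -> nbhs u (cimg c).
Proof. by move=> cu; apply: open_nbhs_nbhs; split=> //; exact: cimg_open. Qed.

Lemma open_chart_set c (P : set M) : open P -> open [set u | cimg c u /\ P (cinv c u)].
Proof.
move=> oP; rewrite openE => u [cu Pu]; rewrite /interior.
have n1 : nbhs u (cimg c) by exact: nbhs_cimg.
have n2 : \forall v \near u, P (cinv c v).
  by apply: (cinv_continuous cu); exact: open_nbhs_nbhs.
by apply: filterS (filterI n1 n2) => v [].
Qed.

Lemma near_cinv c x (P : set M) : cdom c x -> nbhs x P ->
  \forall u \near cmap c x, cimg c u /\ P (cinv c u).
Proof.
move=> cx nP.
have n1 : nbhs (cmap c x) (cimg c).
  by exact/nbhs_cimg/cimg_cmap.
have n2 : \forall v \near cmap c x, P (cinv c v).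
  by apply: (cinv_continuous (cimg_cmap cx)); rewrite cmapK.
exact: filterI.
Qed.

Lemma near_cmap c x (P : set 'rV[R]_n) : cdom c x -> nbhs (cmap c x) P ->
  \forall y \near x, cdom c y /\ P (cmap c y).
Proof.
move=> cx nP.
have n1 : nbhs x (cdom c) by exact: nbhs_cdom.
have n2 : \forall y \near x, P (cmap c y) by apply: (cmap_continuous cx).
exact: filterI.
Qed.

Lemma transition_smooth A c d x : atlas A c -> atlas A d -> cdom c x -> cdom d x ->
  smooth_at (cmap d \o cinv c) (cmap c x).
Proof.
move=> Ac Ad cx dx.
apply: (SmoothAt _ (atlas_smooth Ac Ad)); split.
  by apply: open_chart_set; exact: cdom_open.
by split; [exact: cimg_cmap|rewrite cmapK].
Qed.

Lemma near_eq_jacobian m p (f g : 'rV[R]_m -> 'rV[R]_p) u : smooth_at f u ->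
  (\forall v \near u, f v = g v) -> 'J f u = 'J g u.
Proof.
move=> sf fg.
have sg := smooth_at_eq fg sf.
apply/matrixP => i j.
apply: (etrans (jacobianE i j (smooth_at_diff sf))).
apply: (etrans _ (esym (jacobianE i j (smooth_at_diff sg)))).
by rewrite (near_eq_derive _ fg).
Qed.

End Charts.

Section SmoothMaps.
Context {R : realType} {m n : nat} {M N : topologicalType}.
Variables (A : manifold R m M) (B : manifold R n N).
Implicit Types (phi : M -> N).

Lemma smooth_chart_change phi c c' d d' x : {for x, continuous phi} ->
  atlas A c -> atlas A c' -> atlas B d -> atlas B d' ->
  cdom c x -> cdom c' x -> cdom d (phi x) -> cdom d' (phi x) ->
  smooth_at (cmap d \o phi \o cinv c) (cmap c x) ->
  smooth_at (cmap d' \o phi \o cinv c') (cmap c' x).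
Proof.
move=> cphi Ac Ac' Bd Bd' cx cx' dx dx' sphi.
have s1 := transition_smooth Ac' Ac cx' cx.
have s2 := transition_smooth Bd Bd' dx dx'.
have E1 : (cmap c \o cinv c') (cmap c' x) = cmap c x by rewrite /= cmapK.
have E2 : (cmap d \o phi \o cinv c) (cmap c x) = cmap d (phi x) by rewrite /= cmapK.
have s12 : smooth_at (fun u => (cmap d \o phi \o cinv c) ((cmap c \o cinv c') u)) (cmap c' x).
  by apply: smooth_at_comp_rV => //; rewrite E1.
have s123 : smooth_at (fun u => (cmap d' \o cinv d)
    ((cmap d \o phi \o cinv c) ((cmap c \o cinv c') u))) (cmap c' x).
  by apply: smooth_at_comp_rV => //; rewrite E1 E2.
apply: smooth_at_eq s123.
have nd : nbhs x (fun y => cdom c y /\ cdom d (phi y)).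
  apply: filterI; first by exact: nbhs_cdom.
  by apply: cphi; exact: nbhs_cdom.
apply: filterS (near_cinv cx' nd) => u [_ [cu du]] /=.
by rewrite (cmapK cu) (cmapK du).
Qed.

Lemma smooth_mapP phi : smooth_map A B phi <->
  continuous phi /\ forall c d x, atlas A c -> atlas B d -> cdom c x -> cdom d (phi x) ->
    smooth_at (cmap d \o phi \o cinv c) (cmap c x).
Proof.
have oS c d : continuous phi -> open [set u | cimg c u /\ cdom d (phi (cinv c u))].
  move=> cphi; apply: (open_chart_set (P := phi @^-1` cdom d)).
  by apply: open_comp (cdom_open d) => ? _; exact: cphi.
split=> -[cphi H]; split=> // c d.
  move=> x Ac Bd cx dx.
  apply: (SmoothAt _ (H c d Ac Bd)); split; first exact: oS.
  by split; [exact: cimg_cmap|rewrite cmapK].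
move=> Ac Bd; apply/smooth_onP; first exact: oS.
by move=> u [cu du]; have [cx <-] := cimgP cu; apply: H.
Qed.

Lemma smooth_map_local phi : continuous phi ->
  (forall x, exists c d, [/\ atlas A c, atlas B d, cdom c x, cdom d (phi x) &
    smooth_at (cmap d \o phi \o cinv c) (cmap c x)]) -> smooth_map A B phi.
Proof.
move=> cphi H; apply/smooth_mapP; split=> // c' d' x Ac' Bd' cx' dx'.
have [c [d [Ac Bd cx dx sphi]]] := H x.
by apply: (smooth_chart_change (c := c) (d := d)); auto; exact: cphi.
Qed.

(** [pullback] is defined through the chart that [chart_at] picks around the image point. The
    transformation law of [w] and the chain rule absorb the transition Jacobian, so any other target
    chart gives the same matrix. *)
Lemma pullbackE phi (w : tensor2 B) c d x : smooth_map A B phi -> atlas A c -> atlas B d ->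
  cdom c x -> cdom d (phi x) ->
  pullback phi w c (cmap c x) = 'J (cmap d \o phi \o cinv c) (cmap c x) *m
    w d (cmap d (phi x)) *m ('J (cmap d \o phi \o cinv c) (cmap c x))^T.
Proof.
move=> /smooth_mapP[cphi sphi] Ac Bd cx dx.
rewrite /pullback (cmapK cx); set e := chart_at B (phi x).
have [Be ex] : atlas B e /\ cdom e (phi x) by rewrite /e /chart_at; case: cid.
have sd := sphi c d x Ac Bd cx dx.
have st := transition_smooth Bd Be dx ex.
have E2 : (cmap d \o phi \o cinv c) (cmap c x) = cmap d (phi x) by rewrite /= cmapK.
have JE : 'J (cmap e \o phi \o cinv c) (cmap c x) =
    'J (cmap d \o phi \o cinv c) (cmap c x) *m transition_jacobian d e (phi x).
  rewrite /transition_jacobian -E2 -jacobian_comp; last 2 first.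
  - exact: smooth_at_diff.
  - by rewrite E2; exact: smooth_at_diff.
  apply: near_eq_jacobian; first exact: sphi.
  have nd : nbhs x (fun y => cdom d (phi y)).
    by apply: cphi; exact: nbhs_cdom.
  by apply: filterS (near_cinv cx nd) => u [_ du] /=; rewrite (cmapK du).
by rewrite JE (tensor2_transform w Bd Be dx ex) trmx_mul !mulmxA.
Qed.

End SmoothMaps.

Section Forms.
Context {R : realType} {n : nat} {M : topologicalType}.
Variable A : manifold R n M.

(** A predicate on bare coefficient families, since [pullback] and [ext_d1] produce such families
    rather than elements of [tensor2]. *)
Definition form2 (a : coefs2 R n M) := forall c x, atlas A c -> cdom c x ->
  [/\ (a c (cmap c x))^T = - a c (cmap c x), smooth_at (a c) (cmap c x) &
    forall d, atlas A d -> cdom d x -> a c (cmap c x) =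
      transition_jacobian c d x *m a d (cmap d x) *m (transition_jacobian c d x)^T].

Lemma tensor2_smooth_at (w : tensor2 A) c x : atlas A c -> cdom c x ->
  smooth_at (w c) (cmap c x).
Proof.
move=> Ac cx; have /smooth_onP := tensor2_smooth w Ac; apply; first exact: cimg_open.
exact: cimg_cmap.
Qed.

Lemma oneform_smooth_at (al : oneform A) c x : atlas A c -> cdom c x ->
  smooth_at (al c) (cmap c x).
Proof.
move=> Ac cx; have /smooth_onP := oneform_smooth al Ac; apply; first exact: cimg_open.
exact: cimg_cmap.
Qed.

Lemma ext_d1_smooth (a : coefs1 R n M) c u : smooth_at (a c) u -> smooth_at (ext_d1 a c) u.
Proof.
move=> sa; apply/smooth_at_mx => i j.
have -> : (fun v => ext_d1 a c v i j) =
    (fun v => ('D_(e_ i) (a c) v) 0 j - ('D_(e_ j) (a c) v) 0 i).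
  by apply/funext => v; rewrite mxE.
by apply: smooth_atB; [have /smooth_at_mx := smooth_at_derive (e_ i) sa|
  have /smooth_at_mx := smooth_at_derive (e_ j) sa]; apply.
Qed.

Lemma form2_ext_d1 (al : oneform A) : form2 (ext_d1 al).
Proof.
move=> c x Ac cx; split.
- by apply/matrixP => i j; rewrite !mxE opprB.
- exact/ext_d1_smooth/oneform_smooth_at.
move=> d Ad dx.
set tau := cmap d \o cinv c; set u := cmap c x.
have st : smooth_at tau u := transition_smooth Ac Ad cx dx.
have tu : tau u = cmap d x by rewrite /tau /u /= cmapK.
have sd : smooth_at (al d) (tau u) by rewrite tu; exact: oneform_smooth_at.
have nE : \forall v \near u, al c v = \sum_k (al d (tau v)) 0 k *: (col k ('J tau v))^T.
  have nd : nbhs x (cdom d) by exact: nbhs_cdom.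
  apply: filterS (near_cinv cx nd) => v [cv dv].
  have [cy yE] := cimgP cv.
  have := oneform_transform al Ac Ad cy dv.
  rewrite /transition_jacobian yE -/tau => ->.
  apply/rowP => j; rewrite !mxE summxE; apply: eq_bigr => k _.
  by rewrite !mxE.
have sJ := smooth_at_jacobian st.
have Dal i j : ('D_(e_ i) (al c) u) 0 j =
    \sum_k ((\sum_l ('J tau u) i l * ('D_(e_ l) (al d) (tau u)) 0 k) * ('J tau u) j k
      + (al d (tau u)) 0 k * 'D_(e_ i) (fun v => ('J tau v) j k) u).
  have sc : smooth_at (al c) u by exact: oneform_smooth_at.
  apply: (etrans (derive_mxE 0 j (smooth_at_derivable sc))).
  transitivity ('D_(e_ i) (fun v => \sum_k (al d (tau v)) 0 k * ('J tau v) j k) u).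
    apply: near_eq_derive; apply: filterS nE => v ->.
    by rewrite summxE; apply: eq_bigr => k _; rewrite !mxE.
  have sk k : smooth_at (fun v => (al d (tau v)) 0 k) u.
    have : smooth_at (fun v => al d (tau v)) u.
      exact: smooth_at_comp_rV.
    by move/smooth_at_mx; apply.
  have sjk k : smooth_at (fun v => ('J tau v) j k) u by have /smooth_at_mx := sJ; apply.
  rewrite (_ : (fun v => \sum_k (al d (tau v)) 0 k * ('J tau v) j k) =
    \sum_k ((fun v => (al d (tau v)) 0 k) * (fun v => ('J tau v) j k))); last first.
    by apply/funext => v; rewrite fct_sumE.
  rewrite derive_sum; last by move=> k; apply: derivableM; exact: smooth_at_derivable.
  apply: eq_bigr => k _.
  rewrite deriveM; [|exact: smooth_at_derivable|exact: smooth_at_derivable].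
  rewrite addrC /GRing.scale /=; congr (_ + _); rewrite mulrC; congr (_ * _).
  transitivity (('D_(e_ i) (al d \o tau) u) 0 k).
    apply: esym; apply: derive_mxE; apply: smooth_at_derivable.
    exact: smooth_at_comp_rV.
  rewrite derive_comp; [|exact: smooth_at_diff|exact: smooth_at_diff].
  have -> : 'D_(e_ i) tau u = \sum_l ('J tau u) i l *: e_ l.
    rewrite [LHS]row_sum_delta; apply: eq_bigr => l _; congr (_ *: _).
    by rewrite (jacobianE _ _ (smooth_at_diff st)).
  rewrite deriveDir_sum; last exact: smooth_at_diff.
  by rewrite summxE; apply: eq_bigr => l _; rewrite mxE.
(* The terms of D_i a_j involving second derivatives of the transition map are symmetric in i and j,
   so they cancel in D_i a_j - D_j a_i. This is why d is independent of coordinates. *)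
have sym i j k : 'D_(e_ i) (fun v => ('J tau v) j k) u = 'D_(e_ j) (fun v => ('J tau v) i k) u.
  have E a b : 'D_(e_ a) (fun v => ('J tau v) b k) u = 'D_(e_ a) ('D_(e_ b) (fun v => tau v 0 k)) u.
    apply: near_eq_derive; apply: filterS (smooth_at_near st) => v sv.
    apply: (etrans (jacobianE _ _ (smooth_at_diff sv))).
      exact: (derive_mxE 0 k (smooth_at_derivable sv)).
  apply: (etrans (E i j)); apply: (etrans _ (esym (E j i))).
  by apply: derive_derive_comm; have /smooth_at_mx := st; apply.
apply/matrixP => i j.
rewrite [LHS]mxE Dal Dal -tu /transition_jacobian -/tau -/u.
under [X in _ - X]eq_bigr do rewrite (sym j i).
rewrite -sumrB.
transitivity (\sum_k \sum_l ('J tau u) i l * ('J tau u) j k * ('D_(e_ l) (al d) (tau u)) 0 k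
   - \sum_k \sum_l ('J tau u) i k * ('J tau u) j l * ('D_(e_ l) (al d) (tau u)) 0 k).
  rewrite -sumrB; apply: eq_bigr => k _.
  rewrite opprD addrACA subrr addr0 !mulr_suml -!sumrB; apply: eq_bigr => l _.
  move: ('J tau u) ('D_(e_ l) (al d) (tau u)) => J D; ring.
rewrite [X in _ - X]exchange_big -sumrB mxE; apply: eq_bigr => k _.
rewrite [(_ *m _) i k]mxE mulr_suml -sumrB; apply: eq_bigr => l _.
rewrite !mxE; move: ('J tau u) ('D_(e_ l) (al d) (tau u)) ('D_(e_ k) (al d) (tau u)) => J D D';
  ring.
Qed.

End Forms.

Section PullbackForms.
Context {R : realType} {m n : nat} {M N : topologicalType}.
Variables (A : manifold R m M) (B : manifold R n N).

Lemma form2_pullback (phi : M -> N) (w : tensor2 B) : smooth_map A B phi ->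
  (forall c u, atlas B c -> cimg c u -> (w c u)^T = - w c u) ->
  form2 A (pullback phi w).
Proof.
move=> sm wa c x Ac cx.
have [cphi sphi] := (smooth_mapP A B phi).1 sm.
have [d [Bd dx]] := atlas_cover B (phi x).
have sd := sphi c d x Ac Bd cx dx.
have nd : nbhs x (fun y => cdom d (phi y)).
  by apply: cphi; exact: nbhs_cdom.
split.
- rewrite (pullbackE w sm Ac Bd cx dx); apply: antisym_congr; apply: wa => //.
  exact: cimg_cmap.
- apply: (@smooth_at_eq _ _ _ (fun u => 'J (cmap d \o phi \o cinv c) u *m
    w d ((cmap d \o phi \o cinv c) u) *m ('J (cmap d \o phi \o cinv c) u)^T)).
    apply: filterS (near_cinv cx nd) => u [cu du].
    have [cy yE] := cimgP cu.
    by have := pullbackE w sm Ac Bd cy du; rewrite yE /= => ->.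
  have sJ := smooth_at_jacobian sd.
  apply: smooth_at_mulmx; last exact: smooth_at_trmx.
  apply: smooth_at_mulmx => //.
  apply: smooth_at_comp_rV => //.
  by rewrite /= (cmapK cx); exact: tensor2_smooth_at.
- move=> c' Ac' cx'.
  rewrite (pullbackE w sm Ac Bd cx dx) (pullbackE w sm Ac' Bd cx' dx).
  have st := transition_smooth Ac Ac' cx cx'.
  have sd' := sphi c' d x Ac' Bd cx' dx.
  have tE : (cmap c' \o cinv c) (cmap c x) = cmap c' x by rewrite /= cmapK.
  have -> : 'J (cmap d \o phi \o cinv c) (cmap c x) =
      transition_jacobian c c' x *m 'J (cmap d \o phi \o cinv c') (cmap c' x).
    rewrite /transition_jacobian -tE -jacobian_comp; last 2 first.
    - exact: smooth_at_diff.
    - by rewrite tE; exact: smooth_at_diff.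
    apply: near_eq_jacobian; first exact: sd.
    have nc : nbhs x (cdom c') by exact: nbhs_cdom.
    by apply: filterS (near_cinv cx nc) => u [_ du] /=; rewrite (cmapK du).
  by rewrite trmx_mul !mulmxA.
Qed.

End PullbackForms.

Section InnerSurface.
Context {R : realType} {M : topologicalType}.
Variables (A : manifold R 2 M) (g : tensor2 A) (gr : riemannian g).

Lemma metric_det_gt0 c x : atlas A c -> cdom c x -> 0 < \det (g c (cmap c x)).
Proof.
by move=> Ac cx; have [? ?] := gr Ac (cimg_cmap cx); exact: posdef_det2_gt0.
Qed.

(** Raising both indices of a 2-form on a surface divides its only coefficient by det g. When
    passing from the chart picked by [inner2] to [c], numerator and denominator both acquire the
    squared transition determinant, which cancels. *)
Lemma inner2E a b c x : form2 A a -> form2 A b -> atlas A c -> cdom c x ->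
  inner2 g a b x = a c (cmap c x) 0 1 * b c (cmap c x) 0 1 / \det (g c (cmap c x)).
Proof.
move=> fa fb Ac cx; rewrite /inner2; set d := chart_at A x.
have [Ad dx] : atlas A d /\ cdom d x by rewrite /d /chart_at; case: cid.
set u := cmap d x.
have [ad _ _] := fa d x Ad dx.
have [bd _ _] := fb d x Ad dx.
have -> : \sum_(i < 2) \sum_(j < 2 | (i < j)%N) a d u i j *
    (invmx (g d u) *m b d u *m invmx (g d u)) i j =
    a d u 0 1 * (invmx (g d u) *m b d u *m invmx (g d u)) 0 1.
  rewrite sum_ord2 (bigD1 (1 : 'I_2))//= big1 ?addr0; last first.
    by move=> [[|[|//]] ilt] //= /andP[_ /eqP]; case; exact: val_inj.
  by rewrite [X in _ + X]big1 ?addr0// => [[[|[|//]] ilt]].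
have gs : (invmx (g d u))^T = invmx (g d u).
  by rewrite trmx_inv; have [-> _] := gr Ad (cimg_cmap dx).
rewrite -{2}gs congr_antisym_mx2// det_inv.
have [_ _ /(_ d Ad dx) ->] := fa c x Ac cx.
have [_ _ /(_ d Ad dx) ->] := fb c x Ac cx.
rewrite (tensor2_transform g Ac Ad cx dx) !congr_antisym_mx2// !det_mulmx det_tr.
have d0 := metric_det_gt0 Ad dx.
have : \det (g c (cmap c x)) != 0 by rewrite gt_eqF// metric_det_gt0.
rewrite (tensor2_transform g Ac Ad cx dx) !det_mulmx det_tr -/u => t0.
have dT : \det (transition_jacobian c d x) != 0.
  by apply: contraNneq t0 => ->; rewrite !mul0r.
by rewrite -/u; field; rewrite dT gt_eqF.
Qed.

Lemma inner2_continuous a b : form2 A a -> form2 A b -> continuous (inner2 g a b).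
Proof.
move=> fa fb x; have [c [Ac cx]] := atlas_cover A x.
pose q u := a c u 0 1 * b c u 0 1 / \det (g c u).
have sq : smooth_at q (cmap c x).
  have [_ /smooth_at_mx sa _] := fa c x Ac cx.
  have [_ /smooth_at_mx sb _] := fb c x Ac cx.
  have /smooth_at_mx sg := tensor2_smooth_at g Ac cx.
  apply: smooth_atM; first exact: smooth_atM.
  apply: smooth_atV; first by rewrite gt_eqF// metric_det_gt0.
  have -> : (fun u => \det (g c u)) =
      fun u => g c u 0 0 * g c u 1 1 - g c u 0 1 * g c u 1 0.
    by apply/funext => u; exact: det_mx2.
  by apply: smooth_atB; exact: smooth_atM.
have cq : {for x, continuous (q \o cmap c)}.
  apply: continuous_comp; first exact: cmap_continuous.
  exact: smooth_at_cont.
have E : inner2 g a b x = q (cmap c x) by exact: inner2E.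
have nE : \forall y \near x, (q \o cmap c) y = inner2 g a b y.
  have nc : nbhs x (cdom c) by exact: nbhs_cdom.
  by apply: filterS nc => y cy; apply: esym; exact: inner2E.
rewrite /continuous_at E.
by apply: cvg_trans cq; exact: near_eq_cvg.
Qed.

End InnerSurface.

(** * The Riemannian measure in charts *)

Section Volume.
Context {R : realType} {M : ptopologicalType}.
Variables (A : manifold R 2 M) (g : tensor2 A).
Hypotheses (M_compact : compact [set: M]) (gr : riemannian g).

Local Notation la := (@lebesgue_measure R).
Local Notation la2 := (la \x la)%E.

(** The clause [cdom c x] cannot be dropped: [cmap c] is a total function with arbitrary values off
    the domain of [c]. *)
Definition cbox (c : chart R 2 M) a r : set M := [set x | cdom c x /\ box a r (cmap c x)].

Lemma cbox_compact c a r : box a r `<=` cimg c -> compact (cbox c a r).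
Proof.
move=> bc; have -> : cbox c a r = cinv c @` box a r.
  apply/seteqP; split=> [x [cx bx]|_ [u bu <-]]; first by exists (cmap c x) => //; exact: cmapK.
  by have [cx xE] := cimgP (bc _ bu); split=> //; rewrite xE.
apply: continuous_compact; last exact: box_compact.
by apply: continuous_in_subspaceT => u; rewrite inE => /bc; exact: cinv_continuous.
Qed.

Lemma cbox_closed c a r : box a r `<=` cimg c -> closed (cbox c a r).
Proof.
by move=> bc; apply: compact_closed; [exact: manifold_hausdorff A|exact: cbox_compact].
Qed.

Lemma open_borel (P : set M) : open P -> measurable (P : set (borel_space M)).
Proof. by move=> oP; exact: sub_sigma_algebra. Qed.

Lemma cbox_measurable c a r : box a r `<=` cimg c ->
  measurable (cbox c a r : set (borel_space M)).
Proof.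
move=> /cbox_closed /closed_openC /open_borel /measurableC.
by rewrite setCK.
Qed.

Lemma exists_cbox x (P : set M) : nbhs x P -> exists c a r,
  [/\ atlas A c, cdom c x, 0 < r, cmap c x = a &
      box a (3 * r) `<=` cimg c /\ cbox c a (2 * r) `<=` P].
Proof.
move=> nP; have [c [Ac cx]] := atlas_cover A x.
have /nbhs_ballP[e /= e0 eP] := near_cinv cx nP.
exists c, (cmap c x), (e / 4); split=> //; first by rewrite divr_gt0.
split.
- move=> u bu; have /eP[] : ball (cmap c x) e u; last by [].
  rewrite -ball_normE /= distrC; apply: le_lt_trans bu _.
  by rewrite mulrA ltr_pdivrMr// mulrC ltr_pM2l// ltr_nat.
- move=> y [cy bu]; have /eP[_] : ball (cmap c x) e (cmap c y).
    rewrite -ball_normE /= distrC; apply: le_lt_trans bu _.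
    by rewrite mulrA ltr_pdivrMr// mulrC ltr_pM2l// ltr_nat.
  by rewrite cmapK.
Qed.

Lemma nbhs_cbox c x r : cdom c x -> 0 < r -> nbhs x (cbox c (cmap c x) r).
Proof.
move=> cx r0.
have : nbhs (cmap c x) (box (cmap c x) r).
  apply/nbhs_ballP; exists r => //= u; rewrite -ball_normE /= distrC => /ltW.
  exact.
exact: near_cmap.
Qed.

Lemma box_sub (a : 'rV[R]_2) r s : r <= s -> box a r `<=` box a s.
Proof. by move=> rs u /= ur; exact: le_trans ur rs. Qed.

Lemma exists_core (x : M) (P : set M) : nbhs x P -> exists q : chart R 2 M * 'rV[R]_2 * R,
  let: (c, a, r) := q in
  [/\ atlas A c, 0 < r, box a (3 * r) `<=` cimg c, cbox c a (2 * r) `<=` P & nbhs x (cbox c a r)].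
Proof.
move=> nP; have [c [a [r [Ac cx r0 <- [bc bP]]]]] := exists_cbox nP.
by exists (c, cmap c x, r); split=> //; exact: nbhs_cbox.
Qed.

Lemma compact_nbhs_cover (P : M -> set M) : (forall x, nbhs x (P x)) ->
  exists s : seq M, forall x, exists2 y, y \in s & P y x.
Proof.
move=> nP; have [s [_ sP]] := compact_cover_seq M_compact (fun x _ => nP x).
by exists s => x; exact: sP.
Qed.

Variable mu : {measure set (borel_space M) -> \bar R}.
Hypothesis mu_volume : riemannian_volume g mu.

Definition sqrtg c u := Num.sqrt (\det (g c u)).

Lemma sqrtg_smooth c x : atlas A c -> cdom c x -> smooth_at (sqrtg c) (cmap c x).
Proof.
move=> Ac cx; apply: smooth_at_sqrt; first exact: metric_det_gt0.
have /smooth_at_mx sg := tensor2_smooth_at g Ac cx.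
have -> : (fun u => \det (g c u)) =
    fun u => g c u 0 0 * g c u 1 1 - g c u 0 1 * g c u 1 0.
  by apply/funext => u; exact: det_mx2.
by apply: smooth_atB; exact: smooth_atM.
Qed.

Lemma sqrtg_gt0 c x : atlas A c -> cdom c x -> 0 < sqrtg c (cmap c x).
Proof. by move=> Ac cx; rewrite sqrtr_gt0; exact: metric_det_gt0. Qed.

Lemma sqrtg_sqr c x : atlas A c -> cdom c x ->
  \det (g c (cmap c x)) = sqrtg c (cmap c x) * sqrtg c (cmap c x).
Proof. by move=> Ac cx; rewrite -expr2 sqr_sqrtr// ltW// metric_det_gt0. Qed.

Section ChartBox.
Variables (c : chart R 2 M) (a : 'rV[R]_2) (r : R).
Hypotheses (Ac : atlas A c) (r0 : 0 < r) (bc : box a r `<=` cimg c).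

Let sq_smooth u : box a r u -> smooth_at (sqrtg c) u.
Proof. by move=> /bc/cimgP[cx <-]; exact: sqrtg_smooth. Qed.

Let muE (E : set (borel_space M)) : measurable E -> E `<=` cbox c a r ->
  mu E = (\int[la2]_(p in qbox a r `&` (cinv c \o @rV2 R) @^-1` E) (sqrtg c (rV2 p))%:E)%E.
Proof.
move=> mE EB; rewrite (mu_volume Ac mE); last by move=> x /EB[].
congr (integral _ _ _); apply/seteqP; split=> p.
  by move=> [x Ex xp]; have [cx bx] := EB _ Ex; split; rewrite /qbox /= -xp// cmapK.
move=> [bp Ep]; exists (cinv c (rV2 p)) => //.
by have [] := cimgP (bc bp).
Qed.

Let mphi : measurable_fun (qbox a r) (cinv c \o @rV2 R : R * R -> borel_space M).
Proof.
apply: (@measurability _ _ _ (borel_space M) _ _ (@open M) erefl) => // _ [V oV <-].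
apply: continuous_on_preimage_measurable => //.
- exact: measurable_qbox.
- exact: open_rV2_measurable.
- by move=> p bp; apply: cinv_continuous; exact: bc.
Qed.

Lemma cbox_lty : (mu (cbox c a r) < +oo)%E.
Proof.
have mB := cbox_measurable bc.
rewrite (muE mB) //.
have -> : qbox a r `&` (cinv c \o @rV2 R) @^-1` cbox c a r = qbox a r.
  apply/seteqP; split=> p; first by case.
  by move=> bp; split=> //; have [cx xE] := cimgP (bc bp); split=> //=; rewrite xE.
have /integrableP[_] : la2.-integrable (qbox a r) (EFin \o (fun p => sqrtg c (rV2 p))).
  by apply: integrable_qbox => // u bu; exact/smooth_at_cont/sq_smooth.
apply: le_lt_trans; apply: ge0_le_integral.
- exact: measurable_qbox.
- by move=> p _; rewrite lee_fin sqrtr_ge0.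
- apply/measurable_EFinP; apply: (measurable_qbox_fun (G := sqrtg c)) => u bu.
  exact/smooth_at_cont/sq_smooth.
- apply/measurable_EFinP; apply: measurableT_comp => //.
  by apply: (measurable_qbox_fun (G := sqrtg c)) => u bu; exact/smooth_at_cont/sq_smooth.
- by move=> p _; rewrite lee_fin ler_norm.
Qed.

Lemma Rintegral_cbox (f : M -> R) : (forall x, cbox c a r x -> {for x, continuous f}) ->
  \int[mu]_(x in cbox c a r) f x =
  \int[la2]_(p in qbox a r) (f (cinv c (rV2 p)) * sqrtg c (rV2 p)).
Proof.
move=> cf.
have mB := cbox_measurable bc.
have [C C0 fC] := continuous_on_compact_bounded (cbox_compact bc) cf.
have mQ := measurable_qbox a r.
have mw : measurable_fun (qbox a r) (fun p : R * R => sqrtg c (rV2 p)).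
  apply: (measurable_qbox_fun (G := sqrtg c)) => u bu.
  exact/smooth_at_cont/sq_smooth.
have w0 p : qbox a r p -> 0 <= sqrtg c (rV2 p) by move=> _; exact: sqrtr_ge0.
have QD p : qbox a r p -> cbox c a r ((cinv c \o @rV2 R) p).
  by move=> bp; have [cx xE] := cimgP (bc bp); split=> //=; rewrite xE.
have mf : measurable_fun (cbox c a r : set (borel_space M)) f.
  apply: (continuous_on_measurable_fun (j := id : borel_space M -> M) (f := f)) => //.
  by move=> P /open_borel.
exact: (@Rintegral_density _ _ _ _ R la2 mu (cinv c \o @rV2 R) _ _ _ mQ mB mw w0 mphi QD muE f C mf fC cbox_lty).
Qed.

Lemma Rintegral_supp_cbox (f : M -> R) : continuous f ->
  (forall x, ~ cbox c a r x -> f x = 0) ->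
  \int[mu]_x f x = \int[la2]_(p in qbox a r) (f (cinv c (rV2 p)) * sqrtg c (rV2 p)).
Proof.
move=> cf f0; rewrite -Rintegral_cbox; last by move=> x _; exact: cf.
rewrite [RHS]Rintegral_mkcond; apply: eq_Rintegral => x _.
by rewrite patchE; case: ifPn => //; rewrite notin_setE => /f0.
Qed.

End ChartBox.

(** Compactness covers M by finitely many coordinate boxes, each of finite measure by [cbox_lty]. *)
Lemma volume_lty : (mu setT < +oo)%E.
Proof.
have [Q Qx] := choice (fun x => @exists_core x setT filterT).
pose F x : set M := let: (c, a, r) := Q x in cbox c a r.
have FP x : [/\ nbhs x (F x), measurable (F x : set (borel_space M)) & (mu (F x) < +oo)%E].
  rewrite /F; have := Qx x; case: (Q x) => -[c a] r [Ac r0 bc _ nx].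
  have bcr : box a r `<=` cimg c by apply: subset_trans bc; apply: box_sub; lra.
  by split=> //; [exact: cbox_measurable|exact: cbox_lty].
have [s sF] := compact_nbhs_cover (fun x => let: And3 h _ _ := FP x in h).
have L : forall s : seq M, let U := \big[setU/set0]_(y <- s) F y in
    measurable (U : set (borel_space M)) /\ (mu U < +oo)%E.
  elim=> [|y t [mU Uoo]] /=; first by rewrite big_nil measure0; split=> //; exact: ltry.
  have [_ mF Foo] := FP y.
  rewrite big_cons; split; first exact: measurableU.
  by apply: le_lt_trans (measureU2 _ mF mU) _; exact: lte_add_pinfty.
have [mU Uoo] := L s.
apply: le_lt_trans Uoo; apply: le_measure; rewrite ?inE//.
move=> x _; rewrite -bigcup_seq; have [y ys Fx] := sF x.
by exists y.
Qed.

Lemma integrable_continuous (f : M -> R) : continuous f ->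
  mu.-integrable setT (EFin \o f).
Proof.
move=> cf; apply: measurable_bounded_integrable => //.
- exact: volume_lty.
- apply: (continuous_on_measurable_fun (j := id : borel_space M -> M) (f := f)) => //.
    by move=> P /open_borel.
  by move=> x _; exact: cf.
- have [C C0 fC] := continuous_on_compact_bounded M_compact (fun x _ => cf x).
  exists C; split; first exact: num_real.
  by move=> K CK x _; apply: le_trans (fC x I) _; exact: ltW.
Qed.

Lemma RintegralB_continuous (f h : M -> R) : continuous f -> continuous h ->
  \int[mu]_x (f x - h x) = \int[mu]_x f x - \int[mu]_x h x.
Proof. by move=> cf ch; rewrite RintegralB//; exact: integrable_continuous. Qed.

End Volume.

Section BumpOnSurface.
Context {R : realType} {M : ptopologicalType}.
Variables (A : manifold R 2 M).
Implicit Types (c d : chart R 2 M).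

Definition cutoff c a r (x : M) : R := if `[< cdom c x >] then bump2 a r (cmap c x) else 0.

Lemma cutoffE c a r x : cdom c x -> cutoff c a r x = bump2 a r (cmap c x).
Proof. by move=> cx; rewrite /cutoff asboolT. Qed.

Lemma cutoff_01 c a r x : 0 <= cutoff c a r x <= 1.
Proof. by rewrite /cutoff; case: ifP => _; [exact: bump2_01|rewrite lexx ler01]. Qed.

Lemma cutoff_1 c a r x : 0 < r -> cbox c a r x -> cutoff c a r x = 1.
Proof. by move=> r0 [cx bx]; rewrite cutoffE// bump2_1. Qed.

Lemma cutoff_0 c a r x : 0 < r -> ~ cbox c a (2 * r) x -> cutoff c a r x = 0.
Proof.
move=> r0 nb; rewrite /cutoff; case: asboolP => // cx; apply: bump2_0 => //.
by rewrite leNgt; apply/negP => h; apply: nb; split=> //; exact: ltW.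
Qed.

Section Patch.
Variables (c : chart R 2 M) (a : 'rV[R]_2) (r : R).
Hypotheses (Ac : atlas A c) (r0 : 0 < r) (bc : box a (3 * r) `<=` cimg c).

Lemma box2_sub : box a (2 * r) `<=` cimg c.
Proof. by apply: subset_trans bc; apply: box_sub; rewrite ler_pM2r// ler_nat. Qed.

(** The box is compact in a Hausdorff space, hence closed. This is what makes objects extended
    trivially off a box smooth on all of M. *)
Lemma near_notin_cbox x : ~ cbox c a (2 * r) x -> \forall y \near x, ~ cbox c a (2 * r) y.
Proof.
move=> nx; apply: open_nbhs_nbhs; split=> //.
by apply: closed_openC; exact: (cbox_closed A box2_sub).
Qed.

(** On the domain of [c] the cutoff is a bump composed with a transition map; off it, the closed box
    is avoided on a whole neighbourhood, where the cutoff is 0. *)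
Lemma cutoff_smooth d x : atlas A d -> cdom d x ->
  smooth_at (cutoff c a r \o cinv d) (cmap d x).
Proof.
move=> Ad dx; have [cx|ncx] := pselect (cdom c x).
  apply: (@smooth_at_eq _ _ _ (fun u => bump2 a r ((cmap c \o cinv d) u))).
    have nc : nbhs x (cdom c) by exact: nbhs_cdom.
    by apply: filterS (near_cinv dx nc) => u [_ cu]; rewrite /= cutoffE.
  apply: smooth_at_comp_rV.
    exact: transition_smooth Ad Ac dx cx.
  exact: bump2_smooth.
have nb : ~ cbox c a (2 * r) x by move=> [].
apply: (@smooth_at_eq _ _ _ (fun=> 0)); last exact: smooth_at_cst.
by apply: filterS (near_cinv dx (near_notin_cbox nb)) => u [_ nu]; rewrite /= cutoff_0.
Qed.

End Patch.

End BumpOnSurface.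

(** * Inner variations *)

Section Variations.
Context {R : realType} {M N : topologicalType} {m n : nat}.
Variables (A : manifold R m M) (B : manifold R n N).

Lemma open_variation_domain eps (Phi : R -> M -> N) (c : chart R m M) (d : chart R n N) :
  (forall t x, `|t| < eps -> {for (t, x), continuous (fun p : R * M => Phi p.1 p.2)}) ->
  open [set p : R * 'rV[R]_m | [/\ `|p.1| < eps, cimg c p.2 &
                                   cdom d (Phi p.1 (cinv c p.2))]].
Proof.
move=> cP; rewrite openE => -[s v] [/= se cv dv]; rewrite /interior.
have c1 : {for (s, v), continuous (fun p : R * 'rV[R]_m => Phi p.1 (cinv c p.2))}.
  have cc : {for (s, v), continuous (fun p : R * 'rV[R]_m => (p.1, cinv c p.2))}.
    move=> P [[P1 P2] /= [n1 n2] HP].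
    have n2' : \forall w \near v, P2 (cinv c w) by apply: (cinv_continuous cv).
    by exists (P1, (fun w => P2 (cinv c w))) => //= -[q1 q2] [/= h1 h2];
      exact: (HP (q1, cinv c q2)).
  exact: (continuous_comp cc (cP s (cinv c v) se)).
have n1 : \forall p \near (s, v), cdom d (Phi p.1 (cinv c p.2)).
  by apply: c1; exact: nbhs_cdom.
have n2 : \forall q \near s, `|q| < eps.
  have cn : {for s, continuous (fun q : R => `|q|)} by exact: norm_continuous.
  exact: (cvgr_lt _ cn).
have n3 : nbhs v (cimg c) by exact: nbhs_cimg.
have n4 : \forall p \near (s, v), `|p.1| < eps /\ cimg c p.2.
  by exists ([set q : R | `|q| < eps], cimg c).
by apply: filterS (filterI n1 n4) => p [h1 [h2 h3]].
Qed.

Lemma smooth_variation_slice phi eps (Phi : R -> M -> N) t :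
  smooth_variation A B phi eps Phi -> `|t| < eps -> smooth_map A B (Phi t).
Proof.
move=> [_ cP sP] te.
have cPt x : {for x, continuous (Phi t)}.
  have c2 : {for x, continuous (fun y : M => (t, y))}.
    by move=> P [[P1 P2] /= [n1 n2] HP]; apply: filterS n2 => y P2y; apply: HP; split=> //=;
      exact: nbhs_singleton n1.
  exact: (continuous_comp c2 (cP t x te)).
apply/smooth_mapP; split=> [x|c d x Ac Bd cx dx]; first exact: cPt.
have sp : smooth_at (fun p : R * 'rV[R]_m => cmap d (Phi p.1 (cinv c p.2))) (t, cmap c x).
  apply: (SmoothAt _ (sP c d Ac Bd)); split; first exact: open_variation_domain.
  by split=> //=; [exact: cimg_cmap|rewrite cmapK].
exact: (smooth_at_pairr sp).
Qed.

End Variations.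

Section InnerVariation.
Context {R : realType} {M : ptopologicalType} {N : topologicalType} {n : nat}.
Variables (A : manifold R 2 M) (B : manifold R n N) (phi : M -> N).
Hypothesis phi_smooth : smooth_map A B phi.
Variables (c : chart R 2 M) (a : 'rV[R]_2) (r : R) (i : 'I_2).
Hypotheses (Ac : atlas A c) (r0 : 0 < r) (bc : box a (3 * r) `<=` cimg c).

Local Notation b := (bump2 a r).

(** A displacement affine in [t] is used in place of the flow of the field b e_i: it has the same
    velocity at time 0, and its Jacobian determinant is an explicit polynomial in [t]. *)
Definition shift_box (t : R) (u : 'rV[R]_2) : 'rV[R]_2 := u + (t * b u) *: e_ i.

Definition shift_map (t : R) (x : M) : M :=
  if `[< cdom c x >] then cinv c (shift_box t (cmap c x)) else x.

Lemma shift_box_out t u : ~ box a (2 * r) u -> shift_box t u = u.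
Proof.
move=> nu; rewrite /shift_box bump2_0 ?mulr0 ?scale0r ?addr0//.
by rewrite leNgt; apply/negP => h; apply: nu; exact: ltW.
Qed.

Lemma shift_box0 u : shift_box 0 u = u.
Proof. by rewrite /shift_box mul0r scale0r addr0. Qed.

Lemma norm_e_ (j : 'I_2) : `|e_ j : 'rV[R]_2| <= 1.
Proof.
by rewrite rV2_norm_le !mxE; apply/andP; split; case: (_ && _);
  rewrite ?normr1 ?normr0 ?lexx ?ler01.
Qed.

(** Only points of the box of radius [2 * r] move, and by at most the absolute value of [t], so they
    remain in the box of radius [3 * r] that the chart covers. *)
Lemma shift_box_cimg t u : `|t| < r -> cimg c u -> cimg c (shift_box t u).
Proof.
move=> tr cu; have [bu|/shift_box_out->//] := pselect (box a (2 * r) u).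
apply: bc; rewrite /box /= /shift_box addrAC (le_trans (ler_normD _ _))//.
have -> : 3 * r = 2 * r + r by ring.
apply: lerD => //; rewrite normrZ normrM.
have /andP[b0 b1] := bump2_01 a r u.
rewrite (ger0_norm b0); apply: le_trans (ltW tr).
apply: (@le_trans _ _ (`|t| * b u)); last by rewrite ler_piMr.
by apply: ler_piMr; [exact: mulr_ge0|exact: norm_e_].
Qed.

Lemma shift_mapE t x : cdom c x -> shift_map t x = cinv c (shift_box t (cmap c x)).
Proof. by move=> cx; rewrite /shift_map asboolT. Qed.

Lemma shift_map_out t x : ~ cbox c a (2 * r) x -> shift_map t x = x.
Proof.
move=> nx; rewrite /shift_map; case: asboolP => // cx.
by rewrite shift_box_out ?cmapK// => bx; apply: nx.
Qed.

Lemma shift_map_dom t x : `|t| < r -> cdom c x ->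
  cdom c (shift_map t x) /\ cmap c (shift_map t x) = shift_box t (cmap c x).
Proof.
by move=> tr cx; rewrite shift_mapE//; apply/cimgP/shift_box_cimg => //; exact: cimg_cmap.
Qed.

Lemma near_snd (U W : topologicalType) (u : U) (w : W) (P : set W) :
  nbhs w P -> \forall p \near (u, w), P p.2.
Proof. by move=> nP; exists (setT, P) => [|[q y] []] //=; split=> //; exact: filterT. Qed.

Lemma shift_box_smooth (p : R * 'rV[R]_2) :
  smooth_at (fun q : R * 'rV[R]_2 => shift_box q.1 q.2) p.
Proof.
apply: smooth_atD; first exact: smooth_at_snd.
apply: smooth_atZ; last exact: smooth_at_cst.
apply: smooth_atM; first exact: smooth_at_fst.
by case: p => t u; apply: smooth_at_comp_snd; exact: bump2_smooth.
Qed.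

Lemma shift_map_continuous t x : `|t| < r ->
  {for (t, x), continuous (fun p : R * M => shift_map p.1 p.2)}.
Proof.
move=> tr; have [cx|ncx] := pselect (cdom c x).
  have nc : nbhs x (cdom c) by exact: nbhs_cdom.
  have E : \forall p \near (t, x), cinv c (shift_box p.1 (cmap c p.2)) = shift_map p.1 p.2.
    by apply: filterS (near_snd t nc) => p cp; rewrite shift_mapE.
  rewrite /prop_for /continuous_at /= (shift_mapE t cx).
  apply: (cvg_trans (near_eq_cvg E)).
  have c1 : {for (t, x), continuous (fun p : R * M => (p.1, cmap c p.2))}.
    move=> P [[P1 P2] /= [n1 n2] HP].
    have n2' : \forall w \near x, P2 (cmap c w) by apply: (cmap_continuous cx).
    by exists (P1, (fun w => P2 (cmap c w))) => //= -[q1 q2] [/= h1 h2];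
      exact: (HP (q1, cmap c q2)).
  have c2 : {for (t, cmap c x), continuous (fun q : R * 'rV[R]_2 => shift_box q.1 q.2)}.
    exact/smooth_at_cont/shift_box_smooth.
  have c3 : {for shift_box t (cmap c x), continuous (cinv c)}.
    by apply: cinv_continuous; apply: shift_box_cimg => //; exact: cimg_cmap.
  exact: (continuous_comp (continuous_comp c1 c2) c3).
have nx : ~ cbox c a (2 * r) x by move=> [].
have E : \forall p \near (t, x), p.2 = shift_map p.1 p.2.
  apply: filterS (near_snd t (near_notin_cbox A r0 bc nx)) => p np.
  by rewrite shift_map_out.
rewrite /prop_for /continuous_at /= (shift_map_out t nx).
apply: (cvg_trans (near_eq_cvg E)).
exact: cvg_snd.
Qed.

Lemma inner_variation_smooth :
  smooth_variation A B phi r (fun t => phi \o shift_map t).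
Proof.
have [cphi sphi] := (smooth_mapP A B phi).1 phi_smooth.
have cP t x : `|t| < r -> {for (t, x), continuous (fun p : R * M => phi (shift_map p.1 p.2))}.
  by move=> tr; apply: (continuous_comp (shift_map_continuous tr)); exact: cphi.
split=> //.
  apply/funext => x /=; have [cx|ncx] := pselect (cdom c x).
    by rewrite shift_mapE// shift_box0 cmapK.
  by rewrite shift_map_out// => -[].
move=> c' d Ac' Bd; apply/smooth_onP.
  have oS := @open_variation_domain R M N 2 n r (fun t => phi \o shift_map t) c' d cP.
  exact: oS.
move=> [t v] [/= tr [x cx <-{v}]]; rewrite (cmapK cx) => dx.
have [dc|ndc] := pselect (cdom c x).
  have nc : nbhs x (cdom c) by exact: nbhs_cdom.
  apply: (@smooth_at_eq _ _ _ (fun p : R * 'rV[R]_2 =>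
    (cmap d \o phi \o cinv c) (shift_box p.1 ((cmap c \o cinv c') p.2)))).
    apply: filterS (near_snd t (near_cinv cx nc)) => p [_ cp] /=.
    by rewrite shift_mapE.
  have st := transition_smooth Ac' Ac cx dc.
  have E0 : (cmap c \o cinv c') (cmap c' x) = cmap c x by rewrite /= cmapK.
  have sin : smooth_at (fun p : R * 'rV[R]_2 => shift_box p.1 ((cmap c \o cinv c') p.2))
      (t, cmap c' x).
    have s2 := smooth_at_comp_snd t st.
    apply: smooth_atD; first exact: s2.
    apply: smooth_atZ; last exact: smooth_at_cst.
    apply: smooth_atM; first exact: smooth_at_fst.
    by apply: smooth_at_comp_rV; [exact: s2|exact: bump2_smooth].
  apply: smooth_at_comp_rV; first exact: sin.
  have [dy yE] := shift_map_dom tr dc.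
  have -> : shift_box (t, cmap c' x).1 ((cmap c \o cinv c') (t, cmap c' x).2) =
      cmap c (shift_map t x) by rewrite /= cmapK// yE.
  exact: sphi.
have nx : ~ cbox c a (2 * r) x by move=> [].
apply: (@smooth_at_eq _ _ _ (fun p : R * 'rV[R]_2 => (cmap d \o phi \o cinv c') p.2)).
  apply: filterS (near_snd t (near_cinv cx (near_notin_cbox A r0 bc nx))) => p [_ np] /=.
  by rewrite shift_map_out.
apply: smooth_at_comp_snd.
by apply: sphi => //; move: dx; rewrite /= shift_map_out.
Qed.

(** The Jacobian is the identity plus a matrix concentrated in column [i], so only its diagonal
    entry there contributes to the determinant. *)
Lemma jacobian_shift_box t u :
  \det ('J (shift_box t) u) = 1 + t * 'D_(e_ i) b u.
Proof.
have sb := bump2_smooth a r u.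
have db := smooth_at_diff sb.
have ds : differentiable (shift_box t) u.
  apply: (smooth_at_diff (V := 'rV[R]_2)).
  exact: (smooth_at_pairr (f := fun q : R * 'rV[R]_2 => shift_box q.1 q.2) (shift_box_smooth (t, u))).
have E k j : ('J (shift_box t) u) k j = (k == j)%:R + t * 'D_(e_ k) b u * (j == i)%:R.
  apply: (etrans (jacobianE k j ds)).
  have -> : 'D_(delta_mx 0 k) (shift_box t) u = e_ k + (t * 'D_(e_ k) b u) *: e_ i.
    have d1 : is_derive u (e_ k) (id : 'rV[R]_2 -> 'rV[R]_2) (e_ k) by exact: is_derive_id.
    have d2 : is_derive u (e_ k) (fun v => (t * b v) *: (e_ i : 'rV[R]_2)) ((t * 'D_(e_ k) b u) *: e_ i).
      have db' : differentiable (fun v => t * b v) u.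
        by apply: smooth_at_diff; apply: smooth_atM => //; exact: smooth_at_cst.
      split; first by apply: diff_derivable; apply: differentiable_scale => //;
        exact: differentiable_cst.
      rewrite (@derive_scale _ _ _ (fun v => t * b v) (cst (e_ i)) u (e_ k) db' (differentiable_cst _ _)).
      rewrite derive_cst scaler0 addr0; congr (_ *: _).
      have := @deriveZ _ _ _ b t u (e_ k) (diff_derivable db).
      exact.
    by have [_ ->] := is_deriveD d1 d2.
  by rewrite !mxE !eqxx /= (eq_sym j).
rewrite det_mx2 !E.
have : i = 0 \/ i = 1 by case: (i) => -[|[|//]] ilt; [left|right]; exact: val_inj.
by case=> -> /=; move: ('D_(e_ 0) b u) ('D_(e_ 1) b u) => D0 D1; ring.
Qed.

End InnerVariation.

(** * First variation of the energy and constancy of the density *)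

Section FirstVariation.
Context {R : realType} {M : ptopologicalType} {N : topologicalType} {n : nat}.
Variables (A : manifold R 2 M) (g : tensor2 A) (B : manifold R n N) (w : tensor2 B).
Hypotheses (M_compact : compact [set: M]) (gr : riemannian g).
Variable mu : {measure set (borel_space M) -> \bar R}.
Hypothesis mu_volume : riemannian_volume g mu.
Hypothesis w_antisym : forall c u, atlas B c -> cimg c u -> (w c u)^T = - w c u.

Local Notation la2 := (@lebesgue_measure R \x @lebesgue_measure R)%E.

Lemma pullback_near_eq (phi psi : M -> N) c x : smooth_map A B phi ->
  atlas A c -> cdom c x -> (\forall y \near x, phi y = psi y) ->
  pullback phi w c (cmap c x) = pullback psi w c (cmap c x).
Proof.
move=> /smooth_mapP[cphi sphi] Ac cx E.
have Ex : phi x = psi x by exact: (nbhs_singleton E).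
rewrite /pullback (cmapK cx) -Ex; set d := chart_at B (phi x).
have [Bd dx] : atlas B d /\ cdom d (phi x) by rewrite /d /chart_at; case: cid.
suff -> : 'J (cmap d \o psi \o cinv c) (cmap c x) = 'J (cmap d \o phi \o cinv c) (cmap c x) by [].
apply: esym; apply: near_eq_jacobian; first exact: sphi.
by apply: filterS (near_cinv cx E) => u [_ Eu] /=; rewrite Eu.
Qed.

Lemma chart_atP (x : M) : atlas A (chart_at A x) /\ cdom (chart_at A x) x.
Proof. by rewrite /chart_at; case: cid. Qed.

Definition coef01 (phi : M -> N) (c : chart R 2 M) (u : 'rV[R]_2) : R := pullback phi w c u 0 1.

(* The function f with phi^*w = f dvol_g, read in the chart c. *)
Definition density (phi : M -> N) (c : chart R 2 M) (u : 'rV[R]_2) : R := coef01 phi c u / sqrtg g c u.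

Lemma form2_pull phi : smooth_map A B phi -> form2 A (pullback phi w).
Proof. by move=> sm; exact: form2_pullback. Qed.

Lemma pullback01_smooth phi c x : smooth_map A B phi -> atlas A c -> cdom c x ->
  smooth_at (coef01 phi c) (cmap c x).
Proof. by move=> sm Ac cx; have [_ /smooth_at_mx + _] := form2_pull sm Ac cx; apply. Qed.

Lemma density_smooth phi c x : smooth_map A B phi -> atlas A c -> cdom c x ->
  smooth_at (density phi c) (cmap c x).
Proof.
move=> sm Ac cx; apply: smooth_atM; first exact: pullback01_smooth.
by apply: smooth_atV; [rewrite gt_eqF// sqrtg_gt0|exact: sqrtg_smooth].
Qed.

(** With F = f s and det g = s^2, the integrand <b, phi^*w> dvol reads b_01 f in coordinates, with
    no metric factor left. Integrals against [phi^*w] thereby become plain Lebesgue integrals. *)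
Lemma inner2_density phi b c x : smooth_map A B phi -> form2 A b -> atlas A c -> cdom c x ->
  inner2 g b (pullback phi w) x * sqrtg g c (cmap c x) =
  b c (cmap c x) 0 1 * density phi c (cmap c x).
Proof.
move=> sm fb Ac cx.
rewrite (inner2E gr fb (form2_pull sm) Ac cx) (sqrtg_sqr gr Ac cx) /density /coef01.
have := sqrtg_gt0 gr Ac cx; move: (sqrtg g c (cmap c x)) => s s0.
by field; rewrite gt_eqF.
Qed.

Variable phi : M -> N.
Hypotheses (phi_smooth : smooth_map A B phi) (phi_critical : critical_point g mu w phi).

Section Patch.
Variables (c : chart R 2 M) (a : 'rV[R]_2) (r : R) (i : 'I_2).
Hypotheses (Ac : atlas A c) (r0 : 0 < r) (bc : box a (3 * r) `<=` cimg c).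

Local Notation b := (bump2 a r).
Local Notation F := (coef01 phi c).
Local Notation s := (sqrtg g c).
Local Notation theta := (shift_box a r i).
Local Notation phi_ t := (phi \o shift_map c a r i t).

Let smooth_phi_ t : `|t| < r -> smooth_map A B (phi_ t).
Proof. exact: smooth_variation_slice (inner_variation_smooth phi_smooth i Ac r0 bc). Qed.

Let dom u : cimg c u -> cdom c (cinv c u) /\ cmap c (cinv c u) = u.
Proof. exact: cimgP. Qed.

Let F_smooth u : cimg c u -> smooth_at F u.
Proof. by move=> /dom[cx <-]; exact: pullback01_smooth. Qed.

Let s_smooth u : cimg c u -> smooth_at s u.
Proof. by move=> /dom[cx <-]; exact: sqrtg_smooth. Qed.

Let s_gt0 u : cimg c u -> 0 < s u.
Proof. by move=> /dom[cx <-]; exact: sqrtg_gt0. Qed.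

(** The chain rule makes the pullback matrix of the varied map the congruence, by the Jacobian of
    the shift, of the pullback matrix of [phi] at the shifted point; [congr_antisym_mx2] and
    [jacobian_shift_box] then give the factor. *)
Lemma pullback_inner_variation t x : `|t| < r -> cdom c x ->
  pullback (phi_ t) w c (cmap c x) 0 1 =
  F (theta t (cmap c x)) * (1 + t * 'D_(e_ i) b (cmap c x)).
Proof.
move=> tr cx.
have [dy yE] := shift_map_dom i r0 bc tr cx.
set y := shift_map c a r i t x in dy yE.
have [d [Bd dx]] := atlas_cover B (phi y).
have [cphi sphi] := (smooth_mapP A B phi).1 phi_smooth.
rewrite -yE /coef01 (pullbackE w phi_smooth Ac Bd dy dx).
rewrite (pullbackE w (smooth_phi_ tr) Ac Bd cx dx).
have wd : (w d (cmap d (phi y)))^T = - w d (cmap d (phi y)).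
  by apply: w_antisym => //; exact: cimg_cmap.
have st : smooth_at (theta t) (cmap c x).
  exact: (smooth_at_pairr (f := fun q : R * 'rV[R]_2 => theta q.1 q.2) (shift_box_smooth a r i (t, cmap c x))).
have sd : smooth_at (cmap d \o phi \o cinv c) (theta t (cmap c x)) by rewrite -yE; exact: sphi.
have -> : 'J (cmap d \o phi_ t \o cinv c) (cmap c x) =
    'J (theta t) (cmap c x) *m 'J (cmap d \o phi \o cinv c) (theta t (cmap c x)).
  rewrite -jacobian_comp; [|exact: smooth_at_diff|exact: smooth_at_diff].
  apply: near_eq_jacobian.
    have [_] := (smooth_mapP A B (phi_ t)).1 (smooth_phi_ tr).
    by apply.
  have nc : nbhs x (cdom c) by exact: nbhs_cdom.
  apply: filterS (near_cinv cx nc) => u [cu cv] /=.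
  by rewrite shift_mapE//; have [_ ->] := dom cu.
rewrite -yE; move: ('J (cmap d \o phi \o cinv c) (cmap c y)) => J.
move: ('J (theta t) (cmap c x)) (jacobian_shift_box a r i t (cmap c x)) => T detT.
have -> : T *m J *m w d (cmap d (phi_ t x)) *m (T *m J)^T =
    T *m (J *m w d (cmap d (phi_ t x)) *m J^T) *m T^T by rewrite trmx_mul !mulmxA.
rewrite congr_antisym_mx2; last exact: antisym_congr.
by rewrite detT mulrC.
Qed.

(** Squared norm of the varied pullback minus that of the original one, times the volume factor.
    Taking the difference localises the energy to the box, outside of which the map is unchanged. *)
Definition variation_integrand (q : R * 'rV[R]_2) := ((F (theta q.1 q.2) * (1 + q.1 * 'D_(e_ i) b q.2)) *
  (F (theta q.1 q.2) * (1 + q.1 * 'D_(e_ i) b q.2)) - F q.2 * F q.2) / s q.2.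

Let bc2 : box a (2 * r) `<=` cimg c.
Proof. exact: box2_sub r0 bc. Qed.

Local Notation G := variation_integrand.

Lemma energy_inner_variation t : `|t| < r ->
  energy g mu w (phi_ t) = energy g mu w phi + 2^-1 * \int[la2]_(p in qbox a (2 * r)) G (t, rV2 p).
Proof.
move=> tr.
have ft := form2_pull (smooth_phi_ tr).
have f0 := form2_pull phi_smooth.
have ct := inner2_continuous gr ft ft.
have c0 := inner2_continuous gr f0 f0.
rewrite /energy -mulrDr; congr (_ * _); apply/eqP; rewrite addrC -subr_eq; apply/eqP.
rewrite -(RintegralB_continuous M_compact gr mu_volume ct c0).
have r2 : 0 < 2 * r by rewrite mulr_gt0.
rewrite (Rintegral_supp_cbox gr mu_volume Ac r2 bc2); last 2 first.
- by move=> x; apply: cvgB; [exact: ct|exact: c0].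
- move=> x nx; apply/eqP; rewrite subr_eq0; apply/eqP.
  have [Ad dx] := chart_atP x.
  have E : \forall y \near x, phi_ t y = phi y.
    by apply: filterS (near_notin_cbox A r0 bc nx) => y ny; rewrite /= shift_map_out.
  by rewrite /inner2 (pullback_near_eq (smooth_phi_ tr) Ad dx E).
apply: eq_Rintegral => p; rewrite inE => bp.
have cp : cimg c (rV2 p) by exact: bc2.
have [cx xE] := dom cp.
have E1 := inner2E gr ft ft Ac cx; have E2 := inner2E gr f0 f0 Ac cx.
have E3 := pullback_inner_variation tr cx.
have E4 := sqrtg_sqr gr Ac cx.
rewrite xE in E1 E2 E3 E4.
rewrite E3 E4 in E1; rewrite E4 in E2.
rewrite [X in (X - _) * _]E1 [X in (_ - X) * _]E2 /variation_integrand /=.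
have := s_gt0 cp; rewrite -[pullback phi w c (rV2 p) 0 1]/(F (rV2 p)).
move: (F (theta t (rV2 p))) (F (rV2 p)) ('D_(e_ i) b (rV2 p)) (s (rV2 p)) => x1 x2 x3 x4 x40.
by field; rewrite gt_eqF.
Qed.

Let G_smooth t u : `|t| < r -> box a (2 * r) u -> smooth_at G (t, u).
Proof.
move=> tr bu; have cu := bc2 bu.
have h2 (f : 'rV[R]_2 -> R) : smooth_at f u -> smooth_at (fun q : R * 'rV[R]_2 => f q.2) (t, u).
  exact: smooth_at_comp_snd.
have h1 : smooth_at (fun q : R * 'rV[R]_2 => F (theta q.1 q.2) * (1 + q.1 * 'D_(e_ i) b q.2)) (t, u).
  apply: smooth_atM.
    apply: (smooth_at_comp_rV (f := fun q : R * 'rV[R]_2 => theta q.1 q.2) (g := F)).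
      exact: shift_box_smooth.
    by apply: F_smooth; exact: (shift_box_cimg i r0 bc tr cu).
  apply: smooth_atD; first exact: smooth_at_cst.
  apply: smooth_atM; first exact: smooth_at_fst.
  exact: (h2 _ (smooth_at_derive (e_ i) (bump2_smooth a r u))).
apply: smooth_atM.
  apply: smooth_atB; first exact: (smooth_atM h1 h1).
  have hF := h2 _ (F_smooth cu).
  exact: (smooth_atM hF hF).
exact: (h2 (fun u => (s u)^-1) (smooth_atV (lt0r_neq0 (s_gt0 cu)) (s_smooth cu))).
Qed.

Let dG u : box a (2 * r) u ->
  'D_((1, 0) : R * 'rV[R]_2) G (0, u) =
  2 * F u * (b u * 'D_(e_ i) F u + F u * 'D_(e_ i) b u) / s u.
Proof.
move=> bu; have cu := bc2 bu.
have z0 : `|0 : R| < r by rewrite normr0.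
have [_ <-] := is_derive_fst (smooth_at_diff (G_smooth z0 bu)).
have sF := smooth_at_diff (F_smooth cu).
have d1 : is_derive (0 : R) (1 : R) (fun t => F (theta t u)) (b u * 'D_(e_ i) F u).
  have E : (fun t : R => F (u + t *: (b u *: e_ i))) = (fun t => F (theta t u)).
    by apply/funext => t; rewrite /shift_box scalerA.
  have D := is_derive_eq (line_derive0 (b u *: e_ i) sF) (deriveZdir (e_ i) (b u) sF).
  exact: (eq_ind _ (fun f => is_derive (0 : R) (1 : R) f _) D _ E).
have d2 : is_derive (0 : R) (1 : R) (fun t : R => 1 + t * 'D_(e_ i) b u) ('D_(e_ i) b u).
  have d3 := is_derive_mulr (is_derive_id (0 : R) (1 : R)) (is_derive_cst ('D_(e_ i) b u) (0 : R) (1 : R)).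
  have d4 := is_deriveD (is_derive_cst (1 : R) (0 : R) (1 : R)) d3.
  by apply: is_derive_eq d4 _; rewrite /=; ring.
have d5 := is_derive_mulr d1 d2.
have d6 := is_derive_mulr d5 d5.
have d7 := is_deriveB d6 (is_derive_cst (F u * F u) (0 : R) (1 : R)).
have d8 := is_derive_mulr d7 (is_derive_cst ((s u)^-1) (0 : R) (1 : R)).
have [_ E8] := d8.
apply: (etrans E8).
rewrite shift_box0 /=;
  move: ('D_(e_ i) F u) ('D_(e_ i) b u) (F u) (b u) ((s u)^-1) => x1 x2 x3 x4 x5.
by ring.
Qed.

(** This is 2 f^2 s b with f = F / s. It is chosen so that the derivative of [variation_integrand]
    at t = 0, minus D_i of this term, is exactly -2 b s f D_i f. *)
Definition divergence_term u := 2 * (F u * F u) * b u / s u.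

Local Notation K := divergence_term.

Let dK u : box a (2 * r) u -> 'D_(e_ i) K u =
  2 * ((2 * F u * 'D_(e_ i) F u * b u + F u * F u * 'D_(e_ i) b u) / s u
       - F u * F u * b u * 'D_(e_ i) s u / (s u * s u)).
Proof.
move=> bu; have cu := bc2 bu.
have dF := is_derive_smooth (e_ i) (F_smooth cu).
have ds := is_derive_smooth (e_ i) (s_smooth cu).
have db := is_derive_smooth (e_ i) (bump2_smooth a r u).
have d1 := is_derive_mulr (is_derive_cst (2 : R) u (e_ i)) (is_derive_mulr dF dF).
have d2 := is_derive_mulr d1 db.
have s0 := lt0r_neq0 (s_gt0 cu).
have [_ E] := is_derive_quot s0 d2 ds.
apply: (etrans E); rewrite /=.
move: s0; move: ('D_(e_ i) F u) ('D_(e_ i) b u) ('D_(e_ i) s u) (F u) (b u) (s u) => x1 x2 x3 x4 x5 x6 s0.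
by field.
Qed.

(** Criticality kills the integral of the derivative of [variation_integrand] at t = 0, and the
    divergence theorem kills that of D_i [divergence_term], since the bump is 0 on the boundary. The
    difference of the two integrands is -2 times the stated one. *)
Lemma first_variation : \int[la2]_(p in qbox a (2 * r))
  (b (rV2 p) * s (rV2 p) * (density phi c (rV2 p) * 'D_(e_ i) (density phi c) (rV2 p))) = 0.
Proof.
have r2 : 0 < 2 * r by rewrite mulr_gt0.
have G1 : \int[la2]_(p in qbox a (2 * r)) 'D_((1, 0) : R * 'rV[R]_2) G (0, rV2 p) = 0.
  have h t u : `|t - 0| < r -> box a (2 * r) u -> smooth_at G (t, u).
    by rewrite subr0; exact: G_smooth.
  have dI := is_derive_integral_qbox r0 r2 h.
  have [dE1 dE2] := phi_critical r0 (inner_variation_smooth phi_smooth i Ac r0 bc).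
  have E : \forall t \near (0 : R), energy g mu w (phi_ t) =
      energy g mu w phi + 2^-1 * \int[la2]_(p in qbox a (2 * r)) G (t, rV2 p).
    have cn : {for (0 : R), continuous (fun q : R => `|q|)} by exact: norm_continuous.
    have nt : \forall t \near (0 : R), `|t| < r by apply: (cvgr_lt _ cn); rewrite normr0.
    by apply: filterS nt => t; exact: energy_inner_variation.
  have d2 := is_deriveD (is_derive_cst (energy g mu w phi) (0 : R) (1 : R))
    (is_derive_mulr (is_derive_cst (2^-1 : R) (0 : R) (1 : R)) dI).
  have [_ E2] := d2.
  have := near_eq_derive (1 : R) E.
  rewrite dE2 => E3.
  have := etrans E3 E2; rewrite mul0r !add0r => /esym/eqP.
  by rewrite mulf_eq0 invr_eq0 pnatr_eq0 /= => /eqP.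
have K_smooth u : box a (2 * r) u -> smooth_at K u.
  move=> bu; have cu := bc2 bu.
  apply: smooth_atM; last exact: (smooth_atV (lt0r_neq0 (s_gt0 cu)) (s_smooth cu)).
  apply: smooth_atM; last exact: bump2_smooth.
  apply: smooth_atM; first exact: smooth_at_cst.
  exact: (smooth_atM (F_smooth cu) (F_smooth cu)).
have K1 : \int[la2]_(p in qbox a (2 * r)) 'D_(e_ i) K (rV2 p) = 0.
  apply: integral_qbox_derive => // u ur.
  by rewrite /K bump2_0 ?ur// mulr0 mul0r.
have cG u : box a (2 * r) u ->
    {for u, continuous (fun u => 'D_((1, 0) : R * 'rV[R]_2) G (0, u))}.
  move=> bu; apply: smooth_at_cont.
  apply: (smooth_at_pairr (f := 'D_((1, 0) : R * 'rV[R]_2) G)).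
  by apply: smooth_at_derive; apply: G_smooth => //; rewrite normr0.
have cK u : box a (2 * r) u -> {for u, continuous ('D_(e_ i) K)}.
  by move=> bu; exact/smooth_at_cont/smooth_at_derive/K_smooth.
have E := Rintegral_qboxB r2 cG cK.
rewrite G1 K1 subrr in E.
have f_smooth u : cimg c u -> smooth_at (density phi c) u.
  by move=> /dom[cx <-]; exact: density_smooth.
have cH u : box a (2 * r) u -> {for u, continuous
    (fun u => b u * s u * (density phi c u * 'D_(e_ i) (density phi c) u))}.
  move=> bu; have cu := bc2 bu.
  apply: smooth_at_cont; apply: smooth_atM.
    by apply: smooth_atM; [exact: bump2_smooth|exact: s_smooth].
  by apply: smooth_atM; [exact: f_smooth|exact/smooth_at_derive/f_smooth].
apply: (@mulfI _ (-2)); first by rewrite oppr_eq0 pnatr_eq0.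
rewrite mulr0 -(Rintegral_qboxZ r2 (-2) cH) -[RHS]E; apply: eq_Rintegral => p; rewrite inE => bp.
have cu := bc2 bp.
rewrite (dG bp) (dK bp).
have s0 := lt0r_neq0 (s_gt0 cu).
have [_ Ef] := is_derive_quot s0 (is_derive_smooth (e_ i) (F_smooth cu)) (is_derive_smooth (e_ i) (s_smooth cu)).
have Ef' : 'D_(e_ i) (density phi c) (rV2 p) = _ := Ef.
rewrite Ef' /density.
move: s0; move: ('D_(e_ i) F (rV2 p)) ('D_(e_ i) b (rV2 p)) ('D_(e_ i) s (rV2 p)) (F (rV2 p)) (b (rV2 p)) (s (rV2 p)) => x1 x2 x3 x4 x5 x6 s0.
by field.
Qed.

End Patch.

(** Fundamental lemma of the calculus of variations: were the continuous product nonzero at [a], it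
    would keep its sign on a small box, and its integral against the positive weight b s could not
    vanish. Multiplying by the sign [sg] treats both signs at once. *)
Lemma density_mul_derive0 c (a : 'rV[R]_2) (i : 'I_2) : atlas A c -> cimg c a ->
  density phi c a * 'D_(e_ i) (density phi c) a = 0.
Proof.
move=> Ac ca; apply/eqP; apply/negPn/negP => ne0.
set q := fun u => density phi c u * 'D_(e_ i) (density phi c) u.
have f_smooth u : cimg c u -> smooth_at (density phi c) u.
  by move=> /cimgP[cx <-]; exact: density_smooth.
have q_smooth u : cimg c u -> smooth_at q u.
  by move=> cu; apply: smooth_atM; [exact: f_smooth|exact/smooth_at_derive/f_smooth].
pose sg := Num.sg (q a).
have qa : 0 < sg * q a by rewrite -normrEsg normr_gt0.
have n1 : \forall u \near a, 0 < sg * q u.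
  have cq : {for a, continuous (fun u => sg * q u)}.
    by apply: smooth_at_cont; apply: smooth_atM; [exact: smooth_at_cst|exact: q_smooth].
  exact: (cvgr_gt _ cq).
have n2 : nbhs a (cimg c) by exact: nbhs_cimg.
have /nbhs_ballP[e /= e0 eP] : nbhs a (fun u => 0 < sg * q u /\ cimg c u) by exact: filterI.
(* So that even the box of radius [3 * r] lies in the ball of radius [e]. *)
pose r := e / 4.
have r0 : 0 < r by rewrite divr_gt0.
have ball_box k u : k <= 3 -> box a (k * r) u -> 0 < sg * q u /\ cimg c u.
  move=> k3 bu; apply: eP; rewrite -ball_normE /= distrC.
  apply: le_lt_trans bu _; rewrite /r mulrA ltr_pdivrMr// mulrC ltr_pM2l//.
  by apply: le_lt_trans k3 _; rewrite ltr_nat.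
have bc : box a (3 * r) `<=` cimg c by move=> u /ball_box[].
have le23 : 2 <= 3 :> R by rewrite ler_nat.
have E := first_variation i Ac r0 bc.
have r2 : 0 < 2 * r by rewrite mulr_gt0.
pose H u := bump2 a r u * sqrtg g c u * (sg * q u).
have H_smooth u : box a (2 * r) u -> smooth_at H u.
  move=> /(ball_box _ _ le23)[_ cu]; apply: smooth_atM.
    apply: smooth_atM; first exact: bump2_smooth.
    by have [cx <-] := cimgP cu; exact: sqrtg_smooth.
  by apply: smooth_atM; [exact: smooth_at_cst|exact: q_smooth].
have : 0 < \int[la2]_(p in qbox a (2 * r)) H (rV2 p).
  apply: integral_qbox_gt0 => //.
  - by move=> u /H_smooth; exact: smooth_at_cont.
  - move=> u /(ball_box _ _ le23)[qu cu].
    have /andP[b0 _] := bump2_01 a r u.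
    by rewrite /H mulr_ge0 ?(ltW qu)// mulr_ge0// sqrtr_ge0.
  - have s0 : 0 < sqrtg g c a by have [cx <-] := cimgP ca; exact: sqrtg_gt0.
    by rewrite /H bump2_1 ?subrr ?normr0 ?ltW// mul1r mulr_gt0.
have cQ u : box a (2 * r) u -> {for u, continuous (fun u => bump2 a r u * sqrtg g c u * q u)}.
  move=> bu; have [_ cu] := ball_box _ _ le23 bu.
  apply: smooth_at_cont; apply: smooth_atM; last exact: q_smooth.
  apply: smooth_atM; first exact: bump2_smooth.
  by have [cx <-] := cimgP cu; exact: sqrtg_smooth.
have -> : \int[la2]_(p in qbox a (2 * r)) H (rV2 p) = sg * \int[la2]_(p in qbox a (2 * r))
    (bump2 a r (rV2 p) * sqrtg g c (rV2 p) * q (rV2 p)).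
  rewrite -(Rintegral_qboxZ r2 sg cQ).
  by apply: eq_Rintegral => p _; rewrite /H mulrCA.
by rewrite E mulr0 ltxx.
Qed.

(** If D_i f were nonzero at [a] it would be so nearby, where f D_i f = 0 then forces f = 0; but a
    locally zero function has zero derivative. *)
Lemma density_derive0 c (a : 'rV[R]_2) (i : 'I_2) : atlas A c -> cimg c a ->
  'D_(e_ i) (density phi c) a = 0.
Proof.
move=> Ac ca; apply/eqP; apply/negPn/negP => ne0.
have sf : smooth_at (density phi c) a.
  by have [cx <-] := cimgP ca; exact: density_smooth.
have n1 : \forall u \near a, 'D_(e_ i) (density phi c) u != 0.
  exact: (cvgr_neq0 _ (smooth_at_cont (smooth_at_derive (e_ i) sf))).
have n2 : nbhs a (cimg c) by exact: nbhs_cimg.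
have nf : \forall u \near a, density phi c u = cst 0 u.
  apply: filterS (filterI n1 n2) => u [du cu].
  have /eqP := density_mul_derive0 i Ac cu.
  by rewrite mulf_eq0 (negbTE du) orbF => /eqP.
by move: ne0; rewrite (near_eq_derive (e_ i) nf) derive_cst eqxx.
Qed.

End FirstVariation.

(** * Coclosedness *)

Section OneForms.
Context {R : realType} {n : nat} {M : topologicalType}.
Variable A : manifold R n M.

(** Closed by [Defined] so that the coefficients of the product form can be computed later. The same
    holds for [zero_form]. *)
Definition scalar_form (k : M -> R)
  (k_smooth : forall c x, atlas A c -> cdom c x -> smooth_at (k \o cinv c) (cmap c x))
  (al : oneform A) : oneform A.
Proof.
exists (fun c u => k (cinv c u) *: al c u).
- move=> c Ac; apply/smooth_onP; first exact: cimg_open.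
  move=> u /cimgP[cx <-]; apply: smooth_atZ; first exact: k_smooth.
  exact: oneform_smooth_at.
- move=> c d x Ac Ad cx dx.
  by rewrite (cmapK cx) (cmapK dx) (oneform_transform al Ac Ad cx dx) scalemxAl.
Defined.

Definition zero_form : oneform A.
Proof.
exists (fun _ _ => 0).
- by move=> c Ac; apply/smooth_onP; [exact: cimg_open|move=> u _; exact: smooth_at_cst].
- by move=> c d x _ _ _ _; rewrite mul0mx.
Defined.

Lemma ext_d1E (al : coefs1 R n M) c u i j :
  ext_d1 al c u i j = ('D_(e_ i) (al c) u) 0 j - ('D_(e_ j) (al c) u) 0 i.
Proof. by rewrite mxE. Qed.

Lemma ext_d1_near0 (al : coefs1 R n M) c u :
  (\forall v \near u, al c v = 0) -> ext_d1 al c u = 0.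
Proof.
move=> E; apply/matrixP => i j.
have D k : 'D_(e_ k) (al c) u = 0.
  by apply: (etrans (near_eq_derive (e_ k) (g := cst 0) E)); exact: derive_cst.
by rewrite !mxE !D !mxE subrr.
Qed.

Lemma inner2_0 (g : tensor2 A) (a b : coefs2 R n M) x :
  a (chart_at A x) (cmap (chart_at A x) x) = 0 -> inner2 g a b x = 0.
Proof.
by move=> a0; rewrite /inner2 a0; apply: big1 => i _; apply: big1 => j _; rewrite mxE mul0r.
Qed.

End OneForms.

Section Stokes.
Context {R : realType} {M : ptopologicalType} {N : topologicalType} {n : nat}.
Variables (A : manifold R 2 M) (g : tensor2 A) (B : manifold R n N) (w : tensor2 B).
Hypotheses (M_compact : compact [set: M]) (gr : riemannian g).
Variable mu : {measure set (borel_space M) -> \bar R}.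
Hypothesis mu_volume : riemannian_volume g mu.
Hypothesis w_antisym : forall c u, atlas B c -> cimg c u -> (w c u)^T = - w c u.
Variable phi : M -> N.
Hypothesis phi_smooth : smooth_map A B phi.
Hypothesis phi_density : forall c u i, atlas A c -> cimg c u ->
  'D_(e_ i) (density g w phi c) u = 0.

Local Notation la2 := (@lebesgue_measure R \x @lebesgue_measure R)%E.

(* As the density is locally constant, the integrand is a divergence. *)
Lemma stokes_qbox c a r (p0 p1 : 'rV[R]_2 -> R) : atlas A c -> 0 < r -> box a r `<=` cimg c ->
  (forall u, box a r u -> smooth_at p0 u) -> (forall u, box a r u -> smooth_at p1 u) ->
  (forall u, `|u - a| = r -> p0 u = 0) -> (forall u, `|u - a| = r -> p1 u = 0) ->
  \int[la2]_(p in qbox a r) (('D_(e_ 0) p1 (rV2 p) - 'D_(e_ 1) p0 (rV2 p)) *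
    density g w phi c (rV2 p)) = 0.
Proof.
move=> Ac r0 bc s0 s1 z0 z1.
pose f := density g w phi c.
have sf u : box a r u -> smooth_at f u.
  by move=> /bc/cimgP[cx <-]; exact: density_smooth.
have D (i : 'I_2) (p : 'rV[R]_2 -> R) : (forall u, box a r u -> smooth_at p u) -> forall u, box a r u ->
    'D_(e_ i) (fun u => p u * f u) u = 'D_(e_ i) p u * f u.
  move=> sp u bu.
  have [_ E] := is_derive_mulr (is_derive_smooth (e_ i) (sp u bu)) (is_derive_smooth (e_ i) (sf u bu)).
  by apply: (etrans E); rewrite /f (phi_density i Ac (bc _ bu)) mulr0 addr0.
have I (i : 'I_2) (p : 'rV[R]_2 -> R) : (forall u, box a r u -> smooth_at p u) -> (forall u, `|u - a| = r -> p u = 0) ->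
    \int[la2]_(q in qbox a r) ('D_(e_ i) p (rV2 q) * f (rV2 q)) = 0.
  move=> sp zp.
  have s u : box a r u -> smooth_at (fun u => p u * f u) u.
    by move=> bu; apply: smooth_atM; [exact: sp|exact: sf].
  have z u : `|u - a| = r -> p u * f u = 0 by move=> /zp ->; rewrite mul0r.
  have E := integral_qbox_derive i r0 s z; rewrite -[RHS]E.
  by apply: eq_Rintegral => q; rewrite inE => bq; exact: (esym (D i p sp _ bq)).
have cD (i : 'I_2) (p : 'rV[R]_2 -> R) : (forall u, box a r u -> smooth_at p u) -> forall u, box a r u ->
    {for u, continuous (fun u => 'D_(e_ i) p u * f u)}.
  move=> sp u bu; apply: smooth_at_cont; apply: smooth_atM; last exact: sf.
  exact: (smooth_at_derive (e_ i) (sp u bu)).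
have E := Rintegral_qboxB r0 (cD 0 p1 s1) (cD 1 p0 s0).
rewrite (I 0 p1 s1 z1) (I 1 p0 s0 z0) subrr in E.
apply: etrans E; apply: eq_Rintegral => q _; rewrite -/f.
by move: ('D_(e_ 0) p1 (rV2 q)) ('D_(e_ 1) p0 (rV2 q)) => D0 D1; rewrite mulrBl.
Qed.

(** Stokes for a form supported in one box. The two vanishing hypotheses play different roles: zero
    values on the boundary feed the divergence theorem, while zero values off the box, in all
    charts, reduce the integral over M to the box. *)
Lemma stokes_patch c a r (al : oneform A) : atlas A c -> 0 < r -> box a (3 * r) `<=` cimg c ->
  (forall u, box a (2 * r) u -> `|u - a| = 2 * r -> al c u = 0) ->
  (forall d x, atlas A d -> cdom d x -> ~ cbox c a (2 * r) x -> al d (cmap d x) = 0) ->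
  \int[mu]_x inner2 g (ext_d1 al) (pullback phi w) x = 0.
Proof.
move=> Ac r0 bc zb zo.
have bc2 := box2_sub r0 bc.
have r2 : 0 < 2 * r by rewrite mulr_gt0.
have fa := form2_ext_d1 al.
have fp := form2_pull w_antisym phi_smooth.
rewrite (Rintegral_supp_cbox gr mu_volume Ac r2 bc2); last 2 first.
- exact: inner2_continuous.
- move=> x nx; have [Ad dx] := chart_atP A x.
  apply: inner2_0; apply: ext_d1_near0.
  apply: filterS (near_cinv dx (near_notin_cbox A r0 bc nx)) => u [/cimgP[du uE] nu].
  by rewrite -uE; apply: zo.
have sa j u : box a (2 * r) u -> smooth_at (fun v => al c v 0 j) u.
  by move=> /bc2/cimgP[cx <-]; have /smooth_at_mx := oneform_smooth_at al Ac cx; apply.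
have za j u : `|u - a| = 2 * r -> al c u 0 j = 0.
  by move=> E; rewrite zb ?mxE//; rewrite /box /= E.
have E := stokes_qbox Ac r2 bc2 (sa 0) (sa 1) (za 0) (za 1).
apply: etrans E; apply: eq_Rintegral => p; rewrite inE => bp.
have [cx xE] := cimgP (bc2 _ bp).
have := inner2_density gr w_antisym phi_smooth fa Ac cx; rewrite xE => E2.
apply: (etrans E2); congr (_ * _).
have scu : smooth_at (al c) (rV2 p) by rewrite -xE; exact: oneform_smooth_at.
rewrite [LHS]mxE; congr (_ - _).
  exact: (derive_mxE 0 1 (smooth_at_derivable scu)).
exact: (derive_mxE 0 0 (smooth_at_derivable scu)).
Qed.

Lemma ext_d1D (al a1 a2 : oneform A) c x : atlas A c -> cdom c x ->
  (forall u, al c u = a1 c u + a2 c u) ->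
  ext_d1 al c (cmap c x) = ext_d1 a1 c (cmap c x) + ext_d1 a2 c (cmap c x).
Proof.
move=> Ac cx E.
have s1 := oneform_smooth_at a1 Ac cx; have s2 := oneform_smooth_at a2 Ac cx.
have D i : 'D_(e_ i) (al c) (cmap c x) = 'D_(e_ i) (a1 c) (cmap c x) + 'D_(e_ i) (a2 c) (cmap c x).
  have -> : al c = a1 c + a2 c :> ('rV[R]_2 -> 'rV[R]_2) by apply/funext => u; exact: E.
  exact: (deriveD (smooth_at_derivable s1) (smooth_at_derivable s2)).
have E' i j : ('D_(e_ i) (al c) (cmap c x)) 0 j =
    ('D_(e_ i) (a1 c) (cmap c x)) 0 j + ('D_(e_ i) (a2 c) (cmap c x)) 0 j by rewrite D mxE.
apply/matrixP => i j.
have addE (X Y : 'M[R]_2) : (X + Y) i j = X i j + Y i j by rewrite mxE.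
apply: (etrans (ext_d1E al c (cmap c x) i j)); apply: (etrans _ (esym (addE _ _))).
rewrite (ext_d1E a1 c (cmap c x) i j) (ext_d1E a2 c (cmap c x) i j).
apply: (etrans (f_equal2 (fun y z => y - z) (E' i j) (E' j i))).
move: ('D_(e_ i) (a1 c) (cmap c x)) ('D_(e_ j) (a1 c) (cmap c x)) => D1 D2.
move: ('D_(e_ i) (a2 c) (cmap c x)) ('D_(e_ j) (a2 c) (cmap c x)) => D3 D4.
by ring.
Qed.

Lemma onem_cutoff_smooth c a r : atlas A c -> 0 < r -> box a (3 * r) `<=` cimg c ->
  forall d x, atlas A d -> cdom d x ->
    smooth_at ((fun y => 1 - cutoff c a r y) \o cinv d) (cmap d x).
Proof.
move=> Ac r0 bc d x Ad dx; apply: smooth_atB; first exact: smooth_at_cst.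
exact: (cutoff_smooth Ac r0 bc Ad dx).
Qed.

Lemma Rintegral_eq0 (f : M -> R) : (forall x, f x = 0) -> \int[mu]_x f x = 0.
Proof. by move=> f0; rewrite /Rintegral integral0_eq//= => x _; rewrite f0. Qed.

(** A finite cover by box cores replaces a partition of unity. For each box the form splits as chi
    al + (1 - chi) al with chi its cutoff: [stokes_patch] disposes of the first part, and the second
    vanishes on the core, so one box fewer is left. *)
Lemma stokes_form (al : oneform A) : \int[mu]_x inner2 g (ext_d1 al) (pullback phi w) x = 0.
Proof.
have [Q Qx] := choice (fun x => @exists_core _ _ A x setT filterT).
pose core x : set M := let: (c, a, r) := Q x in cbox c a r.
have [s sP] : exists s : seq M, forall x, exists2 y, y \in s & core y x.
  apply: (compact_nbhs_cover M_compact) => x; rewrite /core.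
  by have := Qx x; case: (Q x) => -[c a] r [].
(* The invariant of the induction: each point lies in a core still to be treated, or the form
   already vanishes there. Once no core is left the form is zero. *)
have : forall x, (exists2 y, y \in s & core y x) \/
    (forall c, atlas A c -> cdom c x -> al c (cmap c x) = 0) by move=> x; left.
elim: s {sP} al => [|y s IH] al alP.
  apply: Rintegral_eq0 => x; have [Ad dx] := chart_atP A x.
  apply: inner2_0; apply: ext_d1_near0.
  have nd : nbhs (cmap (chart_at A x) x) (cimg (chart_at A x)).
    by exact/nbhs_cimg/cimg_cmap.
  apply: filterS nd => u /cimgP[du <-].
  by have [[z]|] := alP (cinv (chart_at A x) u); [rewrite in_nil|apply].
(* The equation is kept in order to recognise [core y] as the core of this box further down. *)
move: (Qx y) (erefl (Q y)); case: {1 2}(Q y) => -[c a] r [Ac r0 bc _ _] QE.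
pose a1 := scalar_form (cutoff_smooth Ac r0 bc) al.
pose a2 := scalar_form (onem_cutoff_smooth Ac r0 bc) al.
have E1 : \int[mu]_x inner2 g (ext_d1 a1) (pullback phi w) x = 0.
  apply: (stokes_patch Ac r0 bc).
  - move=> u bu ur; have [cx uE] := cimgP (box2_sub r0 bc bu).
    by rewrite /= cutoffE// uE bump2_0 ?ur// scale0r.
  - by move=> d x Ad dx nx; rewrite /= (cmapK dx) cutoff_0// scale0r.
have E2 : \int[mu]_x inner2 g (ext_d1 a2) (pullback phi w) x = 0.
  apply: IH => x; have [[z zs zx]|h] := alP x; last first.
    by right=> d Ad dx; rewrite /= h// scaler0.
  move: zs; rewrite in_cons => /orP[/eqP zy|zs]; last by left; exists z.
  right=> d Ad dx; rewrite /= (cmapK dx) cutoff_1 ?subrr ?scale0r//.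
  by move: zx; rewrite zy /core -QE.
have fp := form2_pull w_antisym phi_smooth.
have c0 := inner2_continuous gr (form2_ext_d1 al) fp.
have c1 := inner2_continuous gr (form2_ext_d1 a1) fp.
have EB := RintegralB_continuous M_compact gr mu_volume c0 c1.
apply: (etrans (esym (subr0 _))); apply: (etrans (f_equal (fun z => _ - z) (esym E1))).
apply: (etrans (esym EB)); apply: (etrans _ E2); apply: eq_Rintegral => x _.
have [Ad dx] := chart_atP A x.
rewrite (inner2E gr (form2_ext_d1 al) fp Ad dx) (inner2E gr (form2_ext_d1 a1) fp Ad dx).
rewrite (inner2E gr (form2_ext_d1 a2) fp Ad dx).
rewrite (@ext_d1D al a1 a2 _ _ Ad dx); last first.
  by move=> u; rewrite /= -scalerDl addrC subrK scale1r.
rewrite [X in X * _ / _ - _]mxE.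
by rewrite -!mulrBl addrAC subrr add0r.
Qed.

(** The zero form is exhibited as the coderivative: adjointness then says that <d alpha, phi^*w>
    integrates to 0 for every alpha, which is [stokes_form]. *)
Lemma pullback_coclosed : coclosed g mu (pullback phi w).
Proof.
exists (zero_form A) => // al; rewrite stokes_form; apply: esym.
by apply: Rintegral_eq0 => x; rewrite /inner1 /= trmx0 mulmx0 mxE.
Qed.

End Stokes.

(** * Homotopy invariance *)

Section MatrixDerivatives.
Context {R : realType}.
Implicit Types V W : normedModType R.

Lemma derive_mulmx V m n p (f : V -> 'M[R]_(m, n)) (h : V -> 'M[R]_(n, p)) x v :
  smooth_at f x -> smooth_at h x ->
  'D_v (fun y => f y *m h y) x = 'D_v f x *m h x + f x *m 'D_v h x.
Proof.
move=> sf sh; have sfh := smooth_at_mulmx sf sh.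
have sfe i j : smooth_at (fun y => f y i j) x by have /smooth_at_mx := sf; apply.
have she i j : smooth_at (fun y => h y i j) x by have /smooth_at_mx := sh; apply.
apply/matrixP => i j.
apply: (etrans (derive_mxE i j (smooth_at_derivable sfh))).
have -> : (fun y => (f y *m h y) i j) = \sum_k (fun y => f y i k * h y k j).
  by apply/funext => y; rewrite mxE fct_sumE.
have D k : is_derive x v (fun y => f y i k * h y k j)
    (('D_v f x) i k * h x k j + f x i k * ('D_v h x) k j).
  have := is_derive_mulr (is_derive_smooth v (sfe i k)) (is_derive_smooth v (she k j)).
  have <- := derive_mxE i k (smooth_at_derivable (v := v) sf).
  by have <- := derive_mxE k j (smooth_at_derivable (v := v) sh).
rewrite derive_sum; last by move=> k; case: (D k).
under eq_bigr => k _ do rewrite (derive_val (is_derive := D k)).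
by rewrite big_split !mxE.
Qed.

Lemma derive_trmx V m n (f : V -> 'M[R]_(m, n)) x v : smooth_at f x ->
  'D_v (fun y => (f y)^T) x = ('D_v f x)^T.
Proof.
move=> sf; apply/matrixP => i j.
apply: (etrans (derive_mxE i j (smooth_at_derivable (smooth_at_trmx sf)))).
have -> : (fun y => (f y)^T i j) = (fun y => f y j i) by apply/funext => y; rewrite mxE.
rewrite [RHS]mxE; apply: esym.
exact: (derive_mxE j i (smooth_at_derivable sf)).
Qed.

Lemma derive_form V n (f h : V -> 'rV[R]_n) (F : V -> 'M[R]_n) x v :
  smooth_at f x -> smooth_at h x -> smooth_at F x ->
  'D_v (fun y => (f y *m F y *m (h y)^T) 0 0) x =
  ('D_v f x *m F x *m (h x)^T) 0 0 + (f x *m 'D_v F x *m (h x)^T) 0 0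
  + (f x *m F x *m ('D_v h x)^T) 0 0.
Proof.
move=> sf sh sF.
have sfF := smooth_at_mulmx sf sF; have sT := smooth_at_trmx sh.
have E := derive_mxE 0 0 (smooth_at_derivable (v := v) (smooth_at_mulmx sfF sT)).
apply: (etrans (esym E)).
have E1 := derive_mulmx v sfF sT; have E2 := derive_mulmx v sf sF; have E3 := derive_trmx v sh.
apply: (etrans (f_equal (fun X : 'M[R]_1 => X 0 0) E1)).
rewrite E2 E3; move: ('D_v f x) ('D_v h x) ('D_v F x) => Df Dh DF.
by rewrite mulmxDl [LHS]mxE [X in X + _ = _]mxE.
Qed.

Lemma form_sum3 n (D : 'I_n -> 'M[R]_n) (X Y Z : 'rV[R]_n) :
  (Y *m (\sum_l X 0 l *: D l) *m Z^T) 0 0 =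
  \sum_l \sum_j \sum_k X 0 l * Y 0 j * Z 0 k * D l j k.
Proof.
rewrite mulmx_sumr mulmx_suml summxE; apply: eq_bigr => l _.
rewrite !mxE exchange_big /=; apply: eq_bigr => k _.
rewrite !mxE mulr_suml; apply: eq_bigr => j _.
by rewrite !mxE; ring.
Qed.

(** Here [D l] stands for the derivative of a 2-form in direction e_l. Both sides are expanded over
    triples of indices, where the identity is the cyclic closedness relation combined with
    antisymmetry. *)
Lemma closed_form_cyclic n (D : 'I_n -> 'M[R]_n) (X Y Z : 'rV[R]_n) :
  (forall l, (D l)^T = - D l) -> (forall i j k, D i j k + D j k i + D k i j = 0) ->
  (Y *m (\sum_l X 0 l *: D l) *m Z^T) 0 0 =
  (X *m (\sum_l Y 0 l *: D l) *m Z^T) 0 0 - (X *m (\sum_l Z 0 l *: D l) *m Y^T) 0 0.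
Proof.
move=> Da Dc; rewrite !form_sum3.
rewrite [X in _ = X - _]exchange_big /=.
rewrite [X in _ = _ - X]exchange_big /=.
rewrite -sumrB; apply: eq_bigr => l _.
rewrite [X in _ = _ - X]exchange_big /= -sumrB; apply: eq_bigr => j _.
rewrite -sumrB; apply: eq_bigr => k _.
have -> : D j l k = - D j k l by have /matrixP/(_ k l) := Da j; rewrite !mxE.
have -> : D l j k = - D j k l - D k l j by apply/eqP; rewrite -opprD -subr_eq0 opprK addrA Dc.
by ring.
Qed.

End MatrixDerivatives.

(** * The homotopy formula for a closed 2-form along straight segments *)

Section FormHomotopy.
Context {R : realType} {n : nat}.
Variables (F : 'rV[R]_n -> 'M[R]_n) (S : set 'rV[R]_n).
Hypotheses (F_smooth : forall p, S p -> smooth_at F p)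
  (F_antisym : forall p, S p -> (F p)^T = - F p)
  (F_closed : forall p i j k, S p ->
    ('D_(e_ i) F p) j k + ('D_(e_ j) F p) k i + ('D_(e_ k) F p) i j = 0)
  (S_open : open S).

Lemma derive_dir_sum p (X : 'rV[R]_n) : S p -> 'D_X F p = \sum_l X 0 l *: 'D_(e_ l) F p.
Proof.
move=> Sp; rewrite {1}[X]row_sum_delta.
exact: (deriveDir_sum _ _ (smooth_at_diff (F_smooth Sp))).
Qed.

Lemma derive_antisym p (X : 'rV[R]_n) : S p -> ('D_X F p)^T = - 'D_X F p.
Proof.
move=> Sp; apply: (etrans (esym (derive_trmx X (F_smooth Sp)))).
apply: (etrans _ (deriveN (smooth_at_derivable (F_smooth Sp)))).
apply: near_eq_derive.
by apply: filterS (open_nbhs_nbhs (conj S_open Sp)) => q; exact: F_antisym.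
Qed.

(* This is dF(X, Y, Z) = 0 for the 2-form F. *)
Lemma closed_form_identity p (X Y Z : 'rV[R]_n) : S p ->
  (Y *m 'D_X F p *m Z^T) 0 0 =
  (X *m 'D_Y F p *m Z^T) 0 0 - (X *m 'D_Z F p *m Y^T) 0 0.
Proof.
move=> Sp; rewrite (derive_dir_sum X Sp) (derive_dir_sum Y Sp) (derive_dir_sum Z Sp).
apply: (@closed_form_cyclic _ n (fun l => 'D_(e_ l) F p)).
- by move=> l; exact: derive_antisym.
- by move=> i j k; exact: F_closed.
Qed.

Variables (y0 W : 'rV[R]_2 -> 'rV[R]_n).

Definition segment_map (q : R * 'rV[R]_2) : 'rV[R]_n := y0 q.2 + q.1 *: W q.2.

Definition segment_derive (i : 'I_2) (q : R * 'rV[R]_2) : 'rV[R]_n :=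
  'D_(e_ i) y0 q.2 + q.1 *: 'D_(e_ i) W q.2.

(** The coefficient of du^0 /\ du^1 in the pullback of [F] by y_s = y0 + s W, the vector
    [segment_derive i] being the partial derivative D_i y_s. *)
Definition segment_form (q : R * 'rV[R]_2) : R :=
  (segment_derive 0 q *m F (segment_map q) *m (segment_derive 1 q)^T) 0 0.

(** The [i]-th coefficient of the 1-form y_s^* (i_W F). *)
Definition segment_flux (i : 'I_2) (s : R) (u : 'rV[R]_2) : R :=
  (W u *m F (segment_map (s, u)) *m (segment_derive i (s, u))^T) 0 0.

(** The linear algebra of the homotopy formula. [A] and [C] stand for D_0 y_s and D_1 y_s, [V] for
    W, [dA] and [dC] for D_0 W and D_1 W, [P] for F, and [DV], [DA], [DC] for the derivatives of F
    along V, A, C. [K] is the mixed second derivative of y_s, whose two occurrences cancel. Primed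
    letters are the same quantities in the form in which the product rule delivers them. *)
Lemma flux_algebra (A C dA dC dA' dC' V K K' : 'rV[R]_n) (P DV DA DC DV' DA' DC' : 'M[R]_n) :
  P^T = - P -> dA' = dA -> dC' = dC -> K' = K -> DV' = DV -> DA' = DA -> DC' = DC ->
  (A *m DV *m C^T) 0 0 = (V *m DA *m C^T) 0 0 - (V *m DC *m A^T) 0 0 ->
  (dA' *m P *m C^T) 0 0 + (A *m DV' *m C^T) 0 0 + (A *m P *m dC'^T) 0 0 =
  ((dA *m P *m C^T) 0 0 + (V *m DA' *m C^T) 0 0 + (V *m P *m K^T) 0 0) -
  ((dC *m P *m A^T) 0 0 + (V *m DC' *m A^T) 0 0 + (V *m P *m K'^T) 0 0).
Proof.
move=> Pa -> -> -> -> -> -> ->.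
have -> : (dC *m P *m A^T) 0 0 = - (A *m P *m dC^T) 0 0.
  have /matrixP/(_ 0 0) : (dC *m P *m A^T)^T = - (A *m P *m dC^T).
    by rewrite !trmx_mul trmxK Pa mulmxA mulmxN mulNmx.
  by rewrite [LHS]mxE [RHS]mxE.
by ring.
Qed.

Section Point.
Variables (s : R) (u : 'rV[R]_2).
Hypotheses (s0 : smooth_at y0 u) (sW : smooth_at W u) (Sy : S (segment_map (s, u))).

Let affine_smooth (f h : 'rV[R]_2 -> 'rV[R]_n) : smooth_at f u -> smooth_at h u ->
  smooth_at (fun q : R * 'rV[R]_2 => f q.2 + q.1 *: h q.2) (s, u).
Proof.
move=> sf sh.
apply: smooth_atD; first exact: smooth_at_comp_snd.
by apply: smooth_atZ; [exact: smooth_at_fst|exact: smooth_at_comp_snd].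
Qed.

Lemma segment_map_smooth : smooth_at segment_map (s, u).
Proof. exact: affine_smooth. Qed.

Lemma segment_derive_smooth i : smooth_at (segment_derive i) (s, u).
Proof.
exact: (affine_smooth (smooth_at_derive (e_ i) s0) (smooth_at_derive (e_ i) sW)).
Qed.

Lemma segment_F_smooth : smooth_at (fun q => F (segment_map q)) (s, u).
Proof.
by apply: smooth_at_comp_rV; [exact: segment_map_smooth|exact: F_smooth].
Qed.

Lemma smooth_at_form (V : normedModType R) (x : V) (f h : V -> 'rV[R]_n) (G : V -> 'M[R]_n) :
  smooth_at f x -> smooth_at h x -> smooth_at G x ->
  smooth_at (fun y => (f y *m G y *m (h y)^T) 0 0) x.
Proof.
move=> sf sh sG.
have /smooth_at_mx := smooth_at_mulmx (smooth_at_mulmx sf sG) (smooth_at_trmx sh).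
exact.
Qed.

Lemma segment_form_smooth : smooth_at segment_form (s, u).
Proof.
exact: (smooth_at_form (segment_derive_smooth 0) (segment_derive_smooth 1) segment_F_smooth).
Qed.

Lemma segment_flux_smooth i : smooth_at (segment_flux i s) u.
Proof.
apply: (smooth_at_form sW (smooth_at_pairr (segment_derive_smooth i))).
exact: (smooth_at_pairr segment_F_smooth).
Qed.

Let derive_fst (f h : 'rV[R]_2 -> 'rV[R]_n) : smooth_at f u -> smooth_at h u ->
  'D_((1, 0) : R * 'rV[R]_2) (fun q : R * 'rV[R]_2 => f q.2 + q.1 *: h q.2) (s, u) = h u.
Proof.
move=> sf sh; apply/rowP => j.
have sfh := affine_smooth sf sh.
apply: (etrans (derive_mxE 0 j (smooth_at_derivable sfh))).
have sj : smooth_at (fun q : R * 'rV[R]_2 => (f q.2 + q.1 *: h q.2) 0 j) (s, u).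
  by have /smooth_at_mx := sfh; apply.
have [_ <-] := is_derive_fst (smooth_at_diff sj).
have D : is_derive s (1 : R) (fun t : R => f u 0 j + t * h u 0 j) (h u 0 j).
  apply: is_derive_eq (is_deriveD (is_derive_cst (f u 0 j) s (1 : R))
    (is_derive_mulr (is_derive_id s (1 : R)) (is_derive_cst (h u 0 j) s (1 : R)))) _.
  by rewrite /=; ring.
have E : (fun t : R => f u 0 j + t * h u 0 j) = (fun t : R => (f u + t *: h u) 0 j).
  by apply/funext => t; rewrite !mxE.
have [_ E2] := eq_ind _ (fun k => is_derive s (1 : R) k (h u 0 j)) D _ E.
exact: E2.
Qed.

Let derive_affine i (f h : 'rV[R]_2 -> 'rV[R]_n) : smooth_at f u -> smooth_at h u ->
  'D_(e_ i) (fun v => f v + s *: h v) u = 'D_(e_ i) f u + s *: 'D_(e_ i) h u.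
Proof.
move=> sf sh.
have shs : smooth_at (fun v => s *: h v) u by apply: smooth_atZ => //; exact: smooth_at_cst.
apply: (etrans (deriveD (smooth_at_derivable sf) (smooth_at_derivable shs))).
by congr (_ + _); exact: (deriveZ _ (smooth_at_derivable sh)).
Qed.

(* d/ds (y_s)^*F = d (i_W F) along the homotopy y_s = y0 + s W. *)
Lemma segment_form_derive : 'D_((1, 0) : R * 'rV[R]_2) segment_form (s, u) =
  'D_(e_ 0) (segment_flux 1 s) u - 'D_(e_ 1) (segment_flux 0 s) u.
Proof.
have sA := segment_derive_smooth 0; have sB := segment_derive_smooth 1.
have sF := segment_F_smooth; have sm := segment_map_smooth.
have dF (v : R * 'rV[R]_2) : 'D_v (fun q => F (segment_map q)) (s, u) =
    'D_('D_v segment_map (s, u)) F (segment_map (s, u)).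
  exact: (derive_comp v (smooth_at_diff sm) (smooth_at_diff (F_smooth Sy))).
have smu := smooth_at_pairr sm; have sFu := smooth_at_pairr sF.
have dFu i : 'D_(e_ i) (fun v => F (segment_map (s, v))) u =
    'D_(segment_derive i (s, u)) F (segment_map (s, u)).
  apply: (etrans (derive_comp (e_ i) (smooth_at_diff smu) (smooth_at_diff (F_smooth Sy)))).
  by have -> : 'D_(e_ i) (fun v => segment_map (s, v)) u = segment_derive i (s, u)
    by exact: (derive_affine i s0 sW).
have dD i j : 'D_(e_ j) (fun v => segment_derive i (s, v)) u =
    'D_(e_ j) ('D_(e_ i) y0) u + s *: 'D_(e_ j) ('D_(e_ i) W) u.
  exact: (derive_affine j (smooth_at_derive (e_ i) s0) (smooth_at_derive (e_ i) sW)).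
have dflux i j := derive_form (e_ j) sW (smooth_at_pairr (segment_derive_smooth i)) sFu.
have dfst i : 'D_((1, 0) : R * 'rV[R]_2) (segment_derive i) (s, u) = 'D_(e_ i) W u.
  exact: (derive_fst (smooth_at_derive (e_ i) s0) (smooth_at_derive (e_ i) sW)).
have dmap : 'D_((1, 0) : R * 'rV[R]_2) segment_map (s, u) = W u by exact: (derive_fst s0 sW).
have dform := derive_form ((1, 0) : R * 'rV[R]_2) sA sB sF.
have mixed : 'D_(e_ 1) (fun v => segment_derive 0 (s, v)) u =
    'D_(e_ 0) (fun v => segment_derive 1 (s, v)) u.
  apply: (etrans (dD 0 1)); apply: (etrans _ (esym (dD 1 0))).
  exact: (f_equal2 (fun x y => x + s *: y)
    (derive_derive_comm_mx (e_ 0) (e_ 1) s0) (derive_derive_comm_mx (e_ 0) (e_ 1) sW)).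
have dF1 := etrans (dF (1, 0)) (f_equal (fun X => 'D_X F (segment_map (s, u))) dmap).
have id3 := closed_form_identity (W u) (segment_derive 0 (s, u)) (segment_derive 1 (s, u)) Sy.
apply: (etrans dform).
apply: (etrans (flux_algebra (F_antisym Sy) (dfst 0) (dfst 1) mixed dF1 (dFu 0) (dFu 1) id3)).
by apply: esym; exact: (f_equal2 (fun x y => x - y) (dflux 1 0) (dflux 0 1)).
Qed.

End Point.

End FormHomotopy.

Lemma half_dist01 (R : realFieldType) : `|0 - 2^-1 : R| < 3 / 2 /\ `|1 - 2^-1 : R| < 3 / 2.
Proof. by rewrite !ltr_norml; split; apply/andP; split; lra. Qed.

Section HomotopyStep.
Context {R : realType} {M : ptopologicalType} {N : topologicalType} {n : nat}.
Variables (A : manifold R 2 M) (g : tensor2 A) (B : manifold R n N) (w : tensor2 B).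
Hypotheses (M_compact : compact [set: M]) (gr : riemannian g).
Variable mu : {measure set (borel_space M) -> \bar R}.
Hypothesis mu_volume : riemannian_volume g mu.
Hypothesis w_symplectic : symplectic w.
Variable phi : M -> N.
Hypothesis phi_smooth : smooth_map A B phi.
Hypothesis phi_density : forall c u i, atlas A c -> cimg c u ->
  'D_(e_ i) (density g w phi c) u = 0.

Local Notation la2 := (@lebesgue_measure R \x @lebesgue_measure R)%E.

Lemma symplectic_antisym c u : atlas B c -> cimg c u -> (w c u)^T = - w c u.
Proof. by move=> Bc cu; have [] := w_symplectic Bc cu. Qed.

(* |s - 1/2| < 3/2 is an open interval of parameters around [0, 1]. *)
Section Segment.
Variables (c : chart R 2 M) (d : chart R n N) (a : 'rV[R]_2) (r : R).
Hypotheses (Ac : atlas A c) (Bd : atlas B d) (r0 : 0 < r) (bc : box a r `<=` cimg c).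
Variables (y0 W : 'rV[R]_2 -> 'rV[R]_n).
Hypotheses (y0_smooth : forall u, box a r u -> smooth_at y0 u)
  (W_smooth : forall u, box a r u -> smooth_at W u)
  (W0 : forall u, `|u - a| = r -> W u = 0)
  (segment_dom : forall s u, `|s - 2^-1| < 3 / 2 -> box a r u -> cimg d (y0 u + s *: W u)).

Local Notation f := (density g w phi c).
Local Notation sform := (segment_form (w d) y0 W).

Let wd_smooth p : cimg d p -> smooth_at (w d) p.
Proof. by move=> /cimgP[dx <-]; exact: tensor2_smooth_at. Qed.

Let wd_antisym p : cimg d p -> (w d p)^T = - w d p.
Proof. exact: symplectic_antisym. Qed.

Let wd_closed p i j k : cimg d p ->
  ('D_(e_ i) (w d) p) j k + ('D_(e_ j) (w d) p) k i + ('D_(e_ k) (w d) p) i j = 0.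
Proof. by move=> dp; have [_ H _] := w_symplectic Bd dp; exact: H. Qed.

Let f_smooth u : box a r u -> smooth_at f u.
Proof.
by move=> /bc/cimgP[cx <-]; apply: density_smooth => //; exact: symplectic_antisym.
Qed.

Let G (q : R * 'rV[R]_2) := sform q * f q.2.

Let sform_smooth s u : `|s - 2^-1| < 3 / 2 -> box a r u -> smooth_at sform (s, u).
Proof.
move=> hs bu; apply: (segment_form_smooth wd_smooth (y0_smooth bu) (W_smooth bu)).
exact: segment_dom.
Qed.

Let G_smooth s u : `|s - 2^-1| < 3 / 2 -> box a r u -> smooth_at G (s, u).
Proof.
move=> hs bu; apply: smooth_atM; first exact: sform_smooth.
by apply: smooth_at_comp_snd; exact: f_smooth.
Qed.

Let G_derive s u : `|s - 2^-1| < 3 / 2 -> box a r u ->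
  'D_((1, 0) : R * 'rV[R]_2) G (s, u) =
  ('D_(e_ 0) (segment_flux (w d) y0 W 1 s) u - 'D_(e_ 1) (segment_flux (w d) y0 W 0 s) u) * f u.
Proof.
move=> hs bu.
have [_ <-] := is_derive_fst (smooth_at_diff (G_smooth hs bu)).
have D := is_derive_fst (smooth_at_diff (sform_smooth hs bu)).
have E := segment_form_derive wd_smooth wd_antisym wd_closed (@cimg_open _ _ _ d)
  (y0_smooth bu) (W_smooth bu) (segment_dom hs bu).
have [_ E2] := is_derive_mulr D (is_derive_cst (f u) s (1 : R)).
apply: (etrans E2); apply: (etrans (f_equal (fun x => _ + x) (mulr0 _))).
by apply: (etrans (addr0 _)); exact: (f_equal (fun x => x * f u) E).
Qed.

(** The parameter derivative of the integral is that of (D_0 flux_1 - D_1 flux_0) f, which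
    [stokes_qbox] shows to be 0 because the flux vanishes with W on the boundary. The mean value
    theorem on [0, 1] concludes. *)
Lemma segment_integral : \int[la2]_(p in qbox a r) G (1, rV2 p) = \int[la2]_(p in qbox a r) G (0, rV2 p).
Proof.
have flux_smooth i (s : R) u : `|s - 2^-1| < 3 / 2 -> box a r u ->
    smooth_at (segment_flux (w d) y0 W i s) u.
  move=> hs bu; apply: (segment_flux_smooth wd_smooth (y0_smooth bu) (W_smooth bu)).
  exact: segment_dom.
have flux0 i s u : `|u - a| = r -> segment_flux (w d) y0 W i s u = 0.
  by move=> /W0 Wu; rewrite /segment_flux Wu !mul0mx mxE.
pose H s := \int[la2]_(p in qbox a r) G (s, rV2 p).
have dH (s : R) : 0 <= s <= 1 -> is_derive s (1 : R) H 0.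
  move=> /andP[s0 s1].
  have near_s (t : R) : `|t - s| < 1 -> `|t - 2^-1| < 3 / 2.
    by rewrite !ltr_norml => /andP[? ?]; apply/andP; split; lra.
  have hs : `|s - 2^-1| < 3 / 2 by apply: near_s; rewrite subrr normr0.
  have sG (t : R) u : `|t - s| < 1 -> box a r u -> smooth_at G (t, u).
    by move=> /near_s; exact: G_smooth.
  apply: is_derive_eq (is_derive_integral_qbox ltr01 r0 sG) _.
  have E := stokes_qbox gr symplectic_antisym phi_smooth phi_density Ac r0 bc
    (fun u => flux_smooth 0 s u hs) (fun u => flux_smooth 1 s u hs) (flux0 0 s) (flux0 1 s).
  by apply: etrans E; apply: eq_Rintegral => p; rewrite inE => bp; exact: G_derive.
apply/eqP; rewrite -subr_eq0; apply/eqP.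
have [t _] : exists2 t : R, t \in `]0, 1[%R & H 1 - H 0 = cst (0 : R) t * (1 - 0).
  apply: (@MVT R H (cst (0 : R))) => //.
  - by move=> t; rewrite in_itv /= => /andP[t0 t1]; apply: dH; rewrite !ltW.
  - apply: derivable_within_continuous => t; rewrite in_itv /= => t01.
    by have [] := dH t t01.
by rewrite mul0r.
Qed.

End Segment.

(** The integral of f chi^*w, with f the density of [phi]; at chi = phi it is twice the energy of
    [phi]. *)
Definition pairing (chi : M -> N) : R := \int[mu]_x inner2 g (pullback chi w) (pullback phi w) x.

Section Step.
Variables (chi0 chi1 : M -> N) (c : chart R 2 M) (d : chart R n N) (a : 'rV[R]_2) (r : R).
Hypotheses (sm0 : smooth_map A B chi0) (sm1 : smooth_map A B chi1).
Hypotheses (Ac : atlas A c) (Bd : atlas B d) (r0 : 0 < r) (bc : box a (3 * r) `<=` cimg c).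
Hypotheses (chi_out : forall x, ~ cbox c a (2 * r) x -> chi1 x = chi0 x)
  (chi_bd : forall u, `|u - a| = 2 * r -> chi1 (cinv c u) = chi0 (cinv c u))
  (dom0 : forall x, cbox c a (2 * r) x -> cdom d (chi0 x))
  (dom1 : forall x, cbox c a (2 * r) x -> cdom d (chi1 x))
  (dom_segment : forall s x, `|s - 2^-1| < 3 / 2 -> cbox c a (2 * r) x ->
    cimg d (cmap d (chi0 x) + s *: (cmap d (chi1 x) - cmap d (chi0 x)))).

Let bc2 : box a (2 * r) `<=` cimg c.
Proof. exact: (box2_sub r0 bc). Qed.

Let boxP u : box a (2 * r) u -> [/\ cbox c a (2 * r) (cinv c u), cdom c (cinv c u) & cmap c (cinv c u) = u].
Proof. by move=> bu; have [cx xE] := cimgP (bc2 bu); split=> //; split=> //; rewrite xE. Qed.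

Lemma coef01E chi x : smooth_map A B chi -> cdom c x -> cdom d (chi x) ->
  coef01 w chi c (cmap c x) = ('D_(e_ 0) (cmap d \o chi \o cinv c) (cmap c x) *m
    w d (cmap d (chi x)) *m ('D_(e_ 1) (cmap d \o chi \o cinv c) (cmap c x))^T) 0 0.
Proof.
move=> sm cx dx.
have [_ s] := (smooth_mapP A B chi).1 sm.
have sd := smooth_at_diff (s c d x Ac Bd cx dx).
have D i : 'D_(e_ i) (cmap d \o chi \o cinv c) (cmap c x) =
    row i ('J (cmap d \o chi \o cinv c) (cmap c x)).
  by apply/rowP => j; rewrite [RHS]mxE; apply: esym; exact: (jacobianE i j sd).
rewrite /coef01 (pullbackE w sm Ac Bd cx dx) !D.
move: ('J (cmap d \o chi \o cinv c) (cmap c x)) => J.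
rewrite -row_mul [LHS]mxE [RHS]mxE; apply: eq_bigr => k _.
by congr (_ * _); [rewrite [RHS]mxE|rewrite [LHS]mxE [RHS]mxE [RHS]mxE].
Qed.

(** Both maps agree off the box, so only the box contributes. There the two coefficients are the
    values of [segment_form] at s = 1 and s = 0 for the straight segment between the coordinate
    expressions, and [segment_integral] equates their integrals. *)
Lemma pairing_step : pairing chi1 = pairing chi0.
Proof.
have wa := symplectic_antisym.
have f0 := form2_pull wa sm0; have f1 := form2_pull wa sm1; have fp := form2_pull wa phi_smooth.
have c0 := inner2_continuous gr f0 fp; have c1 := inner2_continuous gr f1 fp.
have r2 : 0 < 2 * r by rewrite mulr_gt0.
apply/eqP; rewrite -subr_eq0; apply/eqP.
apply: (etrans (esym (RintegralB_continuous M_compact gr mu_volume c1 c0))).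
have cont01 : continuous (fun x => inner2 g (pullback chi1 w) (pullback phi w) x -
    inner2 g (pullback chi0 w) (pullback phi w) x).
  by move=> x; apply: cvgB; [exact: c1|exact: c0].
apply: (etrans (Rintegral_supp_cbox gr mu_volume Ac r2 bc2 cont01 _)).
  move=> x nx; have [Ad dx] := chart_atP A x.
  have E : \forall y \near x, chi1 y = chi0 y.
    by apply: filterS (near_notin_cbox A r0 bc nx) => y; exact: chi_out.
  by rewrite /inner2 (pullback_near_eq w sm1 Ad dx E) subrr.
pose y0 := cmap d \o chi0 \o cinv c; pose y1 := cmap d \o chi1 \o cinv c.
pose W u := y1 u - y0 u.
have [_ s0] := (smooth_mapP A B chi0).1 sm0.
have [_ s1] := (smooth_mapP A B chi1).1 sm1.
have y0_smooth u : box a (2 * r) u -> smooth_at y0 u.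
  by move=> /boxP[bx cx xE]; rewrite -xE; apply: s0 => //; exact: dom0.
have y1_smooth u : box a (2 * r) u -> smooth_at y1 u.
  by move=> /boxP[bx cx xE]; rewrite -xE; apply: s1 => //; exact: dom1.
have W_smooth u : box a (2 * r) u -> smooth_at W u.
  by move=> bu; apply: smooth_atB; [exact: y1_smooth|exact: y0_smooth].
have W0 u : `|u - a| = 2 * r -> W u = 0.
  by move=> bu; rewrite /W /y1 /y0 /= chi_bd// subrr.
have dom (s : R) u : `|s - 2^-1| < 3 / 2 -> box a (2 * r) u -> cimg d (y0 u + s *: W u).
  by move=> hs /boxP[bx _ _]; exact: dom_segment.
have I := segment_integral Ac Bd r2 bc2 y0_smooth W_smooth W0 dom.
have E0 u : box a (2 * r) u -> coef01 w chi0 c u = segment_form (w d) y0 W (0, u).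
  move=> bu; have [bx cx xE] := boxP bu.
  have E := coef01E sm0 cx (dom0 bx); rewrite xE in E; apply: (etrans E).
  have Z (x y : 'rV[R]_n) : x = x + 0 *: y by rewrite scale0r addr0.
  have D i : 'D_(e_ i) y0 u = segment_derive y0 W i (0, u) by exact: Z.
  exact: (f_equal3 (fun X P Y => (X *m w d P *m Y^T) 0 0) (D 0) (Z (y0 u) (W u)) (D 1)).
have E1 u : box a (2 * r) u -> coef01 w chi1 c u = segment_form (w d) y0 W (1, u).
  move=> bu; have [bx cx xE] := boxP bu.
  have E := coef01E sm1 cx (dom1 bx); rewrite xE in E; apply: (etrans E).
  have D i : 'D_(e_ i) y1 u = segment_derive y0 W i (1, u).
    rewrite /segment_derive scale1r; apply/eqP; rewrite addrC -subr_eq; apply/eqP.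
    apply: esym.
    exact: (deriveB (smooth_at_derivable (y1_smooth _ bu)) (smooth_at_derivable (y0_smooth _ bu))).
  have Z : y1 u = y0 u + 1 *: W u by rewrite scale1r /W addrC subrK.
  exact: (f_equal3 (fun X P Y => (X *m w d P *m Y^T) 0 0) (D 0) Z (D 1)).
apply: (etrans _ (etrans (f_equal (fun z => z - _) I) (subrr _))).
have cG (s : R) u : `|s - 2^-1| < 3 / 2 -> box a (2 * r) u ->
    {for u, continuous (fun u => segment_form (w d) y0 W (s, u) * density g w phi c u)}.
  move=> hs bu; have [bx cx xE] := boxP bu; apply: smooth_at_cont; apply: smooth_atM.
    apply: (smooth_at_pairr (f := segment_form (w d) y0 W)).
    apply: segment_form_smooth (y0_smooth _ bu) (W_smooth _ bu) (dom s u hs bu).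
    by move=> p /cimgP[dx <-]; exact: tensor2_smooth_at.
  by rewrite -xE; exact: density_smooth.
have [h0 h1] := half_dist01 R.
apply: (etrans _ (Rintegral_qboxB r2 (fun u => cG 1 u h1) (fun u => cG 0 u h0))).
apply: eq_Rintegral => p; rewrite inE => bp.
have [bx cx xE] := boxP bp.
have P1 := inner2_density gr wa phi_smooth f1 Ac cx.
have P0 := inner2_density gr wa phi_smooth f0 Ac cx.
rewrite xE in P0 P1.
apply: (etrans (mulrBl _ _ _)); apply: (etrans (f_equal2 (fun x y => x - y) P1 P0)).
exact: (f_equal2 (fun x y => x * _ - y * _) (E1 _ bp) (E0 _ bp)).
Qed.

End Step.
End HomotopyStep.

(** * Smooth approximation of continuous maps *)

Section Approximation.
Context {R : realType} {n : nat}.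

Lemma smooth_at_sum_seq (V W : normedModType R) (I : eqType) (s : seq I) (f : I -> V -> W) x :
  (forall i, smooth_at (f i) x) -> smooth_at (fun y => \sum_(i <- s) f i y) x.
Proof.
move=> sf; elim: s => [|i s IH].
  apply: (@smooth_at_eq _ _ _ (fun=> 0)); last exact: smooth_at_cst.
  by apply: nearW => y; rewrite big_nil.
apply: (@smooth_at_eq _ _ _ (fun y => f i y + \sum_(j <- s) f j y)).
  by apply: nearW => y; rewrite big_cons.
exact: smooth_atD.
Qed.

(** A bump-weighted average of finitely many values of [f]. The bump at z has support of radius
    [2 * D z], chosen so small that f varies there by less than [e / 2], and the cores of radius
    [D z] cover the box, which keeps the total weight positive. *)
Lemma smooth_approximation a r (f : 'rV[R]_2 -> 'rV[R]_n) (e : R) : 0 < e ->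
  (forall u, box a r u -> {for u, continuous f}) ->
  exists y : 'rV[R]_2 -> 'rV[R]_n, forall u, box a r u -> smooth_at y u /\ `|y u - f u| < e.
Proof.
move=> e0 cf.
have loc u : exists d : R, 0 < d /\
    (box a r u -> forall v, `|v - u| < 2 * d -> `|f u - f v| < e / 2).
  have [bu|nbu] := pselect (box a r u); last by exists 1; split.
  have /cvgr_dist_lt/(_ (e / 2)) := cf u bu; rewrite divr_gt0// => /(_ isT)/nbhs_ballP[d /= d0 dP].
  exists (d / 2); split; first by rewrite divr_gt0.
  move=> _ v; rewrite mulrC divfK// => vu; apply: dP.
  by rewrite -ball_normE /= distrC.
have [D DP] := choice loc.
have [s [sb sc]] : exists s : seq 'rV[R]_2, (forall z, z \in s -> box a r z) /\
    forall u, box a r u -> exists2 z, z \in s & `|u - z| <= D z.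
  apply: (compact_cover_seq (P := fun z => [set u | `|u - z| <= D z]) (@box_compact R a r)).
  move=> z _; apply/nbhs_ballP; exists (D z) => /=; first by have [] := DP z.
  by move=> u; rewrite -ball_normE /= distrC => /ltW.
pose b z := bump2 z (D z).
have b0 z u : 0 <= b z u by have /andP[] := bump2_01 z (D z) u.
pose S u := \sum_(z <- s) b z u.
exists (fun u => (S u)^-1 *: \sum_(z <- s) b z u *: f z) => u bu.
have S0 : 0 < S u.
  have [z zs uz] := sc u bu; have [D0 _] := DP z.
  rewrite /S (big_rem z zs) /= ltr_wpDr//; first by apply: sumr_ge0.
  by rewrite /b bump2_1// ltr01.
split.
  apply: smooth_atZ.
    apply: smooth_atV; first by rewrite gt_eqF.
    by apply: smooth_at_sum_seq => z; exact: bump2_smooth.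
  apply: smooth_at_sum_seq => z; apply: smooth_atZ; first exact: bump2_smooth.
  exact: smooth_at_cst.
have -> : (S u)^-1 *: (\sum_(z <- s) b z u *: f z) - f u =
    (S u)^-1 *: (\sum_(z <- s) b z u *: (f z - f u)).
  under [X in _ = _ *: X]eq_bigr do rewrite scalerBr.
  rewrite sumrB -scaler_suml scalerBr scalerA mulVf ?scale1r// gt_eqF//.
have e2 : e / 2 < e by rewrite ltr_pdivrMr// mulr_natr mulr2n ltr_pwDr.
apply: le_lt_trans e2.
rewrite normrZ gtr0_norm ?invr_gt0// mulrC ler_pdivrMr//.
apply: le_trans (ler_norm_sum _ _ _) _.
rewrite /S mulr_sumr big_seq [leRHS]big_seq; apply: ler_sum => z zs.
rewrite normrZ (ger0_norm (b0 z u)) mulrC.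
have [D0 Dz] := DP z.
have [uz|zu] := ltP `|u - z| (2 * D z).
  by apply: ler_wpM2r => //; apply: ltW; apply: Dz => //; exact: sb.
by rewrite /b bump2_0// !mulr0.
Qed.

End Approximation.

Section Blend.
Context {R : realType} {M : ptopologicalType} {N : topologicalType} {n : nat}.
Variables (A : manifold R 2 M) (B : manifold R n N).

(** One pair of charts suffices because, for a map continuous at [x], smoothness passes to any other
    pair. The predicate records which points have become smooth while a map is modified patch by
    patch. *)
Definition smooth_point (chi : M -> N) x := exists c d,
  [/\ atlas A c, atlas B d, cdom c x, cdom d (chi x) &
      smooth_at (cmap d \o chi \o cinv c) (cmap c x)].

Variables (c : chart R 2 M) (d : chart R n N) (a : 'rV[R]_2) (r : R).
Hypotheses (Ac : atlas A c) (Bd : atlas B d) (r0 : 0 < r) (bc : box a (3 * r) `<=` cimg c).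

Local Notation b := (cutoff c a r).

Section Target.
Variables (chi : M -> N) (y : 'rV[R]_2 -> 'rV[R]_n).

(* blend follows chi away from the box and, in the chart d, the target y on    *)
(* the core of the box.                                                        *)
Definition blend_coord x : 'rV[R]_n :=
  cmap d (chi x) + b x *: (y (cmap c x) - cmap d (chi x)).

Definition blend x : N := if b x == 0 then chi x else cinv d (blend_coord x).

Lemma blend_out x : ~ cbox c a (2 * r) x -> blend x = chi x.
Proof. by move=> nx; rewrite /blend cutoff_0// eqxx. Qed.

(** Where [chi x] lies in the domain of [d], the two branches of [blend] agree at a vanishing
    cutoff. Elsewhere [cmap d (chi x)] is meaningless, and the test in [blend] avoids it. *)
Lemma blendE x : cdom d (chi x) -> blend x = cinv d (blend_coord x).
Proof.
move=> dx; rewrite /blend; case: eqP => // b0.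
by rewrite /blend_coord b0 scale0r addr0 cmapK.
Qed.

Lemma blend_bd u : cdom c (cinv c u) -> cmap c (cinv c u) = u -> `|u - a| = 2 * r ->
  blend (cinv c u) = chi (cinv c u).
Proof.
by move=> cx uE ur; rewrite /blend cutoffE// uE bump2_0 ?ur// eqxx.
Qed.

Hypotheses (chi_cont : continuous chi)
  (chi_dom : forall x, cbox c a (2 * r) x -> cdom d (chi x))
  (blend_cimg : forall x, cbox c a (2 * r) x -> cimg d (blend_coord x)).

Lemma blend_dom x : cbox c a (2 * r) x -> cdom d (blend x) /\ cmap d (blend x) = blend_coord x.
Proof. by move=> bx; rewrite blendE; [exact/cimgP/blend_cimg|exact: chi_dom]. Qed.

Lemma near_blend x : cbox c a (2 * r) x -> \forall z \near x,
  [/\ cdom c z, cdom d (chi z) & blend z = cinv d (blend_coord z)].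
Proof.
move=> bx; have [cx _] := bx.
have n1 : nbhs x (cdom c) by exact: nbhs_cdom.
have n2 : \forall z \near x, cdom d (chi z).
  apply: chi_cont; apply: open_nbhs_nbhs; split; first exact: cdom_open.
  exact: chi_dom.
by apply: filterS (filterI n1 n2) => z [cz dz]; split=> //; exact: blendE.
Qed.

Lemma cutoff_cont : continuous b.
Proof.
move=> x; have [e [Ae ex]] := atlas_cover A x.
have c1 : {for x, continuous ((b \o cinv e) \o cmap e)}.
  apply: (continuous_comp (cmap_continuous ex)).
  exact: (smooth_at_cont (cutoff_smooth Ac r0 bc Ae ex)).
have n1 : nbhs x (cdom e) by exact: nbhs_cdom.
have E : \forall z \near x, ((b \o cinv e) \o cmap e) z = b z.
  by apply: filterS n1 => z ez; rewrite /= cmapK.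
move: c1; rewrite /prop_for /continuous_at [X in _ --> X](nbhs_singleton E) => c1.
exact: cvg_trans (near_eq_cvg E) c1.
Qed.

Lemma blend_continuous : (forall u, box a (2 * r) u -> {for u, continuous y}) -> continuous blend.
Proof.
move=> cy x; have [bx|nx] := pselect (cbox c a (2 * r) x); last first.
  have E : \forall z \near x, chi z = blend z.
    by apply: filterS (near_notin_cbox A r0 bc nx) => z /blend_out ->.
  rewrite /continuous_at (blend_out nx).
  exact: cvg_trans (near_eq_cvg E) (chi_cont (x := x)).
have [cx bx'] := bx.
have c1 : {for x, continuous (cmap d \o chi)}.
  by apply: (continuous_comp (chi_cont (x := x))); apply: cmap_continuous; exact: chi_dom.
have c2 : {for x, continuous (y \o cmap c)}.
  by apply: (continuous_comp (cmap_continuous cx)); exact: cy.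
have c3 : blend_coord z @[z --> x] --> blend_coord x.
  by apply: cvgD; [exact: c1|apply: cvgZ; [exact: cutoff_cont|apply: cvgB; [exact: c2|exact: c1]]].
have c4 : cinv d (blend_coord z) @[z --> x] --> cinv d (blend_coord x).
  have c5 : {for x, continuous blend_coord} by exact: c3.
  exact: (continuous_comp c5 (cinv_continuous (blend_cimg bx))).
have E : \forall z \near x, cinv d (blend_coord z) = blend z.
  by apply: filterS (near_blend bx) => z [].
rewrite /continuous_at (blendE (chi_dom bx)).
exact: cvg_trans (near_eq_cvg E) c4.
Qed.

Lemma smooth_point_chart x : smooth_point chi x -> cdom c x -> cdom d (chi x) ->
  smooth_at (cmap d \o chi \o cinv c) (cmap c x).
Proof.
move=> [c' [d' [Ac' Bd' cx' dx' s]]] cx dx.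
exact: (smooth_chart_change (chi_cont (x := x)) Ac' Ac Bd' Bd cx' cx dx' dx s).
Qed.

Lemma blend_smooth_eq x (h : 'rV[R]_2 -> 'rV[R]_n) : cbox c a (2 * r) x ->
  (\forall z \near x, h (cmap c z) = blend_coord z) -> smooth_at h (cmap c x) ->
  smooth_point blend x.
Proof.
move=> bx hE sh; have [cx _] := bx; have [dx xE] := blend_dom bx.
exists c, d; split=> //.
have n1 : \forall u \near cmap c x, cimg d (h u).
  apply: (smooth_at_cont sh); apply: open_nbhs_nbhs; split; first exact: cimg_open.
  by rewrite (nbhs_singleton hE); exact: blend_cimg.
apply: smooth_at_eq sh.
apply: filterS (filterI n1 (near_cinv cx (filterI hE (near_blend bx)))) => u [du [cu [hu [cz dz bz]]]].
have [_ uE] := cimgP cu; rewrite uE in hu.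
by rewrite /= bz -hu; have [_ ->] := cimgP du.
Qed.

Lemma smooth_point_blend_out x : ~ cbox c a (2 * r) x -> smooth_point chi x -> smooth_point blend x.
Proof.
move=> nx [c' [d' [Ac' Bd' cx' dx' s]]].
exists c', d'; split=> //; first by rewrite blend_out.
apply: smooth_at_eq s.
by apply: filterS (near_cinv cx' (near_notin_cbox A r0 bc nx)) => u [_ nu]; rewrite /= blend_out.
Qed.

Lemma smooth_point_blend_in x : cbox c a (2 * r) x -> smooth_at y (cmap c x) ->
  smooth_point chi x -> smooth_point blend x.
Proof.
move=> bx sy sx; have [cx _] := bx.
have sc := smooth_point_chart sx cx (chi_dom bx).
apply: (@blend_smooth_eq x (fun u => (cmap d \o chi \o cinv c) u +
    bump2 a r u *: (y u - (cmap d \o chi \o cinv c) u))) => //.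
  apply: filterS (near_blend bx) => z [cz _ _].
  by rewrite /blend_coord /= cmapK// cutoffE.
apply: smooth_atD => //; apply: smooth_atZ; first exact: bump2_smooth.
exact: smooth_atB.
Qed.

Lemma smooth_point_blend_core x : (cbox c a r)^° x -> smooth_at y (cmap c x) ->
  smooth_point blend x.
Proof.
move=> ix sy.
have [cx bx] : cbox c a r x by exact: (nbhs_singleton ix).
have bx2 : cbox c a (2 * r) x by split=> //; apply: box_sub bx; rewrite ler_peMl// ?ler1n// ltW.
apply: (blend_smooth_eq bx2 _ sy); apply: filterS ix => z bz.
by rewrite /blend_coord cutoff_1// scale1r addrC subrK.
Qed.

Lemma blend_core x : cbox c a r x -> blend_coord x = y (cmap c x).
Proof. by move=> bx; rewrite /blend_coord cutoff_1// scale1r addrC subrK. Qed.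

(** [blend_coord] is a convex combination of the two points, and balls are convex. *)
Lemma blend_coord_dist x p e : `|cmap d (chi x) - p| < e -> `|y (cmap c x) - p| < e ->
  `|blend_coord x - p| < e.
Proof.
move=> h1 h2; have /andP[b0 b1] := cutoff_01 c a r x.
have -> : blend_coord x - p = (1 - b x) *: (cmap d (chi x) - p) + b x *: (y (cmap c x) - p).
  by apply/rowP => j; rewrite /blend_coord !mxE; ring.
apply: le_lt_trans (ler_normD _ _) _; rewrite !normrZ (ger0_norm b0) ger0_norm ?subr_ge0//.
(* For a zero weight the strict inequality comes from the first point; otherwise it comes from the
   second. *)
have [->|b00] := eqVneq (b x) 0; first by rewrite subr0 mul1r mul0r addr0.
have bx0 : 0 < b x by rewrite lt0r b00.
have : b x * `|y (cmap c x) - p| < b x * e by rewrite ltr_pM2l.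
have : (1 - b x) * `|cmap d (chi x) - p| <= (1 - b x) * e by rewrite ler_wpM2l ?subr_ge0// ltW.
by lra.
Qed.

End Target.

End Blend.

Section Patches.
Context {R : realType} {M : ptopologicalType} {N : topologicalType} {n : nat}.
Variables (A : manifold R 2 M) (B : manifold R n N).
Hypothesis M_compact : compact [set: M].

Record patch := Patch {
  patch_chart : chart R 2 M; patch_target : chart R n N;
  patch_center : 'rV[R]_2; patch_radius : R }.

Implicit Type q : patch.

Definition patch_core q := cbox (patch_chart q) (patch_center q) (patch_radius q).
Definition patch_box q := cbox (patch_chart q) (patch_center q) (2 * patch_radius q).
Definition patch_ok q := [/\ atlas A (patch_chart q), atlas B (patch_target q),
  0 < patch_radius q & box (patch_center q) (3 * patch_radius q) `<=` cimg (patch_chart q)].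
Lemma patch_box_closed q : patch_ok q -> closed (patch_box q).
Proof. by move=> [Ac _ r0 bc]; exact: (cbox_closed A (box2_sub r0 bc)). Qed.

Lemma exists_patches (h : M -> N) : continuous h -> exists (s : seq M) (Q : M -> patch),
  (forall z, patch_ok (Q z) /\
    forall x, patch_box (Q z) x -> cdom (patch_target (Q z)) (h x)) /\
  forall x, exists2 z, z \in s & (patch_core (Q z))^° x.
Proof.
move=> ch.
have loc (z : M) : exists q, [/\ patch_ok q,
    forall x, patch_box q x -> cdom (patch_target q) (h x) & nbhs z (patch_core q)].
  have [d [Bd dz]] := atlas_cover B (h z).
  have nP : \forall x \near z, cdom d (h x).
    by apply: ch; exact: nbhs_cdom.
  have [c [a [r [Ac cz r0 za [bc bP]]]]] := exists_cbox A nP.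
  exists (Patch c d a r); split=> //=.
  by rewrite /patch_core /= -za; exact: nbhs_cbox.
have [Q QP] := choice loc.
have [s sP] : exists s : seq M, forall x, exists2 z, z \in s & (patch_core (Q z))^° x.
  apply: (compact_nbhs_cover M_compact) => z; have [_ _] := QP z.
  exact: nbhs_interior.
by exists s, Q; split=> // z; have [h1 h2 _] := QP z.
Qed.

(** A condition imposed only over a closed box is open: off the box it is void on a
    neighbourhood. *)
Lemma open_patch_rel q (V : set (M * N)) : patch_ok q ->
  (forall p, patch_box q p.1 -> V p -> nbhs p V) ->
  open [set p : M * N | patch_box q p.1 -> V p].
Proof.
move=> okq oV; rewrite openE => -[x y] /= H; rewrite /interior.
have [bx|nx] := pselect (patch_box q x).
  by apply: filterS (oV (x, y) bx (H bx)) => p Vp _.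
exists (~` patch_box q, setT) => /=.
  split; last exact: filterT.
  by apply: open_nbhs_nbhs; split=> //; exact/closed_openC/patch_box_closed.
by move=> [x' y'] [/= nx' _].
Qed.

Lemma seq_min_pos (T : eqType) (s : seq T) (e : T -> R) : (forall z, 0 < e z) ->
  exists e0, 0 < e0 /\ forall z, z \in s -> e0 <= e z.
Proof.
move=> e_gt0; elim: s => [|z s [e0 [e00 H]]]; first by exists 1; split.
exists (Num.min (e z) e0); split; first by rewrite lt_min e_gt0.
move=> t; rewrite in_cons => /orP[/eqP ->|ts]; first by rewrite ge_min lexx.
by rewrite ge_min H ?orbT.
Qed.

(** Tube lemma for the graph of [h], measured in the target chart. Near each point some radius
    works, half of it being spent on the variation of [h] and half on [v]; compactness of M makes
    the radius uniform. *)
Lemma graph_tube (h : M -> N) q (O : set (M * N)) : patch_ok q -> continuous h -> open O ->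
  (forall x, O (x, h x)) -> (forall x, patch_box q x -> cdom (patch_target q) (h x)) ->
  exists2 e : R, 0 < e & forall x v, patch_box q x -> `|v - cmap (patch_target q) (h x)| < e ->
    cimg (patch_target q) v /\ O (x, cinv (patch_target q) v).
Proof.
move=> okq ch oO Oh dh; set d := patch_target q in dh *.
have loc (z : M) : exists e : R, 0 < e /\ nbhs z [set x | patch_box q x -> forall v,
    `|v - cmap d (h x)| < e -> cimg d v /\ O (x, cinv d v)].
  have [bz|nz] := pselect (patch_box q z); last first.
    exists 1; split=> //.
    have nn : nbhs z (~` patch_box q).
      by apply: open_nbhs_nbhs; split=> //; exact/closed_openC/patch_box_closed.
    by apply: filterS nn => x nx /nx.
  have dz := dh z bz.
  have [[P1 P2] /= [n1 n2] PO] : nbhs (z, h z) O by apply: open_nbhs_nbhs.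
  have [e /= e0 eP] := (nbhs_ballP _ _).1 (near_cinv dz n2).
  exists (e / 2); split; first by rewrite divr_gt0.
  have n3 : \forall x \near z, cdom d (h x).
    by apply: ch; exact: nbhs_cdom.
  have c4 : {for z, continuous (cmap d \o h)}.
    by apply: (continuous_comp (ch z)); exact: cmap_continuous.
  have n4 : \forall x \near z, `|cmap d (h z) - cmap d (h x)| < e / 2.
    by have /cvgr_dist_lt := c4; apply; rewrite divr_gt0.
  apply: filterS (filterI n1 n4) => x [P1x xz] _ v vx.
  have [dv P2v] : [set u | cimg d u /\ P2 (cinv d u)] v.
    apply: eP; rewrite -ball_normE /=.
    have -> : cmap d (h z) - v = (cmap d (h z) - cmap d (h x)) - (v - cmap d (h x)).
      by apply/rowP => j; rewrite !mxE; ring.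
    apply: le_lt_trans (ler_normB _ _) _.
    by rewrite [ltRHS](splitr e); exact: ltrD.
  by split=> //; exact: (PO (x, cinv d v)).
have [E EP] := choice loc.
have [s sP] := compact_nbhs_cover M_compact (fun z => proj2 (EP z)).
have [e [e0 eE]] := seq_min_pos s (fun z => proj1 (EP z)).
exists e => // x v bx vx; have [z zs Hz] := sP x.
by apply: Hz => //; apply: lt_le_trans vx (eE z zs).
Qed.

Lemma smooth_map_point (chi : M -> N) x : smooth_map A B chi -> smooth_point A B chi x.
Proof.
move=> /smooth_mapP[_ s]; have [c [Ac cx]] := atlas_cover A x.
by have [d [Bd dx]] := atlas_cover B (chi x); exists c, d; split=> //; exact: s.
Qed.

(** Shrinks the neighbourhood of the graph so that every map with graph inside it sends each listed
    box into the corresponding target chart. Successive modifications of [h] can then keep using the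
    same patches. *)
Lemma restrict_patch_domains (Q : M -> patch) (s : seq M) (h : M -> N) (O : set (M * N)) :
  (forall z, patch_ok (Q z) /\
    forall x, patch_box (Q z) x -> cdom (patch_target (Q z)) (h x)) ->
  open O -> (forall x, O (x, h x)) ->
  exists S : set (M * N), [/\ open S, S `<=` O, forall x, S (x, h x) &
    forall z x y, z \in s -> patch_box (Q z) x -> S (x, y) -> cdom (patch_target (Q z)) y].
Proof.
move=> QP oO Oh; elim: s => [|z s [S [oS SO Sh H]]]; first by exists O; split=> // z x y;
  rewrite in_nil.
have [okz dz] := QP z.
pose V := [set p : M * N | patch_box (Q z) p.1 -> [set p : M * N | cdom (patch_target (Q z)) p.2] p].
exists (S `&` V); split.
- apply: openI => //; apply: open_patch_rel => // -[x y] _ /= dy.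
  exists (setT, cdom (patch_target (Q z))) => /=; last by case=> x' y' [].
  by split; [exact: filterT|exact: nbhs_cdom].
- by move=> p [/SO].
- by move=> x; split=> // /dz.
- move=> t x y; rewrite in_cons => /orP[/eqP ->|ts] bx [Sxy Vxy]; first exact: Vxy.
  exact: (H t x y).
Qed.

(* h is replaced on one patch after the other by a smooth approximation; the   *)
(* points made smooth by earlier patches stay smooth under later blends.       *)
Lemma smooth_map_dense (h : M -> N) (O : set (M * N)) : continuous h -> open O ->
  (forall x, O (x, h x)) ->
  exists chi, smooth_map A B chi /\ forall x, O (x, chi x).
Proof.
move=> ch oO Oh; have [s [Q [QP sP]]] := exists_patches ch.
have [S [oS SO Sh Sd]] := restrict_patch_domains s QP oO Oh.
have {sP} : forall x, smooth_point A B h x \/ exists2 z, z \in s & (patch_core (Q z))^° x.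
  by move=> x; right.
(* The map [h] is generalised since each patch replaces it. The invariants are continuity, a graph
   inside [S], and that each point is already smooth or interior to the core of a remaining
   patch. *)
elim: s h ch Sh Sd {Oh QP oO} (fun z => (QP z).1) => [|z s IH] h ch Sh Sd okQ sP.
  exists h; split; last by move=> x; exact: SO.
  by apply: smooth_map_local => // x; have [|[]] := sP x.
have okz := okQ z; have [Ac Bd r0 bc] := okz.
have dh x : patch_box (Q z) x -> cdom (patch_target (Q z)) (h x).
  by move=> bx; apply: (Sd z x) => //; rewrite mem_head.
have [e e0 eP] := graph_tube okz ch oS Sh dh.
set c := patch_chart (Q z) in Ac bc; set d := patch_target (Q z) in Bd dh eP.
set a := patch_center (Q z) in bc; set r := patch_radius (Q z) in r0 bc.
have bc2 := box2_sub r0 bc.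
have cf u : box a (2 * r) u -> {for u, continuous (cmap d \o h \o cinv c)}.
  move=> bu; have [cx xE] := cimgP (bc2 _ bu).
  have c1 : {for u, continuous (cinv c)} by apply: cinv_continuous; exact: bc2.
  have c2 := continuous_comp c1 (ch (cinv c u)).
  apply: (continuous_comp c2); apply: cmap_continuous; apply: dh.
  by split=> //; rewrite -/c xE.
have [y yP] := smooth_approximation e0 cf.
have yd x : patch_box (Q z) x -> `|y (cmap c x) - cmap d (h x)| < e.
  move=> [cx bx]; have [_] := yP _ bx; by rewrite /= cmapK.
have coordP x : patch_box (Q z) x -> cimg d (blend_coord c d a r h y x) /\
    S (x, cinv d (blend_coord c d a r h y x)).
  move=> bx; apply: eP => //; apply: blend_coord_dist; last exact: yd.
  by rewrite subrr normr0.
have cimgb x (bx : cbox c a (2 * r) x) := (coordP x bx).1.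
pose h' := blend c d a r h y.
have ch' : continuous h'.
  apply: (blend_continuous Ac r0 bc ch dh cimgb) => u bu.
  by apply: smooth_at_cont; have [] := yP u bu.
have Sh1 x : S (x, h' x).
  have [bx|nx] := pselect (patch_box (Q z) x); last by rewrite /h' blend_out.
  by rewrite /h' blendE; [exact: (coordP x bx).2|exact: dh].
apply: (IH h') => //.
  by move=> t x y' ts; apply: Sd; rewrite in_cons ts orbT.
move=> x.
have [bx|nx] := pselect (patch_box (Q z) x); last first.
  have [sx|[t]] := sP x.
    by left; exact: (smooth_point_blend_out d r0 bc y nx sx).
  rewrite in_cons => /orP[/eqP ->|ts] tx; last by right; exists t.
  exfalso; apply: nx; have [cx bx] : patch_core (Q z) x by exact: nbhs_singleton tx.
  by split=> //; apply: box_sub bx; rewrite ler_peMl// ?ler1n// ltW.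
have sy : smooth_at y (cmap c x) by case: bx => _ /yP[].
have [sx|[t]] := sP x.
  by left; exact: (smooth_point_blend_in Ac Bd ch dh cimgb bx sy sx).
rewrite in_cons => /orP[/eqP ->|ts] tx; last by right; exists t.
by left; exact: (smooth_point_blend_core Ac Bd r0 ch dh cimgb tx sy).
Qed.

End Patches.

(** * Local constancy of the pairing near a continuous map *)

Section Homotopy.
Context {R : realType} {M : ptopologicalType} {N : topologicalType} {n : nat}.
Variables (A : manifold R 2 M) (g : tensor2 A) (B : manifold R n N) (w : tensor2 B).
Hypotheses (M_compact : compact [set: M]) (gr : riemannian g).
Variable mu : {measure set (borel_space M) -> \bar R}.
Hypothesis mu_volume : riemannian_volume g mu.
Hypothesis w_symplectic : symplectic w.
Variable phi : M -> N.
Hypothesis phi_smooth : smooth_map A B phi.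
Hypothesis phi_density : forall c u i, atlas A c -> cimg c u ->
  'D_(e_ i) (density g w phi c) u = 0.

Local Notation pairing := (pairing g w mu phi).

(** The constant 5 comes from the extended parameter range, where s is at most 2 in absolute value:
    e/5 + 2 (e/5 + e/5) = e. *)
Lemma segment_dist (p x y : 'rV[R]_n) (e s : R) : 0 < e -> `|s - 2^-1| < 3 / 2 ->
  `|x - p| < e / 5 -> `|y - p| < e / 5 -> `|x + s *: (y - x) - p| < e.
Proof.
move=> e0 hs hx hy.
have s2 : `|s| <= 2.
  have -> : s = (s - 2^-1) + 2^-1 by rewrite subrK.
  apply: le_trans (ler_normD _ _) _; rewrite [X in _ + X]gtr0_norm ?invr_gt0//.
  by apply: le_trans (lerD (ltW hs) (lexx _)) _; lra.
have -> : x + s *: (y - x) - p = (x - p) + s *: ((y - p) - (x - p)).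
  by apply/rowP => j; rewrite !mxE; ring.
apply: le_lt_trans (ler_normD _ _) _; rewrite normrZ.
have h : `|y - p - (x - p)| < e / 5 + e / 5.
  by apply: le_lt_trans (ler_normB _ _) _; exact: ltrD.
have h2 : `|s| * `|y - p - (x - p)| <= 2 * (e / 5 + e / 5).
  by apply: ler_pM => //; exact: ltW.
by apply: lt_le_trans (ltr_leD hx h2) _; lra.
Qed.

(* chi0 is blended into chi1 patch by patch; each patch needs a smaller        *)
(* neighbourhood of the graph, so S is built from the last patch backwards.    *)
Lemma pairing_locally_constant (h : M -> N) : continuous h ->
  exists S : set (M * N), [/\ open S, forall x, S (x, h x) &
    forall chi0 chi1, smooth_map A B chi0 -> smooth_map A B chi1 ->
      (forall x, S (x, chi0 x)) -> (forall x, S (x, chi1 x)) -> pairing chi0 = pairing chi1].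
Proof.
move=> ch; have [s [Q [QP sP]]] := exists_patches A B M_compact ch.
(* The statement is strengthened for the induction on the list: the maps may differ only on the
   cores of the listed patches, which is no restriction for the full cover. *)
suff [S [oS Sh H]] : exists S : set (M * N), [/\ open S, forall x, S (x, h x) &
    forall chi0 chi1, smooth_map A B chi0 -> smooth_map A B chi1 ->
      (forall x, S (x, chi0 x)) -> (forall x, S (x, chi1 x)) ->
      (forall x, chi0 x = chi1 x \/ exists2 z, z \in s & patch_core (Q z) x) ->
      pairing chi0 = pairing chi1].
  exists S; split; [exact: oS|exact: Sh|move=> chi0 chi1 sm0 sm1 S0 S1].
  apply: (H _ _ sm0 sm1 S0 S1) => x; right.
  by have [z zs xz] := sP x; exists z => //; exact: nbhs_singleton xz.
elim: s {sP} => [|z s [S [oS Sh H]]].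
  exists setT; split; [exact: openT|by []|move=> chi0 chi1 _ _ _ _ E].
  suff -> : chi0 = chi1 by [].
  by apply/funext => x; have [|[]] := E x.
have [okz dh] := QP z; have [Ac Bd r0 bc] := okz.
have [e e0 eP] := graph_tube M_compact okz ch oS Sh dh.
set c := patch_chart (Q z) in Ac bc; set d := patch_target (Q z) in Bd dh eP.
set a := patch_center (Q z) in bc; set r := patch_radius (Q z) in r0 bc.
have bc2 := box2_sub r0 bc.
have e5 : 0 < e / 5 by rewrite divr_gt0.
(* Keeps both maps within [e / 5] of [h] over the box, so that by [segment_dist] the segments
   joining them stay in the chart. *)
pose V := [set p : M * N | cdom d p.2 /\ `|cmap d p.2 - cmap d (h p.1)| < e / 5].
exists (S `&` [set p | patch_box (Q z) p.1 -> V p]); split.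
- apply: openI => //; apply: (open_patch_rel okz) => -[x y] bx [/= dy Vxy].
  have c1 : {for (x, y), continuous (fun p : M * N => cmap d p.2)}.
    have cs : {for (x, y), continuous (@snd M N)} by exact: cvg_snd.
    exact: (continuous_comp cs (cmap_continuous dy)).
  have c2 : {for (x, y), continuous (fun p : M * N => cmap d (h p.1))}.
    have cf : {for (x, y), continuous (@fst M N)} by exact: cvg_fst.
    exact: (continuous_comp cf (continuous_comp (ch x) (cmap_continuous (dh x bx)))).
  have c3 : `|cmap d p.2 - cmap d (h p.1)| @[p --> (x, y)] --> `|cmap d y - cmap d (h x)|.
    by apply: cvg_norm; apply: cvgB; [exact: c1|exact: c2].
  have n1 : \forall p \near (x, y), cdom d p.2.
    by apply: near_snd; exact: nbhs_cdom.
  exact: (filterI n1 (cvgr_lt _ c3 _ Vxy)).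
- by move=> x; split=> // bx; split=> /=; [exact: dh|rewrite subrr normr0].
move=> chi0 chi1 sm0 sm1 S0 S1 E.
have [c0 s0] := (smooth_mapP A B chi0).1 sm0.
have [c1 s1] := (smooth_mapP A B chi1).1 sm1.
have V0 x : patch_box (Q z) x -> V (x, chi0 x) by have [_] := S0 x.
have V1 x : patch_box (Q z) x -> V (x, chi1 x) by have [_] := S1 x.
pose y := cmap d \o chi1 \o cinv c.
have yE x : patch_box (Q z) x -> y (cmap c x) = cmap d (chi1 x).
  by move=> [cx _]; rewrite /y /= cmapK.
have sy x : patch_box (Q z) x -> smooth_at y (cmap c x).
  by move=> bx; have [cx _] := bx; have [d1 _] := V1 x bx; exact: s1.
have coord_dist x : patch_box (Q z) x ->
    `|blend_coord c d a r chi0 y x - cmap d (h x)| < e / 5.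
  move=> bx; have [_ h0] := V0 x bx; have [_ h1] := V1 x bx.
  by apply: blend_coord_dist => //; rewrite yE.
have e5e : e / 5 < e by rewrite ltr_pdivrMr// ltr_pMr// ltr1n.
have coordP x : patch_box (Q z) x -> cimg d (blend_coord c d a r chi0 y x) /\
    S (x, cinv d (blend_coord c d a r chi0 y x)).
  by move=> bx; apply: eP => //; exact: lt_trans (coord_dist x bx) e5e.
have cimgb x (bx : cbox c a (2 * r) x) := (coordP x bx).1.
have d0 x : cbox c a (2 * r) x -> cdom d (chi0 x) by move=> /V0[].
(* The intermediate map, equal to [chi1] on the core of this patch and to [chi0] off its box.
   Passing from [chi0] to [chi] is a single segment move; from [chi] to [chi1] only the remaining
   patches matter. *)
pose chi := blend c d a r chi0 y.
have blendP x : patch_box (Q z) x -> cdom d (chi x) /\ cmap d (chi x) = blend_coord c d a r chi0 y x.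
  by move=> bx; apply: (blend_dom d0 cimgb).
have cchi : continuous chi.
  apply: (blend_continuous Ac r0 bc c0 d0 cimgb) => u bu.
  have [cx xE] := cimgP (bc2 _ bu); rewrite -xE; apply: smooth_at_cont; apply: sy.
  by split=> //; rewrite -/c xE.
have smchi : smooth_map A B chi.
  apply: smooth_map_local => // x; have sx := smooth_map_point x sm0.
  have [bx|nx] := pselect (patch_box (Q z) x).
    exact: (smooth_point_blend_in Ac Bd c0 d0 cimgb bx (sy x bx) sx).
  exact: (smooth_point_blend_out d r0 bc y nx sx).
have Schi x : S (x, chi x).
  have [bx|nx] := pselect (patch_box (Q z) x); last by rewrite /chi blend_out//; have [] := S0 x.
  by rewrite /chi blendE; [exact: (coordP x bx).2|exact: d0].
have <- : pairing chi = pairing chi0.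
  apply: (pairing_step M_compact gr mu_volume w_symplectic phi_smooth phi_density
    sm0 smchi Ac Bd r0 bc).
  - by move=> x nx; rewrite /chi blend_out.
  - move=> u ur; have bu : box a (2 * r) u by rewrite /box /= ur.
    by have [cx xE] := cimgP (bc2 _ bu); exact: blend_bd.
  - exact: d0.
  - by move=> x /blendP[].
  - move=> t x ht bx; have [_ ->] := blendP x bx.
    exact: (eP x _ bx (segment_dist e0 ht (V0 x bx).2 (coord_dist x bx))).1.
apply: (H chi chi1 smchi sm1 Schi (fun x => (S1 x).1)) => x.
have [bx|nx] := pselect (patch_box (Q z) x); last first.
  rewrite /chi blend_out//; have [|[t]] := E x; first by left.
  rewrite in_cons => /orP[/eqP ->|ts] tx; last by right; exists t.
  exfalso; apply: nx; have [cx bx] := tx.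
  by split=> //; apply: box_sub bx; rewrite ler_peMl// ?ler1n// ltW.
have [d1 _] := V1 x bx.
have core : patch_core (Q z) x -> chi x = chi1 x.
  by move=> xz; rewrite /chi (blendE _ _ _ _ (d0 x bx)) blend_core// yE// cmapK.
have [E01|[t]] := E x.
  left; rewrite /chi (blendE _ _ _ _ (d0 x bx)) /blend_coord yE// E01 subrr scaler0 addr0.
  by rewrite cmapK.
rewrite in_cons => /orP[/eqP ->|ts] tx; first by left; exact: core.
by right; exists t.
Qed.

End Homotopy.

Section TimeParameter.
Context {R : realType}.

(** Connectedness of the line, obtained from the vanishing derivative. *)
Lemma locally_constant_eq (J : R -> R) s t : (forall x, \forall y \near x, J y = J x) -> J s = J t.
Proof.
move=> lc; apply: is_derive_0_is_cst => x.
have E : \forall y \near x, cst (J x) y = J y by apply: filterS (lc x) => y ->.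
split.
  exact: (near_eq_derivable E (derivable_cst (J x) x 1)).
by rewrite -(near_eq_derive (1 : R) E) derive_cst.
Qed.

(* Extends the homotopy to all times, so that local constancy can be used on R. *)
Definition clamp (t : R) : R := Num.max 0 (Num.min t 1).

Lemma clamp_itv t : 0 <= clamp t <= 1.
Proof.
rewrite /clamp le_max lexx /= ge_max ler01 /= ge_min lexx orbT //.
Qed.

Lemma clamp_id t : 0 <= t <= 1 -> clamp t = t.
Proof. by move=> /andP[t0 t1]; rewrite /clamp min_l// max_r. Qed.

Lemma clamp_continuous : continuous clamp.
Proof.
move=> t.
have c1 : {for t, continuous (id \min cst (1 : R))}.
  by apply: (@continuous_min R R id (cst 1)); [exact: cvg_id|exact: cvg_cst].
have c0 : {for t, continuous (cst (0 : R) : R -> R)} by exact: cvg_cst.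
exact: (@continuous_max R R _ _ t c0 c1).
Qed.

Context {M N : topologicalType}.

Lemma clamp_homotopy_continuous (H : R -> M -> N) :
  {within `[0, 1] `*` [set: M], continuous (fun p : R * M => H p.1 p.2)} ->
  forall t x, {for (t, x), continuous (fun p : R * M => H (clamp p.1) p.2)}.
Proof.
move=> /subspace_continuousP cH t x P nP.
have inI s z : (`[0, 1] `*` [set: M]) (clamp s, z) by split=> //=; rewrite in_itv /= clamp_itv.
have cc : {for (t, x), continuous (fun p : R * M => (clamp p.1, p.2))}.
  move=> Q [[Q1 Q2] /= [n1 n2] HQ].
  exists (clamp @^-1` Q1, Q2) => /=; first by split=> //; exact: clamp_continuous.
  by move=> [s z] [/= h1 h2]; apply: HQ; split.
have := cH (clamp t, x) (inI t x) P nP; rewrite /nbhs /= => h.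
have h1 : \forall p \near (clamp t, x), (`[0, 1] `*` [set: M]) p -> P (H p.1 p.2) by exact: h.
have h2 : \forall p \near (t, x), (`[0, 1] `*` [set: M]) (clamp p.1, p.2) -> P (H (clamp p.1) p.2).
  exact: (cc _ h1).
suff : \forall p \near (t, x), P (H (clamp p.1) p.2) by [].
by apply: filterS h2 => -[s z] /= /(_ (inI s z)).
Qed.

End TimeParameter.

(** The pointwise inequality |p - q|^2 >= 0 for 2-forms on a surface with coefficients [p] and [q],
    where [e] stands for det g. *)
Lemma square_gap (R : realFieldType) (p q e : R) : 0 < e -> 0 <= p * p / e - p * q / e - (p * q / e - q * q / e).
Proof.
move=> e0; rewrite -!mulrBl; apply: divr_ge0; last exact: ltW.
have -> : p * p - p * q - (p - q) * q = (p - q) ^+ 2 by ring.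
exact: sqr_ge0.
Qed.

Lemma half_gap (R : realFieldType) (x y z : R) : 0 <= x - y - (y - z) -> y = z -> 2^-1 * z <= 2^-1 * x.
Proof. by move=> h yz; rewrite yz in h; rewrite ler_pM2l ?invr_gt0//; lra. Qed.

(** * Invariance along a homotopy and minimality *)

Section HomotopyInvariance.
Context {R : realType} {M : ptopologicalType} {N : topologicalType} {n : nat}.
Variables (A : manifold R 2 M) (g : tensor2 A) (B : manifold R n N) (w : tensor2 B).
Hypotheses (M_compact : compact [set: M]) (gr : riemannian g).
Variable mu : {measure set (borel_space M) -> \bar R}.
Hypothesis mu_volume : riemannian_volume g mu.
Hypothesis w_symplectic : symplectic w.
Variable phi : M -> N.
Hypothesis phi_smooth : smooth_map A B phi.
Hypothesis phi_density : forall c u i, atlas A c -> cimg c u ->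
  'D_(e_ i) (density g w phi c) u = 0.

Local Notation pairing := (pairing g w mu phi).

(** Tube lemma in the time direction: each point of M has a product neighbourhood that works, and
    compactness leaves finitely many time intervals to intersect. *)
Lemma near_graph (K : R -> M -> N) (S : set (M * N)) t :
  (forall t x, {for (t, x), continuous (fun p : R * M => K p.1 p.2)}) ->
  open S -> (forall x, S (x, K t x)) -> \forall s \near t, forall x, S (x, K s x).
Proof.
move=> cK oS St.
have loc (x : M) : exists UP : set R * set M, [/\ nbhs t UP.1, nbhs x UP.2 &
    forall s z, UP.1 s -> UP.2 z -> S (z, K s z)].
  have nS : nbhs (x, K t x) S by apply: open_nbhs_nbhs.
  have cc : {for (t, x), continuous (fun p : R * M => (p.2, K p.1 p.2))}.
    move=> Q [[Q1 Q2] /= [n1 n2] HQ].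
    have m1 : \forall p \near (t, x), Q1 p.2 by exact: near_snd.
    apply: filterS (filterI m1 (cK t x Q2 n2)) => p [h1 h2].
    exact: (HQ (p.2, K p.1 p.2)).
  have [[U P] /= [nU nP] UP] := cc S nS.
  by exists (U, P); split=> // s z Us Pz; exact: (UP (s, z)).
have [UP UPP] := choice loc.
have [l lP] : exists l : seq M, forall x, exists2 z, z \in l & (UP z).2 x.
  by apply: (compact_nbhs_cover M_compact) => z; have [] := UPP z.
have nl : \forall s \near t, forall z, z \in l -> (UP z).1 s.
  elim: l {lP} => [|z l IH].
    have nT : nbhs t [set: R] by exact: filterT.
    by apply: filterS nT => s _ y; rewrite in_nil.
  have [nz _ _] := UPP z.
  apply: filterS (filterI nz IH) => s [zs ls] y; rewrite in_cons => /orP[/eqP ->//|]; exact: ls.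
apply: filterS nl => s sl x; have [z zl zx] := lP x.
by have [_ _ h] := UPP z; apply: h => //; exact: sl.
Qed.

(** To each time is attached the pairing of some smooth map near that stage, a value independent of
    the choice by [pairing_locally_constant]. It is locally constant in time, and at the end stages
    the smooth maps [phi] and [psi] themselves can be chosen. *)
Lemma pairing_homotopic psi : smooth_map A B psi -> homotopic (R := R) phi psi ->
  pairing psi = pairing phi.
Proof.
move=> psi_smooth [H [cH H0 H1]].
pose K t x := H (clamp t) x.
have cK t x : {for (t, x), continuous (fun p : R * M => K p.1 p.2)}.
  exact: clamp_homotopy_continuous.
have cKt t : continuous (K t).
  move=> x P nP; have [[U V] /= [nU nV] UV] := cK t x P nP.
  by apply: filterS nV => z Vz; apply: (UV (t, z)); split=> //=; exact: nbhs_singleton nU.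
have [S SP] := choice (fun t => pairing_locally_constant M_compact gr mu_volume
  w_symplectic phi_smooth phi_density (cKt t)).
have dense t : exists chi, smooth_map A B chi /\ forall x, S t (x, chi x).
  by have [oS Sh _] := SP t; exact: (smooth_map_dense A B M_compact (cKt t) oS Sh).
have [chi chiP] := choice dense.
have JE t chi' : smooth_map A B chi' -> (forall x, S t (x, chi' x)) -> pairing (chi t) = pairing chi'.
  move=> sm' S'; have [_ _ h] := SP t; have [smt St] := chiP t.
  exact: (h _ _ smt sm' St S').
have <- : pairing (chi 1) = pairing psi.
  apply: (JE 1 psi psi_smooth) => x.
  by have [_ Sh _] := SP 1; have := Sh x; rewrite /K clamp_id ?H1// ler01 lexx.
have <- : pairing (chi 0) = pairing phi.
  apply: (JE 0 phi phi_smooth) => x.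
  by have [_ Sh _] := SP 0; have := Sh x; rewrite /K clamp_id ?H0// ler01 lexx.
apply: (locally_constant_eq (J := fun t => pairing (chi t))) => t.
have [oS Sh _] := SP t.
apply: filterS (near_graph cK oS Sh) => s Ss.
have [oSs Shs _] := SP s.
(* A smooth map close to stage [s] for both neighbourhoods [S t] and [S s] at once computes the
   value attached to either time. *)
have [chi' [sm' S']] := smooth_map_dense A B M_compact (cKt s) (openI oS oSs) (fun x => conj (Ss x) (Shs x)).
apply: (etrans (JE s chi' sm' (fun x => (S' x).2))).
exact: (esym (JE t chi' sm' (fun x => (S' x).1))).
Qed.

(** Let Q11, Q10, Q00 be the integrals of |psi^*w|^2, <psi^*w, phi^*w> and |phi^*w|^2. Then (Q11 -
    Q10) - (Q10 - Q00) >= 0 as the integral of a square, and Q10 = Q00 by homotopy invariance,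
    whence Q00 <= Q11. *)
Lemma energy_homotopic psi : smooth_map A B psi -> homotopic (R := R) phi psi ->
  energy g mu w phi <= energy g mu w psi.
Proof.
move=> psi_smooth hom.
have wa := symplectic_antisym w_symplectic.
have f0 := form2_pull wa phi_smooth; have f1 := form2_pull wa psi_smooth.
have c11 := inner2_continuous gr f1 f1.
have c10 := inner2_continuous gr f1 f0.
have c00 := inner2_continuous gr f0 f0.
have E := pairing_homotopic psi_smooth hom.
pose q11 := inner2 g (pullback psi w) (pullback psi w).
pose q10 := inner2 g (pullback psi w) (pullback phi w).
pose q00 := inner2 g (pullback phi w) (pullback phi w).
have cB (p q : M -> R) : continuous p -> continuous q -> continuous (fun x => p x - q x).
  by move=> cp cq x; apply: cvgB; [exact: cp|exact: cq].
have I : 0 <= \int[mu]_x ((q11 x - q10 x) - (q10 x - q00 x)).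
  apply: Rintegral_ge0 => x _; have [Ad dx] := chart_atP A x.
  have e11 := inner2E gr f1 f1 Ad dx; have e10 := inner2E gr f1 f0 Ad dx.
  have e00 := inner2E gr f0 f0 Ad dx.
  have e := f_equal2 (fun y z => y - z) (f_equal2 (fun y z => y - z) e11 e10)
    (f_equal2 (fun y z => y - z) e10 e00).
  apply: (eq_ind _ (fun z => 0 <= z) _ _ (esym e)).
  exact: (square_gap _ _ (metric_det_gt0 gr Ad dx)).
have EI := etrans
  (RintegralB_continuous M_compact gr mu_volume (cB _ _ c11 c10) (cB _ _ c10 c00))
  (f_equal2 (fun y z => y - z) (RintegralB_continuous M_compact gr mu_volume c11 c10)
    (RintegralB_continuous M_compact gr mu_volume c10 c00)).
exact: (half_gap (eq_ind _ (fun z => 0 <= z) I _ EI) E).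
Qed.

End HomotopyInvariance.

Theorem theorem2p7 (R : realType)
    (M : ptopologicalType) (A : manifold R 2 M)
    (M_compact : compact [set: M]) (M_oriented : oriented A)
    (g : tensor2 A) (g_riemannian : riemannian g)
    (mu : {measure set (borel_space M) -> \bar R})
    (mu_volume : riemannian_volume g mu)
    (n : nat) (N : topologicalType) (B : manifold R n N)
    (w : tensor2 B) (w_symplectic : symplectic w)
    (phi : M -> N) (phi_smooth : smooth_map A B phi)
    (phi_critical : critical_point g mu w phi) :
  coclosed g mu (pullback phi w) /\
  (forall psi : M -> N, smooth_map A B psi -> homotopic (R := R) phi psi ->
     energy g mu w phi <= energy g mu w psi).
Proof.
have wa := symplectic_antisym w_symplectic.
have D c u i : atlas A c -> cimg c u -> 'D_(e_ i) (density g w phi c) u = 0.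
  exact: (density_derive0 M_compact g_riemannian mu_volume wa phi_smooth phi_critical).
split; first exact: (pullback_coclosed M_compact g_riemannian mu_volume wa phi_smooth D).
exact: (energy_homotopic M_compact g_riemannian mu_volume w_symplectic phi_smooth D).
Qed.
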